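(* There is an algorithm that, given a non-zero $a \in \mathbb{Z}^n$ and $b\in\mathbb{Z}$, enumerates all vertices of the integer hull $\mathcal{P}_I = \operatorname{Conv}(\{x\in\mathbb{R}^n : a^\top x = b,\ x\ge 0\}\cap\mathbb{Z}^n)$ in time $(n\cdot\log(\Delta))^{O(\log(\Delta))}$, where $\Delta=\lVert a\rVert_\infty$.
   Context: All logarithms are base 2; the $O(\cdot)$ hides an absolute constant. A vertex of $\mathcal{P}_I$ is a point $v\in\mathcal{P}_I$ with $v\notin\operatorname{Conv}(\mathcal{P}_I\setminus\{v\})$.
   Formalization: Time counts unit-cost integer operations (addition, subtraction, division, comparison), since bit time must depend on b; in the bound, log Δ is read as at least 1 and the base n·log Δ as at least 2, because the literal formula fails for Δ = 1 and for n = 1, Δ = 2. *)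

(* Defs.v *)
From HB Require Import structures.
From mathcomp Require Import all_boot all_order all_algebra archimedean.
From mathcomp Require Import boolp classical_sets reals exp.

Set Implicit Arguments.
Unset Strict Implicit.
Unset Printing Implicit Defensive.

Import Order.TTheory GRing.Theory Num.Theory.
Local Open Scope classical_set_scope.
Local Open Scope ring_scope.

(** * Integer hull *)

Definition conv (R : realType) (V : lmodType R) (S : set V) : set V :=
  [set x | exists (k : nat) (w : 'I_k -> R) (y : 'I_k -> V),
    [/\ forall i, 0 <= w i, \sum_(i < k) w i = 1, forall i, S (y i)
      & x = \sum_(i < k) w i *: y i]].

Definition is_vertex (R : realType) (V : lmodType R) (P : set V) (v : V) : Prop :=
  P v /\ ~ conv (P `\ v) v.

Definition knapsack (R : realType) (n : nat) (a : 'cV[int]_n) (b : int)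
    : set 'cV[R]_n :=
  [set x | \sum_(i < n) (a i 0)%:~R * x i 0 = b%:~R /\ forall i, 0 <= x i 0].

Definition int_points (R : realType) (n : nat) : set 'cV[R]_n :=
  [set x | forall i, x i 0 \is a Num.int].

Definition int_hull (R : realType) (n : nat) (a : 'cV[int]_n) (b : int)
    : set 'cV[R]_n :=
  conv (knapsack a b `&` @int_points R n).

(** * Machine model

   A structured random-access machine: while-programs over finitely many named
   arrays of unbounded integers, addressed indirectly by integers ([Get k e] is
   cell [e] of array [k]; a scalar variable is a cell at a fixed address), with
   a write-only output tape.  Arithmetic operations have unit cost, since a
   running time that does not depend on [b] cannot account for the bits of [b].
   Multiplication is deliberately not an instruction: with addition,
   subtraction and Euclidean division only, [t] steps lengthen the integers by
   O(t) bits, so that unit cost is polynomially related to Turing machine time,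
   which fails when multiplication has unit cost. *)

Inductive expr : Type :=
| Cst of int
| Get of nat & expr
| Plus of expr & expr
| Minus of expr & expr
| Quo of expr & expr
| Rem of expr & expr.

Inductive cmd : Type :=
| Skip
| Put of nat & expr & expr
| Emit of expr
| Seq of cmd & cmd
| IfLe of expr & expr & cmd & cmd
| WhileLe of expr & expr & cmd.

Definition memory : Type := nat -> int -> int.

Record state : Type := State { store : memory; out : seq int }.

Definition update (m : memory) (k : nat) (i x : int) : memory :=
  fun k' i' => if (k' == k) && (i' == i) then x else m k' i'.

Fixpoint eval (m : memory) (e : expr) : int :=
  match e with
  | Cst z => z
  | Get k e1 => m k (eval m e1)
  | Plus e1 e2 => eval m e1 + eval m e2
  | Minus e1 e2 => eval m e1 - eval m e2
  | Quo e1 e2 => (eval m e1 %/ eval m e2)%Z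
  | Rem e1 e2 => (eval m e1 %% eval m e2)%Z
  end.

Fixpoint cost (e : expr) : nat :=
  match e with
  | Cst _ => 1
  | Get _ e1 => (cost e1).+1
  | Plus e1 e2 | Minus e1 e2 | Quo e1 e2 | Rem e1 e2 => (cost e1 + cost e2).+1%N
  end.

(* [exec c s t s'] : started in [s], [c] halts in [s'] after [t] steps. *)
Inductive exec : cmd -> state -> nat -> state -> Prop :=
| exec_skip s :
    exec Skip s 1 s
| exec_put k e1 e2 s :
    exec (Put k e1 e2) s (cost e1 + cost e2).+1%N
      (State (update (store s) k (eval (store s) e1) (eval (store s) e2)) (out s))
| exec_emit e s :
    exec (Emit e) s (cost e).+1 (State (store s) (rcons (out s) (eval (store s) e)))
| exec_seq c1 c2 s t1 s1 t2 s2 :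
    exec c1 s t1 s1 -> exec c2 s1 t2 s2 -> exec (Seq c1 c2) s (t1 + t2)%N s2
| exec_if_true e1 e2 c1 c2 s t s' :
    eval (store s) e1 <= eval (store s) e2 -> exec c1 s t s' ->
    exec (IfLe e1 e2 c1 c2) s (cost e1 + cost e2 + t).+1%N s'
| exec_if_false e1 e2 c1 c2 s t s' :
    eval (store s) e2 < eval (store s) e1 -> exec c2 s t s' ->
    exec (IfLe e1 e2 c1 c2) s (cost e1 + cost e2 + t).+1%N s'
| exec_while_true e1 e2 c s t1 s1 t2 s2 :
    eval (store s) e1 <= eval (store s) e2 -> exec c s t1 s1 ->
    exec (WhileLe e1 e2 c) s1 t2 s2 ->
    exec (WhileLe e1 e2 c) s (cost e1 + cost e2 + t1 + t2).+1%N s2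
| exec_while_false e1 e2 c s :
    eval (store s) e2 < eval (store s) e1 ->
    exec (WhileLe e1 e2 c) s (cost e1 + cost e2).+1%N s.

(* Array 0 holds [n, b], array 1 holds [a]; every other cell is 0. *)
Definition input (n : nat) (a : 'cV[int]_n) (b : int) : state :=
  State (fun k i =>
    match k, i with
    | 0%N, Posz 0 => n%:Z
    | 0%N, Posz 1 => b
    | 1%N, Posz j => if insub j is Some i' then a i' 0 else 0
    | _, _ => 0
    end) [::].

Definition encode (n : nat) (vs : seq 'cV[int]_n) : seq int :=
  flatten [seq [seq v i 0 | i <- enum 'I_n] | v : 'cV[int]_n <- vs].

(* [c] prints [vs] coordinate by coordinate and halts after [t] steps. *)
Definition enumerates (c : cmd) (n : nat) (a : 'cV[int]_n) (b : int)
    (vs : seq 'cV[int]_n) (t : nat) : Prop :=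
  exists2 s : state, exec c (input a b) t s & out s = encode vs.

(** * Running time *)

Definition norm_oo (n : nat) (a : 'cV[int]_n) : nat :=
  (\max_(i < n) `|a i ord0|)%N.

Definition log2 (R : realType) (x : R) : R := ln x / ln 2.

(* (n log D)^(C log D), with log D clamped to be at least 1 and the base to be
   at least 2.  This changes the value only for D = 1, where log D = 0, and for
   n = 1, D <= 3, where the base is below 2. *)
Definition time_bound (R : realType) (C n D : nat) : R :=
  let L := Num.max 1 (log2 (D%:R : R)) in
  (Num.max 2 (n%:R * L)) `^ (C%:R * L).

(* Main.v *)
Require Import Defs.
From HB Require Import structures.
From mathcomp Require Import all_boot all_order all_algebra archimedean.
From mathcomp Require Import perm zify ring lra.
From mathcomp Require Import boolp classical_sets reals exp.

Set Implicit Arguments.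
Unset Strict Implicit.
Unset Printing Implicit Defensive.

Import Order.TTheory GRing.Theory Num.Theory.
Local Open Scope ring_scope.

(* Write S = n * D. A point of the knapsack that is not the midpoint of two
   others has, off a coordinate where it is largest, entries w with
   prod (1 + w_j) <= 4 D^2: otherwise two different vectors of the box [0, u]
   have the same scalar product with a, by the pigeonhole principle. There are
   at most (4 D^2)^2 (n + 1)^(log (4 D^2)) such w, and w and b determine the
   remaining coordinate, which gives a list of candidates containing all
   vertices.

   A candidate v is a vertex if and only if some integer vector c is uniquely
   minimised by v over the solutions. Kernel vectors of a decompose conformally
   into kernel vectors with entries at most n D^2, so truncating the entries of
   v at S^2 does not change the answer, and for positive c it suffices to
   compare the truncation with the candidates of its own right-hand side. This
   leaves a system of strict linear inequalities in c whose coefficients are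
   bounded independently of b. It is decided by a Yamnitsky-Levin method: a
   simplicial cone containing all feasible c is cut by a violated inequality
   and replaced with a smaller one. If the system is feasible, it has a basic
   solution with bounded entries, so that the cones cannot become too small;
   after 2200 S^8 rounds of cuts the candidate is therefore rejected. *)

(** * Simplicial cones *)

(** The obstacle is that the running time must not depend on [b], whereas solutions have entries as
    long as [b] and the machine cannot multiply. Every product of the program has one short factor
    (an entry of [a] or of a generator, a rounded cut coefficient) and is computed by that many
    additions of the other factor, which may have any length. This is why a simplicial cone is cut
    and not an ellipsoid: the update combines rows with integer coefficients of size O(S^3) and
    takes no roots. The cone matrix is never normalised; only the ratio of its determinant to the
    n-th power of the common row sum is controlled. For an integer solution three properties are
    linked in a cycle: a vertex is not [averaged], a solution that is not [averaged] is [certified]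
    by Gordan's alternative, and a [certified] solution is a vertex. The program is shown to decide
    [certified]. Truncation at S^2 is allowed because n D^2 <= S^2. *)

Lemma ler_prod_1D (R : realFieldType) (I : Type) (s : seq I) (x : I -> R) :
  \sum_(i <- s) `|x i| <= 1 ->
  1 + \sum_(i <- s) x i - (\sum_(i <- s) `|x i|) ^+ 2 <= \prod_(i <- s) (1 + x i).
Proof.
elim: s => [|i s IH]; first by rewrite !big_nil; lra.
rewrite !big_cons => h.
have a0 : 0 <= \sum_(j <- s) `|x j| by apply: sumr_ge0.
have x0 := normr_ge0 (x i).
have hS : \sum_(j <- s) `|x j| <= 1 by lra.
have {IH} := IH hS.
have hx : `|\sum_(j <- s) x j| <= \sum_(j <- s) `|x j| by apply: ler_norm_sum.
move: hx hS a0 x0 h; set A := \sum_(j <- s) `|x j|; set B := \sum_(j <- s) x j.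
set p := \prod_(j <- s) _; set y := x i => hx hS a0 x0 h IH.
have y1 : 0 <= 1 + y by move: (ler_norm (- y)); rewrite normrN; lra.
apply: le_trans (ler_wpM2l y1 IH).
have h1 : - (`|y| * A) <= y * B.
  rewrite lerNl; apply: le_trans (ler_norm _) _.
  by rewrite normrN normrM; apply: ler_wpM2l.
have h2 : y * A ^+ 2 <= `|y| * A.
  apply: le_trans (_ : `|y| * A ^+ 2 <= _).
    by apply: ler_wpM2r; [apply: sqr_ge0|apply: ler_norm].
  by apply: ler_wpM2l => //; rewrite expr2 -{3}[A]mulr1; apply: ler_wpM2l.
have h3 : 0 <= `|y| ^+ 2 by apply: sqr_ge0.
nra.
Qed.

(** Weaker than Hadamard's inequality but free of square roots: multiplying out the product of row
    sums gives one term for every map of the indices, and the permutations are among these maps. *)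
Lemma ler_det_prod_sum (R : numDomainType) (n : nat) (A : 'M[R]_n) :
  `|\det A| <= \prod_i \sum_j `|A i j|.
Proof.
rewrite bigA_distr_bigA /=.
apply: le_trans (ler_norm_sum _ _ _) _.
pose h (s : 'S_n) : {ffun 'I_n -> 'I_n} := finfun s.
have E (s : 'S_n) : `|(-1) ^+ s * \prod_i A i (s i)| = \prod_i `|A i (h s i)|.
  rewrite normrM normrX normrN1 expr1n mul1r normr_prod.
  by apply: eq_bigr => i _; rewrite ffunE.
rewrite (eq_bigr _ (fun s _ => E s)).
have inj : injective h.
  by move=> s t /ffunP st; apply/permP => i; have := st i; rewrite !ffunE.
rewrite -(big_imset (fun f : {ffun 'I_n -> 'I_n} => \prod_i `|A i (f i)|)) /=; last first.
  by move=> s t _ _; apply: inj.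
rewrite [X in _ <= X](bigID (mem (h @: 'S_n))) /= lerDl.
by apply: sumr_ge0 => f _; apply: prodr_ge0.
Qed.

(* Row [r] becomes [D] times row [r] plus [m] times row [k]; scaling the other
   rows by [D + m] keeps the row sums equal to each other. *)
Definition elem (n : nat) (D : int) (k r : 'I_n) (m : int) (U : 'M[int]_n)
    : 'M[int]_n :=
  \matrix_(i, j) ((D + m) * U i j + (if i == r then m * (U k j - U r j) else 0)).

Lemma det_elem (n : nat) (D : int) (k r : 'I_n) (m : int) (U : 'M[int]_n) :
  \det (elem D k r m U) =
  (D + (if r == k then m else 0)) * (D + m) ^+ n.-1 * \det U.
Proof.
pose B : 'M[int]_n := \matrix_(i, j) (if i == r then U r j else (D + m) * U i j).
pose C : 'M[int]_n := \matrix_(i, j) (if i == r then U k j else (D + m) * U i j).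
have dB : \det B = (D + m) ^+ n.-1 * \det U.
  pose d : 'rV[int]_n := \row_i (if i == r then 1 else D + m).
  have -> : B = diag_mx d *m U.
    apply/matrixP => i j; rewrite mul_diag_mx !mxE.
    by case: eqP => [->|_]; rewrite ?mul1r.
  rewrite det_mulmx det_diag (bigD1 r) //= mxE eqxx mul1r; congr (_ * _).
  transitivity (\prod_(i < n | i != r) (D + m)).
    by apply: eq_bigr => i /negPf ir; rewrite mxE ir.
  rewrite prodr_const; congr (_ ^+ _).
  by rewrite cardC1 card_ord.
have E : \det (elem D k r m U) = D * \det B + m * \det C.
  apply: (@determinant_multilinear _ _ _ _ _ r).
  - by apply/rowP => j; rewrite !mxE eqxx; ring.
  - by apply/matrixP => i j; rewrite !mxE eq_sym (negPf (neq_lift _ _)) addr0.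
  - by apply/matrixP => i j; rewrite !mxE eq_sym (negPf (neq_lift _ _)) addr0.
rewrite E; case: eqP => [rk|/eqP rk].
  have -> : C = B by apply/matrixP => i j; rewrite !mxE rk.
  by rewrite dB; ring.
suff -> : \det C = 0 by rewrite dB; ring.
(* Rows [r] and [k] of [C] are proportional. Scaling row [r] by [D + m] makes them equal, which
   determines [\det C] only if [D + m] is non-zero; otherwise row [k] vanishes. *)
have [Dm0|Dm0] := eqVneq (D + m) 0.
  rewrite (expand_det_row _ k) big1 // => j _.
  by rewrite mxE eq_sym (negPf rk) Dm0 !mul0r.
pose C' : 'M[int]_n := \matrix_(i, j) (if i == r then (D + m) * U k j else (D + m) * U i j).
have C'0 : \det C' = 0.
  apply: (determinant_alternate rk) => j; rewrite !mxE eqxx.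
  by rewrite eq_sym (negPf rk).
have : \det C' = (D + m) * \det C + 0 * \det C.
  apply: (@determinant_multilinear _ _ _ _ _ r).
  - by apply/rowP => j; rewrite !mxE eqxx; ring.
  - by apply/matrixP => i j; rewrite !mxE eq_sym (negPf (neq_lift _ _)).
  - by apply/matrixP => i j; rewrite !mxE eq_sym (negPf (neq_lift _ _)).
by move=> e; apply: (mulfI Dm0); rewrite mulr0; lra.
Qed.

(** Processing the pivot row itself does no harm: [elem] with [r = k] merely rescales the whole
    matrix. *)
Definition upd (n : nat) (D : int) (k : 'I_n) (m : 'I_n -> int) (U : 'M[int]_n)
    (s : seq 'I_n) : 'M[int]_n :=
  foldl (fun U r => elem D k r (m r) U) U s.

Lemma upd_pivot (n : nat) (D : int) (k : 'I_n) m (U : 'M[int]_n) s j :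
  upd D k m U s k j = \prod_(i <- s) (D + m i) * U k j.
Proof.
elim/last_ind: s => [|s r IH]; first by rewrite big_nil mul1r.
rewrite /upd foldl_rcons -/(upd D k m U s) big_rcons /= mxE IH.
by case: eqP => [<-|_]; rewrite ?IH; ring.
Qed.

Lemma upd_out (n : nat) (D : int) (k : 'I_n) m (U : 'M[int]_n) s r j :
  r \notin s -> upd D k m U s r j = \prod_(i <- s) (D + m i) * U r j.
Proof.
elim/last_ind: s => [|s x IH]; first by rewrite big_nil mul1r.
rewrite mem_rcons inE negb_or => /andP[/negPf rx rs].
rewrite /upd foldl_rcons -/(upd D k m U s) big_rcons /= mxE IH // rx.
ring.
Qed.

(** Row [r] becomes [D * U r + m r * U k] times the factors of all other rows; the extra [D + m r]
    on both sides avoids a division of integers. *)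
Lemma upd_in (n : nat) (D : int) (k : 'I_n) m (U : 'M[int]_n) s r j :
  uniq s -> r \in s ->
  (D + m r) * upd D k m U s r j =
  \prod_(i <- s) (D + m i) * (D * U r j + m r * U k j).
Proof.
elim/last_ind: s => [|s x IH] //.
rewrite rcons_uniq mem_rcons inE => /andP[xs us].
rewrite /upd foldl_rcons -/(upd D k m U s) big_rcons /= mxE.
case: (eqVneq r x) => [->|rx] /= => [_|rs].
  by rewrite upd_pivot (upd_out _ _ _ _ _ xs); ring.
by rewrite addr0 mulrCA IH //; ring.
Qed.

Lemma upd_rowsum (n : nat) (D Q : int) (k : 'I_n) m (U : 'M[int]_n) s :
  (forall r, \sum_j U r j = Q) ->
  forall r, \sum_j upd D k m U s r j = \prod_(i <- s) (D + m i) * Q.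
Proof.
move=> hQ; elim/last_ind: s => [|s x IH] r; first by rewrite big_nil mul1r.
rewrite /upd foldl_rcons -/(upd D k m U s) big_rcons /=.
under eq_bigr do rewrite mxE.
rewrite big_split /= -mulr_sumr IH.
case: eqP => _; last by rewrite big1_eq; ring.
by rewrite -mulr_sumr sumrB !IH; ring.
Qed.

Lemma upd_det (n : nat) (D : int) (k : 'I_n) m (U : 'M[int]_n) s :
  \det (upd D k m U s) =
  \prod_(r <- s) ((D + (if r == k then m r else 0)) * (D + m r) ^+ n.-1) * \det U.
Proof.
elim/last_ind: s => [|s x IH]; first by rewrite big_nil mul1r.
rewrite /upd foldl_rcons -/(upd D k m U s) big_rcons /= det_elem IH.
ring.
Qed.

(** * Volume gain of one cut *)

(** Relative to 50 S^3 the shifts sum to at least 1/(50 S^2), and their absolute values to at most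
    1/(10 S). The second-order estimate [ler_prod_1D] loses at most the square 1/(100 S^2), so half
    of the first-order gain survives. *)
Lemma prod_shift_gain (R : realFieldType) (I : eqType) (s : seq I) (S : nat) (x : I -> R) :
  (0 < S)%N -> \sum_(i <- s) `|x i| <= 5 * S%:R ^+ 2 -> S%:R <= \sum_(i <- s) x i ->
  (50 * S%:R ^+ 3) ^+ size s * (1 + (100 * S%:R ^+ 2)^-1) <=
  \prod_(i <- s) (50 * S%:R ^+ 3 + x i).
Proof.
move=> S0.
have : (1 : R) <= S%:R by rewrite ler1n.
move: (S%:R : R) => u u1 hA hB {S S0}.
have u0 : 0 < u by lra.
set D : R := 50 * u ^+ 3.
have D0 : 0 < D by rewrite mulr_gt0 ?exprn_gt0.
have E : \prod_(i <- s) (D + x i) = D ^+ size s * \prod_(i <- s) (1 + x i / D).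
  elim: s {hA hB} => [|i s IH]; first by rewrite !big_nil mulr1.
  rewrite !big_cons IH /= exprS.
  rewrite [X in _ = X](_ : _ = (D * (1 + x i / D)) * (D ^+ size s * \prod_(j <- s) (1 + x j / D))); last by ring.
  by congr (_ * _); rewrite mulrDr mulr1 mulrCA mulfV ?mulr1 // gt_eqF.
rewrite E ler_pM2l ?exprn_gt0 //.
have eA : \sum_(i <- s) `|x i / D| = (\sum_(i <- s) `|x i|) / D.
  rewrite mulr_suml; apply: eq_bigr => i _.
  by rewrite normrM normfV (gtr0_norm D0).
have eB : \sum_(i <- s) (x i / D) = (\sum_(i <- s) x i) / D by rewrite mulr_suml.
have -> : (100 * u ^+ 2)^-1 = (u^-1) ^+ 2 / 100 by field; rewrite gt_eqF.
have t0 : 0 < u^-1 by rewrite invr_gt0.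
have ut : u * u^-1 = 1 by rewrite mulfV // gt_eqF.
have t1 : u^-1 <= 1 by rewrite invf_le1.
move: (u^-1) t0 ut t1 => t t0 ut t1.
have hA' : \sum_(i <- s) `|x i / D| <= t / 10.
  rewrite eA ler_pdivrMr //; apply: le_trans hA _.
  have -> : t / 10 * D = 5 * (u * t) * u ^+ 2 by rewrite /D; field.
  by rewrite ut; lra.
have hB' : t ^+ 2 / 50 <= \sum_(i <- s) (x i / D).
  rewrite eB ler_pdivlMr //; apply: le_trans hB.
  have -> : t ^+ 2 / 50 * D = (u * t) ^+ 2 * u by rewrite /D; field.
  by rewrite ut; lra.
have hA1 : \sum_(i <- s) `|x i / D| <= 1 by lra.
apply: le_trans (ler_prod_1D hA1).
have hA0 : 0 <= \sum_(i <- s) `|x i / D| by apply: sumr_ge0.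
have hA2 : (\sum_(i <- s) `|x i / D|) ^+ 2 <= (t / 10) ^+ 2.
  by rewrite lerXn2r ?nnegrE //; lra.
have e : (t / 10) ^+ 2 = t ^+ 2 / 100 by field.
rewrite e in hA2.
lra.
Qed.

(** Here [h] is the cutting vector evaluated on the rows; let H be the sum of the [|h j|]. H plus
    the sum of [h] is twice the positive part, hence at most 2 n h_k, so the unrounded coefficients
    -4 S^2 h_i / H off the pivot sum to at least 2 S. Rounding down loses at most n - 1 < S. The
    absolute sum is at most 4 S^2 plus the same rounding loss. *)
Lemma pivot_arith (R : realFieldType) (n S : nat) (h m : 'I_n -> R) (k : 'I_n) :
  (n <= S)%N -> (forall i, h i <= h k) -> \sum_i h i <= 0 -> 0 < h k ->
  (forall i, m i * \sum_j `|h j| <= - (4 * S%:R ^+ 2 * h i)) ->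
  (forall i, - (4 * S%:R ^+ 2 * h i) <= (m i + 1) * \sum_j `|h j|) ->
  S%:R <= \sum_(i | i != k) m i /\ \sum_(i | i != k) `|m i| <= 5 * S%:R ^+ 2.
Proof.
move=> nS hk h0 k0 lo up.
have H0 : 0 < \sum_j `|h j|.
  rewrite (bigD1 k) //=; apply: ltr_wpDr; first exact: sumr_ge0.
  by rewrite normr_gt0 gt_eqF.
have hH : \sum_j `|h j| + \sum_j h j <= 2 * n%:R * h k.
  rewrite -big_split /=; apply: le_trans (_ : \sum_(i < n) (2 * h k) <= _).
    apply: ler_sum => i _; case: (lerP 0 (h i)) => hi.
      by rewrite ger0_norm //; have := hk i; lra.
    by rewrite ltr0_norm //; lra.
  by rewrite sumr_const card_ord -mulr_natr; lra.
have n1 : (1 <= n)%N by apply: leq_ltn_trans (ltn_ord k).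
have n1' : (1 : R) <= n%:R by rewrite ler1n.
have nS' : (n%:R : R) <= S%:R by rewrite ler_nat.
have cK : \sum_(i | i != k) (1 : R) = n%:R - 1.
  by rewrite sumr_const cardC1 card_ord -subn1 natrB.
have sk : \sum_i h i = h k + \sum_(i | i != k) h i by rewrite (bigD1 k).
have sH : \sum_i `|h i| = `|h k| + \sum_(i | i != k) `|h i| by rewrite (bigD1 k).
set H := \sum_j `|h j| in H0 hH lo up sH *.
set u : R := S%:R in nS' lo up *.
split.
  have : \sum_(i | i != k) - (4 * u ^+ 2 * h i) <= \sum_(i | i != k) (m i + 1) * H.
    by apply: ler_sum => i _; apply: up.
  rewrite sumrN -mulr_sumr -mulr_suml big_split /= cK.
  set A := \sum_(i | i != k) m i; set B := \sum_(i | i != k) h i in sk *.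
  move=> hAB; rewrite -(ler_pM2r H0).
  have : H <= 2 * u * (h k - \sum_i h i) by nra.
  rewrite sk => h2.
  have h3 : 2 * u * H <= 4 * u ^+ 2 * - B by nra.
  nra.
have : \sum_(i | i != k) `|m i| * H <= \sum_(i | i != k) (4 * u ^+ 2 * `|h i| + H).
  apply: ler_sum => i _; have := lo i; have := up i.
  have a1 : 4 * u ^+ 2 * h i <= 4 * u ^+ 2 * `|h i|.
    by apply: ler_wpM2l; [rewrite mulr_ge0 ?sqr_ge0|apply: ler_norm].
  have a2 : - (4 * u ^+ 2 * h i) <= 4 * u ^+ 2 * `|h i|.
    rewrite -mulrN; apply: ler_wpM2l; first by rewrite mulr_ge0 ?sqr_ge0.
    by rewrite -normrN; apply: ler_norm.
  by case: (lerP 0 (m i)) => mi; [rewrite ger0_norm|rewrite ltr0_norm] => //; nra.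
rewrite big_split /= -mulr_suml -mulr_sumr.
have -> : \sum_(i < n | i != k) H = (n%:R - 1) * H by rewrite -cK mulr_suml; under [RHS]eq_bigr do rewrite mul1r.
set A := \sum_(i | i != k) `|m i|; set B := \sum_(i | i != k) _ => hAB.
rewrite -(ler_pM2r H0); apply: le_trans hAB _.
have : 4 * u ^+ 2 * B <= 4 * u ^+ 2 * H.
  by apply: ler_wpM2l; [rewrite mulr_ge0 ?sqr_ge0|rewrite sH lerDr].
have : (n%:R - 1) * H <= u ^+ 2 * H by apply: ler_wpM2r; [apply: ltW|nra].
lra.
Qed.

(* [l] are the coordinates, in the old cone, of a point satisfying the cut [h].
   The bound says that its coordinate on the pivot row stays nonnegative when
   the other rows are tilted towards row [k]. *)
Lemma pivot_cone (R : realFieldType) (n S : nat) (h m l : 'I_n -> R) (k : 'I_n) :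
  (forall i, 0 <= l i) -> 0 <= \sum_i l i * h i -> 0 < h k ->
  (forall i, m i * \sum_j `|h j| <= - (4 * S%:R ^+ 2 * h i)) ->
  \sum_(i | i != k) m i * l i <= 4 * S%:R ^+ 2 * l k.
Proof.
move=> l0 lh k0 lo.
have hkH : h k <= \sum_j `|h j|.
  rewrite (bigD1 k) //= (gtr0_norm k0) lerDl; exact: sumr_ge0.
have H0 := lt_le_trans k0 hkH.
rewrite -(ler_pM2r H0) mulr_suml.
apply: le_trans (_ : \sum_(i | i != k) - (4 * S%:R ^+ 2 * (l i * h i)) <= _).
  apply: ler_sum => i _; rewrite mulrAC.
  have := ler_wpM2r (l0 i) (lo i); lra.
rewrite sumrN -mulr_sumr.
have := lh; rewrite (bigD1 k) //=.
set A := \sum_(i | i != k) _ => hA.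
have a0 : 0 <= 4 * (S%:R : R) ^+ 2 by rewrite mulr_ge0 ?sqr_ge0.
have := ler_wpM2l a0 (ler_wpM2l (l0 k) hkH).
have := ler_wpM2l a0 hA.
lra.
Qed.

Definition cone_of (n : nat) (U : 'M[int]_n) (w : 'I_n -> rat) : Prop :=
  exists l : 'I_n -> rat,
    (forall i, 0 <= l i) /\ forall j, w j = \sum_i l i * (U i j)%:~R.

Definition feasible (n : nat) (G : 'cV[int]_n -> Prop) (w : 'I_n -> rat) : Prop :=
  forall g, G g -> 0 <= \sum_j w j * (g j 0)%:~R.

(* The simplex cut out of the cone by [\sum_j w j = 1] has volume proportional to
   [\det U / Q ^+ n]: each cut shrinks it by the factor in the last condition. *)
Definition simplex_inv (S n : nat) (G : 'cV[int]_n -> Prop) (U : 'M[int]_n)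
    (t : nat) : Prop :=
  exists Q : int, [/\ 0 < Q, forall r, \sum_j U r j = Q, 0 < \det U,
    forall w, feasible G w -> cone_of U w
    & (\det U)%:~R * (1 + (100 * S%:R ^+ 2)^-1) ^+ t <= Q%:~R ^+ n :> rat].

(** The Yamnitsky-Levin coefficient rounded down to an integer. Its absolute value is at most 4 S^2
    however long the entries of the matrix are, so that it can be the short factor of a repeated
    addition. *)
Definition cut_coef (S n : nat) (h : 'cV[int]_n) (i : 'I_n) : int :=
  divz (- (4 * S%:R ^+ 2 * h i 0)) (\sum_j `|h j 0|).

Definition cut_upd (S n : nat) (k : 'I_n) (h : 'cV[int]_n) (U : 'M[int]_n) : 'M[int]_n :=
  upd (50 * S%:R ^+ 3) k (cut_coef S h) U (enum 'I_n).

Lemma cut_coef_bound (S n : nat) (h : 'cV[int]_n) (i : 'I_n) :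
  `|cut_coef S h i| <= 4 * S%:R ^+ 2.
Proof.
rewrite /cut_coef; set H := \sum_j `|h j 0|; set K : int := 4 * S%:R ^+ 2.
have K0 : 0 <= K by rewrite mulr_ge0 ?sqr_ge0.
have hiH : `|h i 0| <= H.
  rewrite /H (bigD1 i) //= lerDl; exact: sumr_ge0.
have [->|H0] := eqVneq H 0; first by rewrite divz0 normr0.
have Hp : 0 < H by rewrite lt_def H0 /=; apply: sumr_ge0.
have lo := lez_floor (- (K * h i 0)) H0.
have up := ltz_ceil (- (K * h i 0)) Hp.
set m := divz _ _ in lo up *.
have b1 : K * h i 0 <= K * H by apply: ler_wpM2l => //; apply: le_trans (ler_norm _) hiH.
have b2 : - (K * h i 0) <= K * H.
  by rewrite -mulrN; apply: ler_wpM2l => //; apply: le_trans (ler_norm _) _; rewrite normrN.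
rewrite ler_norml; apply/andP; split.
  have : (- (K + 1)) * H < m * H by lia.
  by rewrite (ltr_pM2r Hp); lia.
by rewrite -(ler_pM2r Hp); lia.
Qed.

Lemma rate_ge0 (R : realFieldType) (S : nat) : 0 <= 1 + (100 * S%:R ^+ 2)^-1 :> R.
Proof. by rewrite addr_ge0 // invr_ge0 mulr_ge0 // sqr_ge0. Qed.

(** Bookkeeping of one cut: [p] is the factor gained by the determinant, [F] the factor gained by
    every row sum, [E] the part of [F] due to the pivot and [P] the part due to the other rows. As
    [F = E * P], the gain [D ^+ n.-1 * rho <= P] is what makes the normalised volume fall by
    [rho]. *)
Lemma potential_step (R : realFieldType) (n t : nat) (p d F Q E D P rho : R) :
  (0 < n)%N -> p = E * D ^+ n.-1 * F ^+ n.-1 -> F = E * P ->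
  D ^+ n.-1 * rho <= P -> d * rho ^+ t <= Q ^+ n ->
  0 <= E -> 0 <= F -> 0 <= d * rho ^+ t -> 0 <= Q ^+ n -> 0 <= D ^+ n.-1 * rho ->
  p * d * rho ^+ t.+1 <= (F * Q) ^+ n.
Proof.
move=> n0 -> FE gain pot E0 F0 d0 Q0 D0; rewrite exprMn.
have -> : F ^+ n = E * P * F ^+ n.-1 by rewrite -FE -exprS prednK.
have := ler_wpM2l (mulr_ge0 E0 (exprn_ge0 n.-1 F0)) (ler_pM D0 d0 gain pot).
rewrite exprS; by congr (_ <= _); ring.
Qed.

Lemma simplex_inv_upd (S n t : nat) (G : 'cV[int]_n -> Prop) (U : 'M[int]_n)
    (g h : 'cV[int]_n) (k : 'I_n) (w0 : 'I_n -> rat) :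
  (n <= S)%N -> G g -> (forall g, G g -> 0 < \sum_j w0 j * (g j 0)%:~R) ->
  (forall i, h i 0 = \sum_j U i j * g j 0) -> \sum_i h i 0 <= 0 ->
  (forall i, h i 0 <= h k 0) ->
  simplex_inv S G U t -> simplex_inv S G (cut_upd S k h U) t.+1.
Proof.
move=> nS Gg hw0 hE h0 hk [Q [Q0 rows det0 cone pot]].
have n0 : (0 < n)%N by apply: leq_ltn_trans (ltn_ord k).
have S0 : (0 < S)%N by apply: leq_trans nS.
have dotE (l : 'I_n -> rat) (w : 'I_n -> rat) : (forall j, w j = \sum_i l i * (U i j)%:~R) ->
    \sum_j w j * (g j 0)%:~R = \sum_i l i * (h i 0)%:~R.
  move=> wE; under eq_bigr do rewrite wE mulr_suml.
  rewrite exchange_big /=; apply: eq_bigr => i _.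
  rewrite hE rmorph_sum mulr_sumr; apply: eq_bigr => j _.
  by rewrite rmorphM /= mulrA.
(* If no row were positive on [g], neither would be the strictly feasible [w0], which is a
   nonnegative combination of the rows. *)
have k0 : 0 < h k 0.
  rewrite ltNge; apply/negP => hk0.
  have [l [l0 wE]] : cone_of U w0 by apply: cone => f Gf; apply/ltW/hw0.
  have := hw0 g Gg; rewrite (dotE _ _ wE) ltNge => /negP; apply.
  rewrite -oppr_ge0 -sumrN; apply: sumr_ge0 => i _.
  rewrite -mulrN; apply: mulr_ge0 => //.
  by rewrite oppr_ge0 lerz0; apply: le_trans hk0.
have H0 : 0 < \sum_j `|h j 0|.
  rewrite (bigD1 k) //=; apply: ltr_wpDr; first exact: sumr_ge0.
  by rewrite normr_gt0 gt_eqF.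
set m := cut_coef S h.
have lo i : m i * \sum_j `|h j 0| <= - (4 * S%:R ^+ 2 * h i 0).
  by apply: lez_floor; rewrite gt_eqF.
have up i : - (4 * S%:R ^+ 2 * h i 0) <= (m i + 1) * \sum_j `|h j 0|.
  by apply/ltW/ltz_ceil.
pose hr i : rat := (h i 0)%:~R; pose mr i : rat := (m i)%:~R.
have HrE : (\sum_j `|h j 0|)%:~R = \sum_j `|hr j|.
  by rewrite rmorph_sum; apply: eq_bigr => j _; rewrite /= intr_norm.
have hkr i : hr i <= hr k by rewrite ler_int.
have h0r : \sum_i hr i <= 0 by rewrite /hr -rmorph_sum lerz0.
have k0r : 0 < hr k by rewrite ltr0z.
have cK : (4 * S%:R ^+ 2 : rat) = (4 * S%:R ^+ 2 : int)%:~R.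
  by rewrite rmorphM rmorphXn /= !rmorph_nat.
have cE i : - (4 * S%:R ^+ 2 * hr i) = (- (4 * S%:R ^+ 2 * h i 0))%:~R.
  by rewrite cK rmorphN [in RHS]rmorphM.
have lor i : mr i * \sum_j `|hr j| <= - (4 * S%:R ^+ 2 * hr i).
  by rewrite cE -HrE -rmorphM ler_int.
have upr i : - (4 * S%:R ^+ 2 * hr i) <= (mr i + 1) * \sum_j `|hr j|.
  by rewrite cE -HrE -(rmorph1 intr) -rmorphD -rmorphM ler_int.
have [gain1 gain2] := pivot_arith nS hkr h0r k0r lor upr.
have pc := pivot_cone _ _ k0r lor.
have [D DI] : exists D : int, D = 50 * S%:R ^+ 3 by eexists.
have -> : cut_upd S k h U = upd D k m U (enum 'I_n) by rewrite DI.
have s1 : 1 <= S%:R :> int by rewrite ler1n.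
have KD : 4 * S%:R ^+ 2 < D.
  have e : (S%:R : int) ^+ 2 <= S%:R ^+ 3 by apply: ler_weXn2l.
  have e2 : 1 <= (S%:R : int) ^+ 2 by apply: exprn_ege1.
  by rewrite DI; lia.
have D0 : 0 < D by apply: le_lt_trans KD; rewrite mulr_ge0 ?sqr_ge0.
have E0 i : 0 < D + m i.
  have := cut_coef_bound S h i; rewrite -/m ler_norml => /andP[+ _]; lia.
have F0 : 0 < \prod_(i <- enum 'I_n) (D + m i) by apply: prodr_gt0.
set F := \prod_(i <- enum 'I_n) (D + m i) in F0 *.
have inE i : i \in enum 'I_n by rewrite mem_enum.
have uE := enum_uniq 'I_n.
have Er0 i : (D%:~R + mr i : rat) != 0.
  by rewrite -rmorphD intr_eq0 gt_eqF.
have Dr0 : (D%:~R : rat) != 0 by rewrite intr_eq0 gt_eqF.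
have Fr0 : (F%:~R : rat) != 0 by rewrite intr_eq0 gt_eqF.
exists (F * Q); split.
- by rewrite mulr_gt0.
- exact: upd_rowsum.
- rewrite upd_det mulr_gt0 //; apply: prodr_gt0 => i _; rewrite mulr_gt0 ?exprn_gt0 //.
  by case: eqP => _; rewrite ?addr0.
- move=> w fw; have [l [l0 wE]] := cone w fw.
  have lh : 0 <= \sum_i l i * hr i by rewrite -(dotE _ _ wE); apply: fw.
  have pcl := pc l l0 lh.
  (* Inverts the update: the new row [i] is [F / (D + m i)] times [D * U i + m i * U k], so
     expressing [U i] by it takes [m i / D] times [U k] off the pivot. What remains there is
     nonnegative by [pivot_cone] and 4 S^2 < D. *)
  exists (fun i => if i == k then (l k - (\sum_(i | i != k) mr i * l i) / D%:~R) / F%:~R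
                   else l i * (D%:~R + mr i) / (D%:~R * F%:~R)); split.
    move=> i; case: eqP => _.
      rewrite divr_ge0 ?ler0z ?(ltW F0) // subr_ge0 ler_pdivrMr ?ltr0z //.
      apply: le_trans pcl _; rewrite mulrC; apply: ler_wpM2l => //.
      by rewrite cK ler_int ltW.
    rewrite divr_ge0 ?mulr_ge0 ?ler0z ?(ltW F0) ?(ltW D0) //.
    by rewrite -rmorphD ler0z ltW.
  move=> j; rewrite wE (bigD1 k) //= [RHS](bigD1 k) //= eqxx.
  rewrite upd_pivot -/F.
  have -> : \sum_(i < n | i != k)
     (if i == k
      then (l k - (\sum_(i0 | i0 != k) mr i0 * l i0) / D%:~R) / F%:~R
      else l i * (D%:~R + mr i) / (D%:~R * F%:~R)) * (upd D k m U (enum 'I_n) i j)%:~R =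
     \sum_(i < n | i != k) (l i * (U i j)%:~R + (mr i * l i) * ((U k j)%:~R / D%:~R)).
    apply: eq_bigr => i /negPf ->.
    have /(congr1 (fun z : int => z%:~R : rat)) := upd_in D k m U j uE (inE i).
    rewrite -/F !(rmorphM, rmorphD) /= => e.
    have -> : (upd D k m U (enum 'I_n) i j)%:~R =
      F%:~R * (D%:~R * (U i j)%:~R + (m i)%:~R * (U k j)%:~R) / (D%:~R + mr i).
      by rewrite -e; field; apply: Er0.
    rewrite /mr; field; rewrite ?Fr0 ?Dr0 ?andbT //=.
    by apply: Er0.
  rewrite big_split /= -mulr_suml rmorphM /=.
  set A := \sum_(i < n | i != k) mr i * l i; set B := \sum_(i < n | i != k) l i * _.
  by field; rewrite Fr0 Dr0.
rewrite upd_det.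
move: (\det U) det0 pot => d det0 pot.
have sz : size [seq i <- enum 'I_n | i != k] = n.-1.
  by rewrite -sum1_size big_filter big_enum_cond /= sum1_card cardC1 card_ord.
have gain := prod_shift_gain (s := [seq i <- enum 'I_n | i != k]) (x := mr) S0.
rewrite !big_filter !big_enum_cond /= sz in gain.
have {gain}gain := gain gain2 gain1.
have DE : (D%:~R : rat) = 50 * S%:R ^+ 3.
  by rewrite DI rmorphM rmorphXn /= !rmorph_nat.
rewrite -DE in gain.
have FE : F%:~R = (D%:~R + mr k) * \prod_(i | i != k) (D%:~R + mr i).
  rewrite /F big_enum (bigD1 k isT) /= rmorphM rmorph_prod rmorphD /=; congr (_ * _).
  by apply: eq_bigr => i _; rewrite rmorphD /= DE.
have pE : (\prod_(r <- enum 'I_n) ((D + (if r == k then m r else 0)) * (D + m r) ^+ n.-1))%:~R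
   = (D%:~R + mr k) * (D%:~R ^+ n.-1) * F%:~R ^+ n.-1.
  rewrite big_split /= prodrXl -/F intrM rmorphXn /=; congr (_ * _).
  rewrite big_enum (bigD1 k isT) /= eqxx (intrM _ (D + m k)) intrD; congr (_ * _).
  rewrite (eq_bigr (fun _ => D)); last by move=> i /negPf ->; rewrite addr0.
  by rewrite prodr_const cardC1 card_ord rmorphXn.
rewrite (intrM rat) (intrM rat F).
have rho0 : 0 <= 1 + (100 * S%:R ^+ 2)^-1 :> rat by exact: rate_ge0.
apply: (potential_step n0 pE FE gain pot).
- rewrite -intrD ler0z; exact: ltW (E0 k).
- rewrite ler0z; exact: ltW F0.
- apply: mulr_ge0; first by rewrite ler0z; exact: ltW det0.
  apply: exprn_ge0; exact: rho0.
- apply: exprn_ge0; rewrite ler0z; exact: ltW Q0.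
- apply: mulr_ge0 rho0; apply: exprn_ge0; rewrite ler0z; exact: ltW D0.
Qed.

Lemma bernoulli_ineq (R : realDomainType) (x : R) (k : nat) :
  0 <= x -> 1 + k%:R * x <= (1 + x) ^+ k.
Proof.
move=> x0; elim: k => [|k IH]; first by rewrite expr0; lra.
rewrite exprS; have := ler_wpM2l (addr_ge0 ler01 x0) IH.
have : 0 <= (k%:R : R) by []. 
rewrite -natr1; nra.
Qed.

(** The identity plus a matrix of rank one: [V] is its inverse up to the scalar [L], as in the
    Sherman-Morrison formula. *)
Lemma det_shifted_identity (n : nat) (x : 'I_n -> int) :
  0 < 1 + \sum_j x j -> \det (\matrix_(i < n, j < n) (x j + (i == j)%:R)) != 0.
Proof.
set L := 1 + _ => L0; set W := \matrix_(i, j) _.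
pose V : 'M[int]_n := \matrix_(i, j) (L * (i == j)%:R - x j).
have WV : W *m V = L%:M.
  apply/matrixP => i j; rewrite !mxE.
  under eq_bigr do rewrite !mxE mulrDl.
  rewrite big_split /= [X in _ + X](bigD1 i) //= eqxx mul1r.
  rewrite [X in _ + (_ + X)]big1 ?addr0; last first.
    by move=> l /negPf li; rewrite eq_sym li mul0r.
  under eq_bigr do rewrite mulrBr.
  rewrite sumrB -mulr_suml (bigD1 j) //= eqxx mulr1.
  rewrite [X in _ + X - _ + _]big1 ?addr0; last by move=> l /negPf ->; rewrite !mulr0.
  by rewrite -mulr_natr /L; ring.
apply/eqP => W0; have := congr1 determinant WV.
by rewrite det_mulmx W0 mul0r det_scalar => /esym/eqP; rewrite gt_eqF ?exprn_gt0.
Qed.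

(* The vectors [B *: c + e_i] are feasible and linearly independent, so that the
   cone contains their simplex, whose volume is bounded from below. *)
Lemma simplex_inv_bounded (S n t : nat) (G : 'cV[int]_n -> Prop) (U : 'M[int]_n)
    (B : int) (c : 'I_n -> int) :
  0 <= B -> (forall j, 0 <= c j) ->
  (forall g, G g -> forall j, `|g j 0| <= B) ->
  (forall g, G g -> 1 <= \sum_j c j * g j 0) ->
  simplex_inv S G U t ->
  (1 + (100 * S%:R ^+ 2)^-1) ^+ t <= (1 + B * \sum_j c j)%:~R ^+ n :> rat.
Proof.
move=> B0 c0 gB gc [Q [Q0 rows det0 cone pot]].
set L := 1 + B * \sum_j c j.
have L0 : 0 < L by rewrite /L ltr_wpDr // mulr_ge0 // sumr_ge0.
pose W : 'M[int]_n := \matrix_(i < n, j < n) (B * c j + (i == j)%:R).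
have detW : \det W != 0.
  by apply: det_shifted_identity; rewrite -mulr_sumr.
have lam i : exists l : 'I_n -> rat,
    (forall i, 0 <= l i) /\ forall j, (W i j)%:~R = \sum_k l k * (U k j)%:~R.
  apply: cone => g Gg.
  have -> : \sum_j (W i j)%:~R * (g j 0)%:~R =
      (B * (\sum_j c j * g j 0) + g i 0)%:~R :> rat.
    transitivity ((\sum_j W i j * g j 0)%:~R : rat).
      by rewrite rmorph_sum; apply: eq_bigr => j _; rewrite rmorphM.
    congr (_%:~R); under eq_bigr do rewrite mxE mulrDl.
    rewrite big_split /= mulr_sumr; congr (_ + _).
      by apply: eq_bigr => j _; rewrite mulrA.
    rewrite (bigD1 i) //= eqxx mul1r big1 ?addr0 // => j /negPf ji.
    by rewrite eq_sym ji mul0r.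
  rewrite ler0z; have := gB g Gg i; rewrite ler_norml => /andP[h1 _].
  have := ler_wpM2l B0 (gc g Gg); lia.
pose l i := sval (boolp.cid (lam i)).
have l0 i k : 0 <= l i k by rewrite /l; case: (boolp.cid _) => /= ? [].
have lE i j : (W i j)%:~R = \sum_k l i k * (U k j)%:~R.
  by rewrite /l; case: (boolp.cid _) => /= ? [].
pose Lam : 'M[rat]_n := \matrix_(i, k) l i k.
have WE : map_mx intr W = Lam *m map_mx intr U.
  apply/matrixP => i j; rewrite [LHS]mxE lE mxE.
  by apply: eq_bigr => k _; rewrite !mxE.
(* The rows of [W] sum to [L], those of [U] to [Q], and the coefficients are nonnegative, so their
   absolute sum is known exactly. *)
have rowL i : \sum_k `|Lam i k| = L%:~R / Q%:~R.
  have Qr : (Q%:~R : rat) != 0 by rewrite intr_eq0 gt_eqF.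
  apply: (canRL (mulfK Qr)).
  have <- : \sum_j W i j = L.
    under eq_bigr do rewrite mxE.
    rewrite big_split /= -mulr_sumr [X in _ + X](bigD1 i) //= eqxx [X in _ + (_ + X)]big1; last first.
      by move=> j /negPf ji; rewrite eq_sym ji.
    by rewrite addr0 addrC.
  rewrite rmorph_sum /=; under [RHS]eq_bigr do rewrite lE.
  rewrite exchange_big /= mulr_suml; apply: eq_bigr => k _.
  by rewrite -mulr_sumr -(rmorph_sum intr) /= rows mxE ger0_norm.
(* Integrality turns non-singularity into a lower bound; as [\det W = \det Lam * \det U], it yields
   [\det U >= (Q / L) ^+ n]. *)
have dW : 1 <= `|\det W|%:~R :> rat.
  by rewrite -[1]/(1%:~R) ler_int; move: detW; rewrite -normr_gt0; lia.
have detE : (\det W)%:~R = \det Lam * (\det U)%:~R :> rat.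
  by rewrite -(det_map_mx intr W) WE det_mulmx (det_map_mx intr).
have bnd : `|\det Lam| <= (L%:~R / Q%:~R) ^+ n.
  apply: le_trans (ler_det_prod_sum _) _.
  by rewrite (eq_bigr _ (fun i _ => rowL i)) prodr_const card_ord.
move: dW; rewrite intr_norm detE normrM.
have d0 : 0 < (\det U)%:~R :> rat by rewrite ltr0z.
rewrite (gtr0_norm d0) => dW.
have Qn : 0 < Q%:~R ^+ n :> rat by rewrite exprn_gt0 // ltr0z.
move: bnd; rewrite expr_div_n ler_pdivlMr // => bnd.
have := ler_wpM2r (exprn_ge0 n (ltW (_ : 0 < Q%:~R :> rat))) dW.
rewrite ltr0z mul1r => /(_ Q0) h1.
rewrite -(ler_pM2l d0); apply: le_trans pot _; apply: le_trans h1 _.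
by rewrite mulrAC [X in _ <= X]mulrC; apply: ler_wpM2r => //; apply: ltW.
Qed.

(** By Bernoulli's inequality every 100 S^2 cuts at least double the power; the additional block in
    [e.+1] makes the inequality strict. *)
Lemma rate_pow (R : realFieldType) (S e t : nat) (L : R) :
  (0 < S)%N -> (100 * S ^ 2 * e.+1 <= t)%N -> L <= 2 ^+ e ->
  L < (1 + (100 * S%:R ^+ 2)^-1) ^+ t.
Proof.
move=> S0 et Le; apply: le_lt_trans Le _.
apply: lt_le_trans (_ : 2 ^+ e.+1 <= _).
  by rewrite ltr_eXn2l // ltr1n.
set x := _^-1.
have k0 : (0 : R) < 100 * S%:R ^+ 2 by rewrite mulr_gt0 // exprn_gt0 // ltr0n.
have x0 : 0 <= x by rewrite invr_ge0 ltW.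
apply: le_trans (_ : (1 + x) ^+ (100 * S ^ 2 * e.+1) <= _); last first.
  by apply: ler_weXn2l => //; rewrite lerDl.
rewrite [X in _ <= X]exprM lerXn2r ?nnegrE ?exprn_ge0 ?addr_ge0 //.
have := bernoulli_ineq (100 * S ^ 2) x0.
rewrite natrM natrX /x mulfV; first by lra.
by rewrite gt_eqF.
Qed.

(** * Linear inequalities *)

(** Induction on the number of vectors, eliminating [g ord0] if the functional [c] found for the
    others is not positive on it. The vectors [g'] combine [g (lift ord0 i)] with [g ord0] so that
    [c] kills them. A functional positive on all of them is corrected to vanish on [g ord0] and then
    tilted slightly towards it; a relation among them unfolds to a relation among the original
    vectors. *)
Lemma gordan (R : realFieldType) (n m : nat) (g : 'I_m -> 'cV[R]_n) :
  (exists c : 'I_n -> R, forall i, 0 < \sum_j c j * g i j 0) \/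
  (exists l : 'I_m -> R, [/\ forall i, 0 <= l i, exists i, 0 < l i
     & \sum_i l i *: g i = 0]).
Proof.
elim: m g => [|m IH] g; first by left; exists (fun _ => 0) => -[].
have [[c hc]|[l [l0 [i li] lE]]] := IH (fun i => g (lift ord0 i)); last first.
  right; exists (fun i => if unlift ord0 i is Some j then l j else 0); split.
  - by move=> j; case: unliftP.
  - by exists (lift ord0 i); rewrite liftK.
  - rewrite big_ord_recl unlift_none scale0r add0r -[RHS]lE.
    by apply: eq_bigr => j _; rewrite liftK.
pose dot (c : 'I_n -> R) (x : 'cV[R]_n) := \sum_j c j * x j 0.
have dotD c1 x y : dot c1 (x + y) = dot c1 x + dot c1 y.
  by rewrite -big_split; apply: eq_bigr => j _; rewrite mxE mulrDr.
have dotZ c1 a x : dot c1 (a *: x) = a * dot c1 x.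
  by rewrite mulr_sumr; apply: eq_bigr => j _; rewrite mxE mulrCA.
have [c0|c0] := ltrP 0 (dot c (g ord0)).
  by left; exists c => i; case: (unliftP ord0 i) => [j|] ->; [apply: hc|].
set al := - dot c (g ord0).
have al0 : 0 <= al by rewrite oppr_ge0.
have [g0|g0] := eqVneq (g ord0) 0.
  right; exists (fun i => (i == ord0)%:R); split.
  - by move=> i; rewrite ler0n.
  - by exists ord0; rewrite eqxx.
  - rewrite (bigD1 ord0) //= g0 scaler0 add0r big1 // => i /negPf ->.
    by rewrite scale0r.
pose g' i := al *: g (lift ord0 i) + dot c (g (lift ord0 i)) *: g ord0.
have [[c' hc']|[l [l0 [i li] lE]]] := IH g'; last first.
  right; exists (fun i => if unlift ord0 i is Some j then al * l j
                 else \sum_j l j * dot c (g (lift ord0 j))); split.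
  - move=> j; case: unliftP => [k|] _; first by rewrite mulr_ge0.
    by apply: sumr_ge0 => k _; rewrite mulr_ge0 //; apply/ltW/hc.
  - exists ord0; rewrite unlift_none (bigD1 i) //=; apply: ltr_wpDr.
      by apply: sumr_ge0 => k _; rewrite mulr_ge0 //; apply/ltW/hc.
    by rewrite mulr_gt0 //; apply: hc.
  - rewrite big_ord_recl unlift_none -[RHS]lE scaler_suml -big_split /=.
    apply: eq_bigr => j _; rewrite liftK /g' scalerDr !scalerA addrC.
    by rewrite (mulrC al).
left.
pose be := dot c' (g ord0).
pose c2 j := al * c' j + be * c j.
have c2E x : dot c2 x = al * dot c' x + be * dot c x.
  rewrite !mulr_sumr -big_split; apply: eq_bigr => j _.
  by rewrite /c2 mulrDl !mulrA.
have c20 : dot c2 (g ord0) = 0 by rewrite c2E /al /be; ring.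
have c2g i : 0 < dot c2 (g (lift ord0 i)).
  have : 0 < dot c' (g' i) by apply: hc'.
  by rewrite c2E /g' dotD !dotZ -/be (mulrC be).
pose q (x : 'cV[R]_n) := \sum_j g ord0 j 0 * x j 0.
have q0 : 0 < q (g ord0).
  have [j hj] : exists j, g ord0 j 0 != 0.
    apply/existsP; rewrite -negb_forall; apply: contra g0 => /forallP h.
    by apply/eqP/colP => j; rewrite mxE; apply/eqP/h.
  rewrite /q (bigD1 j) //=; apply: ltr_wpDr.
    by apply: sumr_ge0 => i _; rewrite -expr2 sqr_ge0.
  by rewrite -expr2 lt_def sqr_ge0 expf_eq0 /= hj.
pose r i := dot c2 (g (lift ord0 i)) / (1 + `|q (g (lift ord0 i))|).
have r0 i : 0 < r i by rewrite divr_gt0 // ltr_wpDr.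
pose e := \big[Order.min/1]_i r i.
have e0 : 0 < e by rewrite /e; elim/big_ind: _ => // x y x0 y0; rewrite lt_min x0.
have er i : e <= r i by rewrite /e; apply: bigmin_le.
exists (fun j => c2 j + e * g ord0 j 0) => i.
have -> : \sum_j (c2 j + e * g ord0 j 0) * g i j 0 = dot c2 (g i) + e * q (g i).
  by rewrite mulr_sumr -big_split; apply: eq_bigr => j _ /=; rewrite mulrDl mulrA.
case: (unliftP ord0 i) => [j|] ->; last by rewrite c20 add0r mulr_gt0.
have := er j; rewrite /r ler_pdivlMr; last by rewrite ltr_wpDr.
have := c2g j; set a := dot _ _; set b := q _ => a0.
have : - (e * `|b|) <= e * b.
  by rewrite -mulrN; apply: ler_wpM2l; [apply: ltW|rewrite lerNl -normrN ler_norm].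
lra.
Qed.

(* Moves along the kernel of the tight constraints until a new one gets tight;
   the unit rows of [A] prevent the ray from being unbounded. *)
Lemma tight_rank_step (R : realFieldType) (m n : nat) (A : 'M[R]_(m, n)) (c : 'cV[R]_n) :
  (forall j : 'I_n, exists i, forall k, A i k = (k == j)%:R) ->
  (forall i, 1 <= (A *m c) i 0) ->
  let T c := \matrix_(i, j) (if (A *m c) i 0 == 1 then A i j else 0) : 'M[R]_(m, n) in
  (\rank (T c) < n)%N ->
  exists2 c' : 'cV[R]_n, forall i, 1 <= (A *m c') i 0 & (\rank (T c) < \rank (T c'))%N.
Proof.
move=> unitA feas T rk.
have TE c1 i k : T c1 i k = if (A *m c1) i 0 == 1 then A i k else 0 by rewrite mxE.
have [z z0 Tz] : exists2 z : 'cV[R]_n, z != 0 & T c *m z = 0.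
  have : cokermx (T c) != 0 by rewrite -mxrank_eq0 mxrank_coker subn_eq0 -ltnNge.
  move=> /eqP C0.
  have [j hj] : exists j, col j (cokermx (T c)) != 0.
    apply/existsP; rewrite -negb_forall; apply/negP => /forallP h.
    by apply: C0; apply/matrixP => i j; have /eqP/colP/(_ i) := h j; rewrite !mxE.
  by exists (col j (cokermx (T c))) => //; rewrite colE mulmxA mulmx_coker mul0mx.
(* The sign of [z] is free. A negative coordinate makes its unit constraint decrease along [z], so
   the ratio test below has a row to stop at. *)
wlog [j zj] : z z0 Tz / exists j, z j 0 < 0.
  move=> W.
  have [j hj] : exists j, z j 0 != 0.
    apply/existsP; rewrite -negb_forall; apply: contra z0 => /forallP h.
    by apply/eqP/colP => j; rewrite mxE; apply/eqP/h.
  move: hj; rewrite neq_lt => /orP[hj|hj]; first by apply: (W z) => //; exists j.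
  apply: (W (- z)); rewrite ?oppr_eq0 // ?mulmxN ?Tz ?oppr0 //.
  by exists j; rewrite mxE oppr_lt0.
have [i0 hi0] := unitA j.
have i0neg : (A *m z) i0 0 < 0.
  rewrite mxE (bigD1 j) //= hi0 eqxx mul1r big1 ?addr0 // => k /negPf kj.
  by rewrite hi0 kj mul0r.
pose th i := ((A *m c) i 0 - 1) / - (A *m z) i 0.
case: (arg_minP (P := fun i => (A *m z) i 0 < 0) th i0neg) => r rneg rmin.
have th0 : 0 <= th r by apply: divr_ge0; rewrite ?subr_ge0 ?oppr_ge0 ?feas //; apply: ltW.
have AE i : (A *m (c + th r *: z)) i 0 = (A *m c) i 0 + th r * (A *m z) i 0.
  by rewrite mulmxDr -scalemxAr !mxE.
have tz i : (A *m c) i 0 == 1 -> (A *m z) i 0 = 0.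
  move=> hi; transitivity ((T c *m z) i 0); last by rewrite Tz mxE.
  by rewrite mxE [RHS]mxE; apply: eq_bigr => k _; rewrite [T c i k]mxE hi.
exists (c + th r *: z).
  move=> i; rewrite AE; case: (lerP 0 ((A *m z) i 0)) => hi.
    by apply: (le_trans (feas i)); rewrite lerDl mulr_ge0.
  have := rmin i hi; rewrite [th i]/th ler_pdivlMr ?oppr_gt0 //; lra.
apply: rank_ltmx; rewrite /ltmx; apply/andP; split.
  apply/row_subP => i; have [hi|hi] := boolP ((A *m c) i 0 == 1).
    have -> : row i (T c) = row i (T (c + th r *: z)).
      by apply/rowP => k; rewrite mxE TE [RHS]mxE TE AE (tz _ hi) mulr0 addr0 hi.
    exact: row_sub.
  have -> : row i (T c) = 0 by apply/rowP => k; rewrite mxE TE (negPf hi) mxE.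
  exact: sub0mx.
(* Row [r] has become tight but does not annihilate [z], whereas all rows tight before do; hence the
   rank grows. *)
apply/negP => /submxP[X XE].
have : (row r (T (c + th r *: z)) *m z) 0 0 = 0.
  by rewrite XE row_mul -mulmxA Tz mulmx0 mxE.
have rt : (A *m (c + th r *: z)) r 0 == 1.
  by rewrite AE /th invrN mulrN mulNr divfK ?(lt_eqF rneg) // opprB addrCA subrr addr0.
rewrite mxE => e; move: rneg; rewrite mxE (eq_bigr (fun k => row r (T (c + th r *: z)) 0 k * z k 0)).
  by rewrite e ltxx.
by move=> k _; rewrite [row _ _ _ _]mxE TE rt.
Qed.

Lemma tight_full_rank (R : realFieldType) (m n : nat) (A : 'M[R]_(m, n)) (c : 'cV[R]_n) :
  (forall j : 'I_n, exists i, forall k, A i k = (k == j)%:R) ->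
  (forall i, 1 <= (A *m c) i 0) ->
  exists (c' : 'cV[R]_n) (f : 'I_n -> 'I_m),
    [/\ forall i, 1 <= (A *m c') i 0, forall i, (A *m c') (f i) 0 = 1
      & rowsub f A \in unitmx].
Proof.
move=> unitA.
pose T (c : 'cV[R]_n) := \matrix_(i, j) (if (A *m c) i 0 == 1 then A i j else 0) : 'M[R]_(m, n).
move: {2}(n - \rank (T c))%N (leqnn (n - \rank (T c))) => k.
elim: k c => [|k IH] c hk feas; last first.
  have [rk|rk] := ltnP (\rank (T c)) n.
    have [c' f' r'] := tight_rank_step unitA feas rk.
    have {r'} r' : (\rank (T c) < \rank (T c'))%N := r'.
    apply: (IH c') => //; rewrite -ltnS; apply: leq_trans hk.
    by rewrite ltn_sub2l.
  by apply: (IH c) => //; rewrite (eqP (_ : _ - _ == 0)%N).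
have full : row_full (T c).
  by rewrite /row_full eqn_leq rank_leq_col /= -subn_eq0 -leqn0.
exists c, (fullrankfun full).
have fu : rowsub (fullrankfun full) (T c) \in unitmx.
  by rewrite -row_full_unit fullrowsub_full.
have tf i : (A *m c) (fullrankfun full i) 0 == 1.
  apply/negPn/negP => hi; move: fu; rewrite unitmxE (expand_det_row _ i) big1 ?unitr0 //.
  by move=> j _; rewrite mxE [T c _ _]mxE (negPf hi) mul0r.
split=> //; first by move=> i; apply/eqP/tf.
rewrite (_ : rowsub _ A = rowsub (fullrankfun full) (T c)) //.
by apply/matrixP => i j; rewrite mxE [RHS]mxE [T c _ _]mxE tf.
Qed.

(** After scaling, all slacks are at least 1, and a basic solution solves [M c' = 1] for an
    invertible square [M] of rows of [A]. By Cramer's rule its multiple by the absolute value of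
    [\det M] is integral, and this factor is at least 1, so the inequalities persist. Each entry is,
    up to sign, a sum of [n] cofactors, whence the bound. *)
Lemma bounded_solution (m n : nat) (A : 'M[int]_(m, n)) (B : nat) (c : 'I_n -> rat) :
  (forall i j, `|A i j| <= B%:Z) ->
  (forall j : 'I_n, exists i, forall k, A i k = (k == j)%:R) ->
  (forall i, 0 < \sum_j (A i j)%:~R * c j) ->
  exists c' : 'I_n -> int, (forall i, 1 <= \sum_j A i j * c' j) /\
    forall j, `|c' j| <= (n * (n * B) ^ n.-1)%:Z.
Proof.
move=> AB unitA cpos.
pose Ar : 'M[rat]_(m, n) := map_mx intr A.
pose v : 'cV[rat]_n := \col_j c j.
have vE i : (Ar *m v) i 0 = \sum_j (A i j)%:~R * c j.
  by rewrite mxE; apply: eq_bigr => j _; rewrite !mxE.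
pose e := \big[Order.min/1]_i (Ar *m v) i 0.
have e0 : 0 < e.
  rewrite /e; elim/big_ind: _ => // [x y x0 y0|i _]; first by rewrite lt_min x0.
  by rewrite vE.
have feas i : 1 <= (Ar *m (e^-1 *: v)) i 0.
  by rewrite -scalemxAr mxE mulrC ler_pdivlMr // mul1r; apply: bigmin_le.
have unitAr j : exists i, forall k, Ar i k = (k == j)%:R.
  by have [i hi] := unitA j; exists i => k; rewrite mxE hi; case: (k == j).
have [c' [f [f1 f2 fu]]] := tight_full_rank unitAr feas.
pose M := rowsub f A.
have ME : rowsub f Ar = map_mx intr M by apply/matrixP => i j; rewrite !mxE.
have dM : \det M != 0.
  by move: fu; rewrite ME unitmxE det_map_mx unitfE intr_eq0.
have Mc : map_mx intr M *m c' = const_mx 1.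
  rewrite -ME; apply/colP => i; rewrite !mxE -[RHS](f2 i) mxE.
  by apply: eq_bigr => k _; rewrite !mxE.
pose w : 'cV[int]_n := \adj M *m const_mx 1.
have wE : map_mx intr w = (\det M)%:~R *: c'.
  rewrite map_mxM -[X in _ *m X](_ : map_mx intr M *m c' = _); last first.
    by rewrite Mc; apply/colP => i; rewrite !mxE.
  by rewrite mulmxA -map_mxM mul_adj_mx map_scalar_mx mul_scalar_mx.
exists (fun j => Num.sg (\det M) * w j 0); split.
  move=> i; rewrite -(ler_int rat).
  have -> : (\sum_j A i j * (Num.sg (\det M) * w j 0))%:~R =
      `|\det M|%:~R * (Ar *m c') i 0 :> rat.
    rewrite rmorph_sum /= mxE mulr_sumr; apply: eq_bigr => j _.
    have /colP/(_ j) := wE; rewrite !mxE => h.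
    by rewrite !rmorphM /= h normrEsg rmorphM /=; ring.
  have d1 : 1 <= `|\det M|%:~R :> rat.
    by rewrite -[1]/(1%:~R) ler_int; move: dM; rewrite -normr_gt0; lia.
  by apply: le_trans (f1 i) _; apply: ler_peMl => //; apply: le_trans (f1 i).
move=> j; rewrite normrM.
apply: le_trans (_ : `|w j 0| <= _).
  by apply: ler_piMl => //; rewrite normr_sg; case: (_ != _).
rewrite mxE; apply: le_trans (ler_norm_sum _ _ _) _.
apply: le_trans (_ : \sum_(i < n) ((n * B) ^ n.-1)%:Z <= _); last first.
  by rewrite sumr_const card_ord -mulr_natl PoszM natz.
apply: ler_sum => i _; rewrite [const_mx _ _ _]mxE mulr1 mxE /cofactor normrM normrX normrN1 expr1n mul1r.
apply: le_trans (ler_det_prod_sum _) _.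
apply: le_trans (_ : \prod_(i < n.-1) (n * B)%:Z <= _); last first.
  by rewrite prodr_const card_ord -!natz natrX.
apply: ler_prod => k _; rewrite sumr_ge0 //=.
apply: le_trans (_ : \sum_(i < n.-1) B%:Z <= _).
  by apply: ler_sum => l _; rewrite !mxE.
rewrite sumr_const card_ord -mulr_natl natz -PoszM lez_nat.
by apply: leq_mul => //; apply: leq_pred.
Qed.

(** * Solutions of the knapsack equation *)

Definition idot (n : nat) (x y : 'cV[int]_n) : int := \sum_i x i 0 * y i 0.

Definition sol (n : nat) (a : 'cV[int]_n) (b : int) (u : 'cV[int]_n) : Prop :=
  idot a u = b /\ forall i, 0 <= u i 0.

(* [v] is a rational convex combination of other solutions. *)
Definition averaged (n : nat) (a : 'cV[int]_n) (b : int) (v : 'cV[int]_n) : Prop :=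
  exists (m : nat) (y : 'I_m -> 'cV[int]_n) (k : 'I_m -> nat),
    [/\ forall i, sol a b (y i) /\ y i != v, exists i, (0 < k i)%N
      & \sum_i (y i - v) *+ k i = 0].

(** Not the midpoint of two different integer solutions. This is weaker than not being [averaged],
    but it suffices for the pigeonhole argument and can be reached by a descent. *)
Definition rigid (n : nat) (a u : 'cV[int]_n) : Prop :=
  forall d : 'cV[int]_n, idot a d = 0 ->
  (forall i, 0 <= u i 0 + d i 0) -> (forall i, 0 <= u i 0 - d i 0) -> d = 0.

Lemma idotDr (n : nat) (a x y : 'cV[int]_n) : idot a (x + y) = idot a x + idot a y.
Proof. by rewrite -big_split; apply: eq_bigr => i _; rewrite mxE mulrDr. Qed.

Lemma idotNr (n : nat) (a x : 'cV[int]_n) : idot a (- x) = - idot a x.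
Proof. by rewrite -sumrN; apply: eq_bigr => i _; rewrite mxE mulrN. Qed.

Lemma idotBr (n : nat) (a x y : 'cV[int]_n) : idot a (x - y) = idot a x - idot a y.
Proof. by rewrite idotDr idotNr. Qed.

Lemma idot0r (n : nat) (a : 'cV[int]_n) : idot a 0 = 0.
Proof. by rewrite /idot big1 // => i _; rewrite mxE mulr0. Qed.

Lemma idot_delta (n : nat) (a : 'cV[int]_n) i : idot a (delta_mx i 0) = a i 0.
Proof.
rewrite /idot (bigD1 i) //= mxE !eqxx mulr1 big1 ?addr0 // => j /negPf ji.
by rewrite mxE ji mulr0.
Qed.

Lemma idot_sum (n : nat) (a : 'cV[int]_n) (I : finType) (x : I -> 'cV[int]_n) (k : I -> nat) :
  idot a (\sum_i x i *+ k i) = \sum_i idot a (x i) *+ k i.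
Proof.
have -> : \sum_i idot a (x i) *+ k i = \sum_j \sum_i (a j 0 * x i j 0) *+ k i.
  by rewrite exchange_big; apply: eq_bigr => i _; rewrite sumrMnl.
apply: eq_bigr => j _; rewrite summxE mulr_sumr; apply: eq_bigr => i _.
by rewrite mulmxnE mulrnAr.
Qed.

Lemma averaged2 (n : nat) (a : 'cV[int]_n) b v d :
  sol a b (v + d) -> sol a b (v - d) -> d != 0 -> averaged a b v.
Proof.
move=> s1 s2 d0; exists 2%N, (fun i : 'I_2 => if i == ord0 then v + d else v - d), (fun _ => 1%N).
split; last by rewrite big_ord_recl big_ord1 /=; apply/colP => j; rewrite !mxE; ring.
  move=> i; case: (i == ord0); split => //; rewrite -subr_eq0.
    by rewrite addrC addKr.
  by rewrite addrC addKr oppr_eq0.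
by exists ord0.
Qed.

Lemma rigid_of_not_averaged (n : nat) (a : 'cV[int]_n) b v :
  sol a b v -> ~ averaged a b v -> rigid a v.
Proof.
move=> [vb v0] nav d ad pd md; apply/eqP/negPn/negP => d0; apply: nav.
by apply: (averaged2 (d := d)) => //; split => [|i]; rewrite ?mxE ?idotDr ?idotNr ?vb ?ad ?oppr0 ?addr0.
Qed.

Lemma averaged_shift (n : nat) (a : 'cV[int]_n) b (v d : 'cV[int]_n) :
  (forall i, 0 <= d i 0) -> averaged a b v -> averaged a (b + idot a d) (v + d).
Proof.
move=> d0 [m [y [k [hy hk hs]]]]; exists m, (fun i => y i + d), k; split => //.
  move=> i; have [[yb y0] yv] := hy i; split.
    by split => [|j]; rewrite ?idotDr ?yb // mxE addr_ge0.
  by apply: contra yv => /eqP /addIr ->.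
by rewrite -[RHS]hs; apply: eq_bigr => i _; rewrite opprD addrACA subrr addr0.
Qed.

(** * Conformal decomposition of kernel vectors *)

(** Applied coordinatewise, this is the order whose minimal non-zero kernel vectors form the Graver
    basis of [a]. *)
Definition conformal (x y : int) : bool := (0 <= x <= y) || (y <= x <= 0).

(** The third hypothesis says that no exchange between two coordinates of opposite contribution fits
    into [g]. If [g j] exceeded n Dl^2, it would exceed every entry of [a], so each [g i] of
    negative contribution would be smaller than [a j] in absolute value. The negative contributions
    would then be too small to cancel [a j 0 * g j 0]. *)
Lemma kernel_entry_bound (n Dl : nat) (a g : 'cV[int]_n) (j : 'I_n) :
  (forall i, `|a i 0| <= Dl%:Z) -> idot a g = 0 ->
  (forall i, a i 0 * g i 0 < 0 -> `|a j 0| <= `|g i 0| -> `|a i 0| <= `|g j 0| -> False) ->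
  0 < a j 0 * g j 0 -> `|g j 0| <= (n * Dl ^ 2)%:Z.
Proof.
move=> aD ag nB pj; rewrite leNgt; apply/negP => hg.
have n0 : (0 < n)%N by apply: leq_ltn_trans (ltn_ord j).
have D0 : (0 < Dl)%N.
  rewrite lt0n; apply/eqP => D0; move: (aD j) pj; rewrite D0.
  by rewrite normr_le0 => /eqP ->; rewrite mul0r.
have gD : Dl%:Z <= `|g j 0|.
  apply/ltW/(le_lt_trans _ hg); rewrite lez_nat expnS expn1.
  by apply: leq_trans (leq_pmulr _ D0) _; apply: leq_pmull.
have neg i : a i 0 * g i 0 < 0 -> - (a i 0 * g i 0) <= (Dl ^ 2)%:Z.
  move=> hi; have h := nB i hi; have := aD i; have := aD j => aDj aDi.
  have gi : `|g i 0| <= Dl%:Z.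
    rewrite leNgt; apply/negP => hgi; apply: h; first by apply/ltW/(le_lt_trans aDj).
    exact: le_trans aDi gD.
  rewrite -(ltr0_norm hi) normrM -mulnn PoszM.
  by apply: ler_pM.
have : - (a j 0 * g j 0) = \sum_(i | i != j) a i 0 * g i 0.
  by move: ag; rewrite /idot (bigD1 j) //= => /eqP; rewrite addr_eq0 => /eqP ->; rewrite opprK.
have : - (\sum_(i | i != j) a i 0 * g i 0) <= \sum_(i < n | i != j) (Dl ^ 2)%:Z.
  rewrite -sumrN; apply: ler_sum => i _; case: (ltrP (a i 0 * g i 0) 0) => hi; first exact: neg.
  by apply: (@le_trans _ _ 0); rewrite ?oppr_le0.
move=> h1 h2; rewrite -h2 opprK in h1.
have h3 : \sum_(i < n | i != j) (Dl ^ 2)%:Z <= (n * Dl ^ 2)%:Z.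
  rewrite sumr_const cardC1 card_ord -mulr_natl natz -PoszM lez_nat leq_mul2r.
  by rewrite leq_pred orbT.
have : `|g j 0| <= a j 0 * g j 0.
  rewrite -(gtr0_norm pj) normrM; apply: ler_peMl => //.
  have : a j 0 != 0 by apply/eqP => e; rewrite e mul0r in pj.
  by rewrite -normr_gt0; lia.
move=> h4; have := le_trans h4 (le_trans h1 h3); by rewrite leNgt hg.
Qed.

(** Three sources: a unit vector where [a] vanishes, an exchange of [a j] against [a i] between two
    coordinates of opposite contribution, or [g] itself if no exchange fits into it. *)
Lemma small_conformal_kernel (n Dl : nat) (a g : 'cV[int]_n) :
  (0 < Dl)%N -> (forall i, `|a i 0| <= Dl%:Z) -> idot a g = 0 -> g != 0 ->
  exists g' : 'cV[int]_n, [/\ g' != 0, idot a g' = 0,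
    forall j, `|g' j 0| <= (n * Dl ^ 2)%:Z & forall j, conformal (g' j 0) (g j 0)].
Proof.
move=> D0 aD ag g0.
have n0 : (0 < n)%N.
  by case: n a g aD ag g0 => // a g _ _ /eqP[]; apply/colP => -[].
have nD (x : int) : x <= Dl%:Z -> x <= (n * Dl ^ 2)%:Z.
  move=> h; apply: le_trans h _; rewrite lez_nat expnS expn1.
  by apply: leq_trans (leq_pmulr _ D0) _; apply: leq_pmull.
have [/existsP[j /andP[/eqP aj gj]]|A] := boolP [exists j, (a j 0 == 0) && (g j 0 != 0)].
  exists (\col_i if i == j then Num.sg (g j 0) else 0); split.
  - apply/eqP => /colP/(_ j); rewrite !mxE eqxx => /eqP.
    by rewrite sgr_eq0 (negPf gj).
  - rewrite /idot (bigD1 j) //= aj mul0r big1 ?addr0 // => i /negPf ij.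
    by rewrite mxE ij mulr0.
  - by move=> i; rewrite mxE; apply: nD; case: eqP => _; rewrite ?normr0 // normr_sg gj; lia.
  - move=> i; rewrite mxE; case: eqP => [->|_]; last by rewrite /conformal; lia.
    by rewrite /conformal; case: sgrP gj; lia.
have {}A j : a j 0 = 0 -> g j 0 = 0.
  move=> aj; move: A; rewrite negb_exists => /forallP/(_ j).
  by rewrite aj eqxx /= negbK => /eqP.
have [/existsP[i /existsP[j /and4P[hi hj h1 h2]]]|B] := boolP [exists i, exists j,
    [&& 0 < a i 0 * g i 0, a j 0 * g j 0 < 0, `|a j 0| <= `|g i 0| & `|a i 0| <= `|g j 0|]].
  have ij : i != j by apply/eqP => e; rewrite e in hi; lia.
  exists (\col_l if l == i then `|a j 0| * Num.sg (g i 0)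
            else if l == j then `|a i 0| * Num.sg (g j 0) else 0); split.
  - apply/eqP => /colP/(_ i); rewrite !mxE eqxx => /eqP.
    rewrite mulf_eq0 normr_eq0 sgr_eq0 => /orP[] /eqP e.
      by rewrite e mul0r in hj.
    by rewrite e mulr0 in hi.
  - rewrite /idot (bigD1 i) //= (bigD1 j) 1?eq_sym //= !mxE !eqxx eq_sym (negPf ij).
    rewrite big1 ?addr0; last first.
      by move=> l /andP[/negPf li /negPf lj]; rewrite mxE li lj mulr0.
    have s1 : Num.sg (a i 0) * Num.sg (g i 0) = 1 by rewrite -sgrM gtr0_sg.
    have s2 : Num.sg (a j 0) * Num.sg (g j 0) = -1 by rewrite -sgrM ltr0_sg.
    rewrite {1}[a i 0]numEsg {2}[a j 0]numEsg.
    transitivity (`|a i 0| * `|a j 0| * (Num.sg (a i 0) * Num.sg (g i 0) + Num.sg (a j 0) * Num.sg (g j 0))).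
      by ring.
    by rewrite s1 s2 subrr mulr0.
  - move=> l; rewrite mxE; apply: nD.
    have sg1 (x : int) : `|Num.sg x| <= 1 by rewrite normr_sg; case: (x != 0).
    case: eqP => _; first by rewrite normrM normr_id; apply: le_trans (ler_piMr _ (sg1 _)) (aD _).
    case: eqP => _; last by rewrite normr0.
    by rewrite normrM normr_id; apply: le_trans (ler_piMr _ (sg1 _)) (aD _).
  - move=> l; rewrite mxE /conformal; case: eqP => [->|_].
      move: h1; case: (sgrP (g i 0)) => e; rewrite ?mulr0 ?mulr1 ?mulrN1; lia.
    case: eqP => [->|_]; last by lia.
    by move: h2; case: (sgrP (g j 0)) => e; rewrite ?mulr0 ?mulr1 ?mulrN1; lia.
have {}B i j : 0 < a i 0 * g i 0 -> a j 0 * g j 0 < 0 -> `|a j 0| <= `|g i 0| ->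
    `|a i 0| <= `|g j 0| -> False.
  move=> h1 h2 h3 h4; move/negP: B; apply; apply/existsP; exists i.
  by apply/existsP; exists j; rewrite h1 h2 h3 h4.
exists g; split => //; last by move=> j; rewrite /conformal; lia.
move=> j; case: (ltrgtP (a j 0 * g j 0) 0) => hj.
- have := @kernel_entry_bound n Dl a (- g) j aD; rewrite idotNr ag oppr0 !mxE normrN; apply=> //.
    by move=> i; rewrite !mxE mulrN oppr_lt0 normrN => h1 h2 h3; apply: (B i j).
  by rewrite mulrN oppr_gt0.
- apply: (kernel_entry_bound aD ag) => // i h1 h2 h3; exact: (B j i).
- move/eqP: hj; rewrite mulf_eq0 => /orP[/eqP/A|/eqP] ->; rewrite normr0 //.
Qed.

Lemma conformal_sub_le (x y : int) : conformal x y -> (absz (y - x) <= absz y)%N.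
Proof. rewrite /conformal; lia. Qed.

Lemma conformal_sub_lt (x y : int) :
  conformal x y -> x != 0 -> (absz (y - x) < absz y)%N.
Proof. rewrite /conformal; lia. Qed.

Lemma conformal_sub_ge (v x y : int) :
  conformal x y -> 0 <= v -> 0 <= v + y -> 0 <= v + (y - x).
Proof. rewrite /conformal; lia. Qed.

(** Induction on the 1-norm, splitting off a short conformal kernel vector. Its entries are at most
    [T], so it may be added to the truncation whenever it may be added to [v]; conformality ensures
    that it and the remainder may each be added to [v]. *)
Lemma kernel_positive_truncate (n Dl : nat) (a c v v' : 'cV[int]_n) (T : int) :
  (0 < Dl)%N -> (forall i, `|a i 0| <= Dl%:Z) -> (n * Dl ^ 2)%:Z <= T ->
  (forall j, v' j 0 = Num.min (v j 0) T) -> (forall j, 0 <= v j 0) ->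
  (forall g : 'cV[int]_n, idot a g = 0 -> g != 0 -> (forall j, 0 <= v' j 0 + g j 0) -> 0 < idot c g) ->
  forall g : 'cV[int]_n, idot a g = 0 -> g != 0 -> (forall j, 0 <= v j 0 + g j 0) -> 0 < idot c g.
Proof.
move=> D0 aD hT v'E v0 small g.
move: {2}(\sum_j absz (g j 0%R))%N (leqnn (\sum_j absz (g j 0%R))%N) => k.
elim: k g => [|k IH] g hk ag g0 vg.
  case/eqP: g0; apply/colP => j; rewrite mxE; move: hk.
  by rewrite leqn0 sum_nat_eq0 => /forallP/(_ j)/=; rewrite absz_eq0 => /eqP.
have [g' [g'0 ag' g'D conf]] := small_conformal_kernel D0 aD ag g0.
have cg' : 0 < idot c g'.
  apply: small => // j; rewrite v'E.
  have := conf j; have := g'D j; have := vg j; have := v0 j.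
  by rewrite /conformal; case: (leP (v j 0) T); lia.
have [e|gg'] := eqVneq (g - g') 0.
  by rewrite -(subrK g' g) e add0r.
rewrite -(subrK g' g) idotDr addr_gt0 //; apply: IH => //.
- rewrite -ltnS; apply: leq_trans hk.
  have [j0 hj0] : exists j, g' j 0 != 0.
    apply/existsP; rewrite -negb_forall; apply: contra g'0 => /forallP h.
    by apply/eqP/colP => j; rewrite mxE; apply/eqP/h.
  rewrite (bigD1 j0) //= [X in (_ < X)%N](bigD1 j0) //= -addSn leq_add //.
    by rewrite !mxE; apply: conformal_sub_lt.
  by apply: leq_sum => j _; rewrite !mxE; apply: conformal_sub_le.
- by rewrite idotBr ag ag' subr0.
- by move=> j; rewrite !mxE; apply: conformal_sub_ge.
Qed.

Lemma sqr_dist_le (x w V : int) :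
  x <= V -> w <= V -> 0 <= x -> 0 <= w -> (x - w) ^+ 2 <= V ^+ 2.
Proof. move=> *; nia. Qed.

(* If [y] is not rigid, one of [y + d], [y - d] decreases [idot c] or keeps it and
   increases the distance to [v]; this terminates as [idot c] bounds the entries. *)
Lemma rigid_descent (n : nat) (a c v y : 'cV[int]_n) (b : int) :
  (forall j, 0 < c j 0) -> sol a b v -> sol a b y -> y != v -> idot c y <= idot c v ->
  exists y', [/\ sol a b y', rigid a y', y' != v & idot c y' <= idot c v].
Proof.
move=> c0 sv.
(* The entries of [c] are at least 1, so a solution not above the level of [v] has entries at most
   [idot c v]; thus [K] bounds its squared distance to [v]. *)
pose K : int := n%:Z * idot c v ^+ 2.
pose Q (y : 'cV[int]_n) := \sum_j (y j 0 - v j 0) ^+ 2.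
have Q0 x : 0 <= Q x by apply: sumr_ge0 => j _; apply: sqr_ge0.
have coord x j : sol a b x -> x j 0 <= idot c x.
  move=> [_ x0]; rewrite /idot (bigD1 j) //=; apply: ler_wpDr.
    by apply: sumr_ge0 => i _; apply: mulr_ge0 => //; apply: ltW.
  by apply: ler_peMl => //; have := c0 j; lia.
have QK x : sol a b x -> idot c x <= idot c v -> Q x <= K.
  move=> sx hx; have -> : K = \sum_(j < n) idot c v ^+ 2 by rewrite sumr_const card_ord -mulr_natl natz.
  apply: ler_sum => j _; have h1 := coord x j sx; have h2 := coord v j sv.
  have [_ /(_ j) x0] := sx; have [_ /(_ j) v0] := sv.
  exact: (sqr_dist_le (le_trans h1 hx) h2).
(* A lexicographic measure as a single number: the factor [K + 1] exceeds the range of [Q], so a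
   drop of [idot c] outweighs any change of the distance. *)
move: {2}(absz (idot c y * (K + 1) + (K - Q y)%R)).+1 (ltnSn (absz (idot c y * (K + 1) + (K - Q y)%R))) => k.
elim: k y => // k IH y hk sy yv cyv.
have [ry|/existsNP[d /not_implyP[ad /not_implyP[pd /not_implyP[md d0]]]]] := pselect (rigid a y).
  by exists y.
have step (d1 : 'cV[int]_n) : idot a d1 = 0 -> (forall i, 0 <= y i 0 + d1 i 0) -> y + d1 != v ->
    idot c (y + d1) * (K + 1) + (K - Q (y + d1)) < idot c y * (K + 1) + (K - Q y) ->
    idot c d1 <= 0 ->
    exists y', [/\ sol a b y', rigid a y', y' != v & idot c y' <= idot c v].
  move=> ad1 pd1 yd1 mu cd1.
  have sy1 : sol a b (y + d1).
    by case: sy => yb y0; split => [|i]; rewrite ?idotDr ?yb ?ad1 ?addr0 // mxE.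
  have cy1 : idot c (y + d1) <= idot c v by rewrite idotDr; lia.
  apply: (IH (y + d1)) => //.
  have K1 : 0 <= K by rewrite /K mulr_ge0 // sqr_ge0.
  have q1 := QK _ sy1 cy1.
  have p1 : 0 <= idot c (y + d1) * (K + 1).
    apply: mulr_ge0; last by lia.
    by apply: sumr_ge0 => i _; apply: mulr_ge0; [apply: ltW|case: sy1].
  by move: hk mu q1 p1; lia.
have K1 : 0 <= K by rewrite /K mulr_ge0 // sqr_ge0.
have dec (d1 : 'cV[int]_n) : idot a d1 = 0 -> (forall i, 0 <= y i 0 + d1 i 0) -> idot c d1 < 0 ->
    exists y', [/\ sol a b y', rigid a y', y' != v & idot c y' <= idot c v].
  move=> ad1 pd1 cd1.
  have sy1 : sol a b (y + d1).
    by case: sy => yb y0; split => [|i]; rewrite ?idotDr ?yb ?ad1 ?addr0 // mxE.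
  apply: (step d1) => //; last exact: ltW.
    by apply/eqP => e; move: cyv; rewrite -e idotDr; lia.
  have q1 := QK _ sy cyv; have q2 := Q0 (y + d1).
  rewrite idotDr; nia.
case: (ltrgtP (idot c d) 0) => cd; first by apply: (dec d).
  by apply: (dec (- d)); rewrite ?idotNr ?ad ?oppr0 ?oppr_lt0 // => i; rewrite mxE.
have Qd (d1 : 'cV[int]_n) : d1 != 0 -> 0 <= \sum_j (y j 0 - v j 0) * d1 j 0 -> Q y < Q (y + d1).
  move=> d10 h.
  have [j hj] : exists j, d1 j 0 != 0.
    apply/existsP; rewrite -negb_forall; apply: contra d10 => /forallP h1.
    by apply/eqP/colP => j; rewrite mxE; apply/eqP/h1.
  have -> : Q (y + d1) = Q y + 2 * (\sum_j (y j 0 - v j 0) * d1 j 0) + \sum_j d1 j 0 ^+ 2.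
    rewrite mulr_sumr -!big_split; apply: eq_bigr => i _ /=.
    by rewrite mxE; ring.
  have : 0 < \sum_j d1 j 0 ^+ 2.
    rewrite (bigD1 j) //=; apply: ltr_wpDr.
      by apply: sumr_ge0 => i _; apply: sqr_ge0.
    by rewrite lt_def sqr_ge0 expf_eq0 /= hj.
  by lia.
have fin (d1 : 'cV[int]_n) : d1 != 0 -> idot a d1 = 0 -> (forall i, 0 <= y i 0 + d1 i 0) -> idot c d1 = 0 ->
    0 <= \sum_j (y j 0 - v j 0) * d1 j 0 ->
    exists y', [/\ sol a b y', rigid a y', y' != v & idot c y' <= idot c v].
  move=> d10 ad1 pd1 cd1 h; have hQ := Qd d1 d10 h.
  apply: (step d1) => //; last by rewrite cd1.
    apply/eqP => e; have := Q0 y; move: hQ; rewrite e /Q [X in _ < X]big1; last first.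
      by move=> j _; rewrite subrr expr0n.
    by lia.
  by rewrite idotDr cd1 addr0; lia.
have d0' : d != 0 by apply/eqP.
case: (lerP 0 (\sum_j (y j 0 - v j 0) * d j 0)) => h; first exact: (fin d).
apply: (fin (- d)); rewrite ?oppr_eq0 ?idotNr ?ad ?cd ?oppr0 //.
  by move=> i; rewrite mxE.
rewrite (eq_bigr (fun j => - ((y j 0 - v j 0) * d j 0))) ?sumrN ?oppr_ge0 ?ltW //.
by move=> j _; rewrite mxE mulrN.
Qed.

Lemma sqrn_le_exp2 (r : nat) : (r.+1 ^ 2 <= 4 * 2 ^ r)%N.
Proof.
case: r => [|[|[|r]]] //; elim: r => [|r IH] //.
rewrite [(2 ^ r.+4)%N]expnS -mulnn; rewrite -mulnn in IH.
by move: (2 ^ r.+3)%N IH => X; nia.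
Qed.

(* Pigeonhole: [idot a] restricted to the box [0, u] is injective on a rigid [u],
   and takes at most [1 + \sum_j `|a j| * u j] values. *)
Lemma rigid_box (n Dl : nat) (a u : 'cV[int]_n) (i : 'I_n) :
  (0 < Dl)%N -> (forall j, `|a j 0| <= Dl%:Z) -> (forall j, 0 <= u j 0) ->
  (forall j, u j 0 <= u i 0) -> rigid a u ->
  (\prod_(j < n | j != i) (absz (u j 0%R)).+1 <= 4 * Dl ^ 2)%N.
Proof.
move=> D0 aD u0 ui rig.
pose y j := absz (u j 0); pose M := y i.
have yE j : u j 0 = (y j)%:Z by rewrite /y gez0_abs.
have yM j : (y j <= M)%N by rewrite -lez_nat -!yE.
pose al j := absz (a j 0).
have alD j : (al j <= Dl)%N by rewrite -lez_nat /al abszE.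
pose R := (\sum_j al j * y j)%N.
(* Complementing the coordinates with negative coefficient moves the scalar product into the range
   from 0 to [R]. *)
pose e (f : {dffun forall j : 'I_n, 'I_(y j).+1}) j : nat :=
  if 0 <= a j 0 then f j : nat else (y j - f j)%N.
have e_le f j : (e f j <= y j)%N.
  by rewrite /e; case: ifP => _; rewrite ?leq_subr // -ltnS ltn_ord.
pose phi f := (\sum_j al j * e f j)%N.
have phiR f : (phi f < R.+1)%N.
  by rewrite ltnS; apply: leq_sum => j _; rewrite leq_mul2l e_le orbT.
have inj : injective (fun f => Ordinal (phiR f)).
  move=> f1 f2 [hphi]; pose d : 'cV[int]_n := \col_j ((f1 j : nat)%:Z - (f2 j : nat)%:Z).
  have f1y j : (f1 j <= y j)%N by rewrite -ltnS ltn_ord.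
  have f2y j : (f2 j <= y j)%N by rewrite -ltnS ltn_ord.
  have d0 : d = 0.
    apply: rig.
    - rewrite /idot; transitivity ((phi f1)%:Z - (phi f2)%:Z); last by rewrite hphi subrr.
      rewrite /phi -!natz !natr_sum -sumrB; apply: eq_bigr => j _.
      rewrite mxE /al /e; have := f1y j; have := f2y j; case: ifP => ha h1 h2; nia.
    - by move=> j; rewrite mxE yE; have := f2y j; lia.
    - by move=> j; rewrite mxE yE; have := f1y j; lia.
  apply/ffunP => j; apply/val_inj => /=.
  by have /colP/(_ j) := d0; rewrite !mxE; lia.
have := leq_card _ inj; rewrite card_dep_ffun card_ord foldrE big_image /=.
rewrite (eq_bigr (fun j => (y j).+1)); last by move=> j _; rewrite card_ord.
rewrite (bigD1 i) //= -/M; set P := (\prod_(j | j != i) _)%N => hP.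
(* [r] counts the non-zero coordinates other than [i]. Pigeonhole gives [(M + 1) * P <= R + 1] with
   [R <= Dl * (r + 1) * M], so the possibly huge [M] cancels and [P <= Dl * (r + 1)] is left. With
   [2 ^ r <= P] this closes up: P^2 <= Dl^2 (r + 1)^2 <= 4 Dl^2 2^r <= 4 Dl^2 P. *)
pose r := #|[pred j | (j != i) && (0 < y j)%N]|.
have P2 : (2 ^ r <= P)%N.
  rewrite /P (bigID (fun j => 0 < y j)%N) /= -[X in (X <= _)%N]muln1 leq_mul //.
    rewrite -prod_nat_const; rewrite (eq_bigl (fun j => (j != i) && (0 < y j)%N)) //.
    by apply: leq_prod => j /andP[_ hj].
  by rewrite prodn_cond_gt0.
have RM : (R <= Dl * r.+1 * M)%N.
  apply: leq_trans (_ : \sum_(j | (0 < y j)%N) Dl * M <= _)%N.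
    rewrite [X in (_ <= X)%N]big_mkcond /=; apply: leq_sum => j _.
    by case: posnP => [->|hj]; rewrite ?muln0 //= leq_mul.
  have hs : (#|[pred j | 0 < y j]%N| <= r.+1)%N.
    rewrite (cardD1 i) -[r.+1]add1n; apply: leq_add; first exact: leq_b1.
    by apply/eq_leq/eq_card => j; rewrite !inE.
  rewrite sum_nat_const mulnA; apply: leq_mul => //.
  by rewrite [(Dl * _)%N]mulnC; apply: leq_mul.
have PD : (P <= Dl * r.+1)%N.
  have [M0|M0] := posnP M.
    have -> : P = 1%N.
      rewrite /P big1 // => j _; congr _.+1; apply/eqP; rewrite -leqn0 -M0; exact: yM.
    by rewrite muln_gt0 D0.
  rewrite -(leq_pmul2l (ltn0Sn M)); apply: leq_trans hP _.
  by apply: leq_ltn_trans RM _; rewrite mulSn mulnC -addn1 addnC leq_add2r muln_gt0 D0.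
have := sqrn_le_exp2 r => hr.
have P0 : (0 < P)%N by apply: leq_trans P2; rewrite expn_gt0.
change (P <= 4 * Dl ^ 2)%N.
rewrite -(leq_pmul2r P0); apply: leq_trans (_ : (Dl * r.+1) ^ 2 <= _)%N.
  by rewrite -mulnn leq_mul.
rewrite expnMn mulnC [(4 * _)%N]mulnC -mulnA [(4 * P)%N]mulnC mulnC leq_mul2l; apply/orP; right.
by apply: leq_trans hr _; rewrite mulnC leq_mul2r P2.
Qed.

(** * Candidates *)

(** For nonnegative [w], the number of integer points in the box from 0 to [w]. *)
Definition weight (n : nat) (w : 'cV[int]_n) : nat := (\prod_(j < n) (absz (w j 0%R)).+1)%N.

Definition set_coord (n : nat) (w : 'cV[int]_n) (k : nat) (t : int) : 'cV[int]_n :=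
  \col_i (if (i : nat) == k then t else w i 0).

(* The nonnegative vectors of weight at most [N] supported on the first [k]
   coordinates, see [boxesP]. *)
Fixpoint boxes (n N k : nat) : seq 'cV[int]_n :=
  if k is k'.+1 then boxes n N k' ++ [seq set_coord w k' t%:Z | w <- boxes n N k',
                                        t <- iota 1 (N %/ weight w - 1)]
  else [:: 0].

Lemma weight_gt0 (n : nat) (w : 'cV[int]_n) : (0 < weight w)%N.
Proof. exact: prodn_gt0. Qed.

Lemma weight0 (n : nat) : weight (0 : 'cV[int]_n) = 1%N.
Proof. by rewrite /weight big1 // => j _; rewrite mxE. Qed.

Lemma weight_set_coord (n : nat) (w : 'cV[int]_n) (k : 'I_n) (t : nat) :
  w k 0 = 0 -> weight (set_coord w k t%:Z) = (t.+1 * weight w)%N.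
Proof.
move=> wk; rewrite /weight (bigD1 k) //= [in RHS](bigD1 k) //= wk mxE eqxx mul1n.
congr (_ * _)%N; apply: eq_bigr => j /negPf jk; rewrite mxE.
by rewrite (_ : (j : nat) == k = false) //; apply: jk.
Qed.

Lemma boxesP (n N k : nat) (w : 'cV[int]_n) : (0 < N)%N -> (k <= n)%N ->
  reflect [/\ forall j, 0 <= w j 0, (weight w <= N)%N
            & forall j : 'I_n, (k <= j)%N -> w j 0 = 0] (w \in boxes n N k).
Proof.
move=> N0; elim: k w => [|k IH] w kn.
  rewrite /= inE; apply: (iffP eqP) => [->|[_ _ h]].
    by split=> [j||j _]; rewrite ?mxE ?weight0.
  by apply/colP => j; rewrite mxE h.
have {}IH w0 := IH w0 (ltnW kn); pose kk := Ordinal kn.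
rewrite /= mem_cat; apply: (iffP orP) => [[/IH[w0 wN wk]|/allpairsPdep[x [t]]]|[w0 wN wk]].
- by split => // j kj; apply: wk; apply: ltnW.
- rewrite mem_iota => -[/IH[x0 xN xk] /andP[t1 tN] ->]; split.
  + by move=> j; rewrite mxE; case: eqP.
  + have -> : set_coord x k t%:Z = set_coord x kk t%:Z by [].
    rewrite weight_set_coord; last by apply: xk.
    rewrite -leq_divRL ?weight_gt0 //; move: tN.
    have : (0 < N %/ weight x)%N by rewrite divn_gt0 ?weight_gt0.
    by lia.
  + by move=> j kj; rewrite mxE gtn_eqF //; apply: xk; apply: ltnW.
have [wkk|wkk] := eqVneq (w kk 0) 0.
  left; apply/IH; split => // j; rewrite leq_eqVlt => /orP[/eqP kj|]; last exact: wk.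
  by rewrite -[RHS]wkk; congr (w _ _); apply: val_inj.
right; apply/allpairsPdep; exists (set_coord w kk 0), (absz (w kk 0)).
have wE : w = set_coord (set_coord w kk 0) k (absz (w kk 0))%:Z.
  apply/colP => j; rewrite !mxE; case: eqP => jk //.
  by rewrite gez0_abs // ; congr (w _ _); apply: val_inj.
have wE2 : weight w = ((absz (w kk 0%R)).+1 * weight (set_coord w kk 0))%N.
  by rewrite {1}wE -[k]/(nat_of_ord kk) weight_set_coord // mxE eqxx.
have lt0 : (0 < absz (w kk 0%R))%N by rewrite absz_gt0.
split => //.
  apply/IH; split.
  - by move=> j; rewrite mxE; case: eqP.
  - by apply: leq_trans wN; rewrite wE2 leq_pmull.
  - move=> j; rewrite mxE leq_eqVlt => /orP[/eqP kj|kj]; first by rewrite /= -kj eqxx.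
    by rewrite wk //; case: eqP.
rewrite mem_iota lt0 /= subnKC; last first.
  by rewrite divn_gt0 ?weight_gt0 // (leq_trans _ wN) // wE2 leq_pmull.
by rewrite leq_divRL ?weight_gt0 // -wE2.
Qed.

Lemma boxes_uniq (n N k : nat) : (0 < N)%N -> (k <= n)%N -> uniq (boxes n N k).
Proof.
move=> N0; elim: k => [|k IH] kn //=; have kn' := ltnW kn; pose kk := Ordinal kn.
have zk w : w \in boxes n N k -> w kk 0 = 0.
  by move=> /(boxesP _ N0 kn')[_ _ h]; apply: h.
rewrite cat_uniq IH //=; apply/andP; split.
  apply/hasPn => x /allpairsPdep[w [t [wk]]]; rewrite mem_iota => /andP[t1 _] ->.
  apply/negP => /zk; rewrite mxE eqxx; lia.
apply: allpairs_uniq_dep; first exact: IH.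
  by move=> w _; apply: iota_uniq.
move=> [w t] [w' t'] /allpairsPdep[x [y [xk _ [-> ->]]]] /allpairsPdep[x' [y' [xk' _ [-> ->]]]] /= e.
have ty : y = y'.
  by have /colP/(_ kk) := e; rewrite !mxE eqxx => -[].
suff -> : x = x' by rewrite ty.
apply/colP => j; have /colP/(_ j) := e; rewrite !mxE.
case: eqP => // jk _; have -> : j = kk by apply: val_inj.
by rewrite !zk.
Qed.

(** * Number of boxes *)

(** The bound 1/t^2 <= 1/(t - 1) - 1/t telescopes to at most 1. Starting at 2 gives the constant 1,
    with which the induction in [size_boxes] reproduces itself. *)
Lemma sum_div_sqr (M : nat) : (\sum_(2 <= t < M.+1) (M %/ t) ^ 2 <= M ^ 2)%N.
Proof.
have h (R : realFieldType) m : \sum_(2 <= t < m.+2) ((t%:R : R) ^+ 2)^-1 <= 1.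
  apply: le_trans (_ : \sum_(2 <= t < m.+2) ((t.-1)%:R^-1 - t%:R^-1) <= _).
    rewrite big_nat [X in _ <= X]big_nat; apply: ler_sum => -[|[|t]] //= _.
    rewrite -subr_ge0.
    have t0 : 0 <= (t%:R : R) by [].
    rewrite -![_.+2%:R]natr1 -![_.+1%:R]natr1; move: (t%:R) t0 => x x0.
    have -> : (x + 1)^-1 - (x + 1 + 1)^-1 - ((x + 1 + 1) ^+ 2)^-1 =
       ((x + 1) * (x + 1 + 1) ^+ 2)^-1.
      by field; rewrite !gt_eqF //; lra.
    by rewrite invr_ge0 mulr_ge0 ?exprn_ge0 //; lra.
  rewrite (@telescope_sumr_eq _ _ _ (fun t => - (t.-1)%:R^-1)) //.
    by rewrite /= invr1 opprK addrC; rewrite gerDl oppr_le0 invr_ge0.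
  by move=> t _; rewrite /= opprK addrC.
case: M => [|M]; first by rewrite big_geq.
rewrite -(ler_nat rat) natr_sum.
apply: le_trans (_ : \sum_(2 <= t < M.+2) (M.+1%:R ^+ 2 * (t%:R ^+ 2)^-1) <= _).
  rewrite big_nat [X in _ <= X]big_nat; apply: ler_sum => t /andP[t2 _].
  have t0 : (0 : rat) < t%:R ^+ 2 by rewrite exprn_gt0 // ltr0n; apply: leq_trans t2.
  rewrite ler_pdivlMr // -!natrX -natrM ler_nat -expnMn leq_exp2r //.
  exact: leq_trunc_div.
rewrite -mulr_sumr -natrX -[X in _ <= X]mulr1; apply: ler_wpM2l; first exact: ler0n.
exact: h.
Qed.

(** Sorting by the value [t - 1] of the last coordinate, the rest has weight at most [M %/ t]. A
    vector [w] has [M %/ weight w] extensions, the zero extension included; the sums over [w] and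
    [t] are exchanged. *)
Lemma size_boxes_sum (n M k : nat) : (0 < M)%N -> (k < n)%N ->
  size (boxes n M k.+1) = (\sum_(1 <= t < M.+1) size (boxes n (M %/ t) k))%N.
Proof.
move=> M0 kn; have kn' := ltnW kn.
rewrite /= size_cat size_allpairs_dep.
have -> : (size (boxes n M k) + sumn [seq size (iota 1 (M %/ weight w - 1)) | w <- boxes n M k]
   = \sum_(w <- boxes n M k) M %/ weight w)%N.
  rewrite -sum1_size sumnE big_map -big_split /= big_seq [RHS]big_seq.
  apply: eq_bigr => w /(boxesP _ M0 kn')[_ wM _]; rewrite size_iota subnKC //.
  by rewrite divn_gt0 ?weight_gt0.
transitivity (\sum_(w <- boxes n M k) \sum_(1 <= t < M.+1 | t * weight w <= M) 1)%N.
  rewrite big_seq [RHS]big_seq; apply: eq_bigr => w _.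
  have w0 := weight_gt0 w.
  rewrite (big_cat_nat (n := (M %/ weight w).+1)) //=; last by rewrite ltnS leq_div.
  rewrite [X in (_ + X)%N]big_nat_cond [X in (_ + X)%N]big1 ?addn0; last first.
    by move=> t /andP[/andP[h1 _]]; rewrite -leq_divRL // leqNgt h1.
  rewrite big_nat_cond (eq_bigl (fun t => 1 <= t < (M %/ weight w).+1)%N); last first.
    by move=> t; apply: andb_idr => /andP[h1 h2]; rewrite -leq_divRL.
  by rewrite -big_nat sum_nat_const_nat subn1 muln1.
rewrite (exchange_big_dep xpredT) //= big_nat [RHS]big_nat.
apply: eq_bigr => t /andP[t1 tM].
have Mt : (0 < M %/ t)%N by rewrite divn_gt0.
rewrite -big_filter sum1_size; apply/perm_size/uniq_perm.
- by rewrite filter_uniq // boxes_uniq.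
- exact: boxes_uniq.
move=> w; rewrite mem_filter; apply/andP/idP.
  by move=> [h /(boxesP _ M0 kn')[w0 wM wk]]; apply/(boxesP _ Mt kn'); split; rewrite // leq_divRL // mulnC.
move=> /(boxesP _ Mt kn')[w0 wM wk]; rewrite leq_divRL // in wM.
split; first by rewrite mulnC.
by apply/(boxesP _ M0 kn'); split => //; apply: leq_trans wM; apply: leq_pmulr.
Qed.

(** The term [t = 1] keeps the exponent l; for [t >= 2] the logarithm of [M %/ t] is smaller by at
    least one, and the squares sum to at most M^2. Then (k + 1)^l + (k + 1)^(l - 1) <= (k + 2)^l.
    The factor M^2 in place of M is what keeps the sum over [t] bounded. *)
Lemma size_boxes (n M k : nat) : (0 < M)%N -> (k <= n)%N ->
  (size (boxes n M k) <= M ^ 2 * k.+1 ^ trunc_log 2 M)%N.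
Proof.
elim: k M => [|k IH] M M0 kn.
  by rewrite exp1n muln1 /= expn_gt0 M0.
rewrite size_boxes_sum // big_ltn ?ltnS // divn1.
have [M1|M1] := leqP M 1.
  have -> : M = 1%N by apply/eqP; rewrite eqn_leq M1.
  rewrite big_geq // addn0; apply: leq_trans (IH 1%N isT (ltnW kn)) _.
  by rewrite trunc_log1.
set l := trunc_log 2 M.
have lE : l = (trunc_log 2 M./2).+1 by rewrite /l trunc_log2S.
have h1 := IH M M0 (ltnW kn).
have h2 : (\sum_(2 <= t < M.+1) size (boxes n (M %/ t) k) <= M ^ 2 * k.+1 ^ l.-1)%N.
  apply: leq_trans (_ : \sum_(2 <= t < M.+1) (M %/ t) ^ 2 * k.+1 ^ l.-1 <= _)%N.
    rewrite big_nat [X in (_ <= X)%N]big_nat; apply: leq_sum => t /andP[t2 tM].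
    have Mt : (0 < M %/ t)%N by rewrite divn_gt0 //; apply: leq_trans t2.
    apply: leq_trans (IH _ Mt (ltnW kn)) _; rewrite leq_mul2l; apply/orP; right.
    apply: leq_pexp2l => //; rewrite lE /= -divn2; apply: leq_trunc_log.
    by apply: leq_div2l.
  by rewrite -big_distrl /= leq_mul2r sum_div_sqr orbT.
apply: leq_trans (leq_add h1 h2) _; rewrite -/l lE /= -mulnDr leq_mul2l; apply/orP; right.
rewrite !expnS addnC -mulSn leq_mul //.
by case: (trunc_log 2 M./2) => // e; rewrite leq_exp2r.
Qed.

Definition candv (n : nat) (a : 'cV[int]_n) (b : int) (i : 'I_n) (w : 'cV[int]_n) : 'cV[int]_n :=
  set_coord w i (divz (b - idot a w) (a i 0)).

(** If [a i 0 = 0], the quotient is 0 and the remainder is the whole dividend, so such a candidate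
    passes only if [w] alone solves the equation. *)
Definition cand_ok (n : nat) (a : 'cV[int]_n) (b : int) (i : 'I_n) (w : 'cV[int]_n) : bool :=
  [&& w i 0 == 0, modz (b - idot a w) (a i 0) == 0 & 0 <= divz (b - idot a w) (a i 0)].

(* Breaking ties makes every candidate appear in the output only once. *)
Definition first_argmax (n : nat) (u : 'cV[int]_n) (i : 'I_n) : bool :=
  [forall j : 'I_n, if (j < i)%N then u j 0 + 1 <= u i 0 else u j 0 <= u i 0].

Lemma idot_set_coord (n : nat) (a w : 'cV[int]_n) (i : 'I_n) t :
  idot a (set_coord w i t) = idot a w - a i 0 * w i 0 + a i 0 * t.
Proof.
rewrite /idot (bigD1 i) //= [X in _ = X - _ + _](bigD1 i) //= mxE eqxx.
set A := \sum_(j < n | j != i) _; set B := \sum_(j < n | j != i) _.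
have -> : A = B.
  apply: eq_bigr => j /negPf ji; rewrite mxE.
  by rewrite (_ : (j : nat) == i = false) //; apply: ji.
by ring.
Qed.

Lemma candv_sol (n : nat) (a w : 'cV[int]_n) b i :
  (forall j, 0 <= w j 0) -> cand_ok a b i w -> sol a b (candv a b i w).
Proof.
move=> w0 /and3P[/eqP wi /eqP r0 q0]; split.
  rewrite idot_set_coord wi mulr0 subr0.
  by have := divz_eq (b - idot a w) (a i 0); rewrite r0 addr0 mulrC => <-; rewrite addrC subrK.
by move=> j; rewrite mxE; case: eqP.
Qed.

Lemma first_argmax_ex (n : nat) (u : 'cV[int]_n) : (0 < n)%N -> exists i, first_argmax u i.
Proof.
case: n u => // n u _.
have [i0 _ h0] := arg_maxP (fun i => u i 0) (isT : xpredT (ord0 : 'I_n.+1)).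
have ex : exists k, [exists i : 'I_n.+1, ((i : nat) == k) && (u i 0 == u i0 0)].
  by exists (nat_of_ord i0); apply/existsP; exists i0; rewrite !eqxx.
case: (ex_minnP ex) => k /existsP[i /andP[/eqP ik /eqP ui]] kmin.
exists i; apply/forallP => j; case: ifP => ji; last by rewrite ui; apply: h0.
have h := h0 j isT.
have : u j 0 != u i0 0.
  apply/eqP => e; have : (k <= j)%N by apply: kmin; apply/existsP; exists j; rewrite eqxx e /=.
  by rewrite leqNgt -ik ji.
by move: h; rewrite ui /=; lia.
Qed.

Lemma first_argmax_inj (n : nat) (u : 'cV[int]_n) i j :
  first_argmax u i -> first_argmax u j -> i = j.
Proof.
move=> /forallP hi /forallP hj; apply: val_inj => /=.
case: (ltngtP i j) => // h.
  by have := hi j; have := hj i; rewrite h ltnNge (ltnW h) /=; lia.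
by have := hi j; have := hj i; rewrite h ltnNge (ltnW h) /=; lia.
Qed.

Lemma cand_complete (n Dl : nat) (a u : 'cV[int]_n) (b : int) :
  (0 < n)%N -> (0 < Dl)%N -> (forall j, `|a j 0| <= Dl%:Z) -> sol a b u -> rigid a u ->
  exists i w, [/\ w \in boxes n (4 * Dl ^ 2) n, cand_ok a b i w, first_argmax u i,
                  candv a b i w = u & w = set_coord u i 0].
Proof.
move=> n0 D0 aD [ub u0] rig.
have [i iu] := first_argmax_ex u n0.
pose w := set_coord u i 0.
have ui j : u j 0 <= u i 0 by move/forallP: iu => /(_ j); case: ifP => _; lia.
have wi : w i 0 = 0 by rewrite mxE eqxx.
have qE : b - idot a w = a i 0 * u i 0.
  by rewrite idot_set_coord ub; ring.
(* If [a i 0 = 0], rigidity forces [u i 0 = 0], in agreement with the default value of the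
   quotient. *)
have quo : divz (b - idot a w) (a i 0) = u i 0.
  rewrite qE mulrC; have [ai|ai] := eqVneq (a i 0) 0; last by rewrite mulzK.
  rewrite ai divz0; have [//|uz] := eqVneq (u i 0) 0.
  have : (delta_mx i 0 : 'cV[int]_n) = 0.
    apply: rig; first by rewrite idot_delta.
      by move=> j; rewrite mxE; case: (_ && _); have := u0 j; lia.
    move=> j; rewrite mxE; case: eqP => [->|_] /=; last by rewrite subr0.
    by have := u0 i; move: uz => /=; move: (u i 0) => x; lia.
  by move/colP/(_ i); rewrite !mxE !eqxx.
exists i, w; split => //.
- apply/boxesP; rewrite ?muln_gt0 ?expn_gt0 ?D0 //; split.
  + by move=> j; rewrite mxE; case: eqP.
  + apply: leq_trans (rigid_box D0 aD u0 ui rig); rewrite /weight (bigD1 i) //= wi mul1n.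
    apply: leq_prod => j /negPf ji; rewrite mxE.
    by rewrite (_ : (j : nat) == i = false) //; apply: ji.
  + by move=> j nj; have := ltn_ord j; rewrite ltnNge nj.
- by rewrite /cand_ok wi eqxx quo u0 qE mulrC modzMl eqxx.
- apply/colP => j; rewrite /candv mxE quo; case: eqP => [/val_inj -> //|/eqP ji].
  by rewrite mxE (negPf ji).
Qed.

(** The strict inequalities imposed on a certificate: the unit vectors make it positive, as the
    descent to rigid solutions requires, and the differences compare [v] with its rivals. *)
Definition gens (n N : nat) (a : 'cV[int]_n) (b : int) (v : 'cV[int]_n) : seq 'cV[int]_n :=
  [seq delta_mx j 0 | j <- enum 'I_n] ++
  [seq g <- [seq candv a b p.1 p.2 - v | p <- [seq (i, w) | i <- enum 'I_n, w <- boxes n N n]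
      & cand_ok a b p.1 p.2] | g != 0].

Lemma gensP (n N : nat) (a : 'cV[int]_n) (b : int) (v g : 'cV[int]_n) :
  reflect ((exists j, g = delta_mx j 0) \/
           (exists i w, [/\ w \in boxes n N n, cand_ok a b i w, candv a b i w != v
                          & g = candv a b i w - v]))
          (g \in gens N a b v).
Proof.
rewrite mem_cat mem_filter; apply: (iffP orP).
  case=> [/mapP[j _ ->]|/andP[g0 /mapP[p]]]; first by left; exists j.
  rewrite mem_filter => /andP[ok /allpairsP[q [_ qw pE]]] gE; right.
  rewrite pE in ok gE.
  exists q.1, q.2; split; [exact: qw|exact: ok| |exact: gE].
  by apply: contra g0 => /eqP e; rewrite gE /= e subrr.
case=> [[j ->]|[i [w [wb ok cv ->]]]]; first by left; apply: map_f; rewrite mem_enum.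
right; rewrite subr_eq0 cv; apply/mapP; exists (i, w); last by [].
rewrite mem_filter ok; apply/allpairsP; exists (i, w); split => //.
by rewrite mem_enum.
Qed.

Lemma clear_denominators (m : nat) (l : 'I_m -> rat) : (forall i, 0 <= l i) ->
  exists (d : nat) (k : 'I_m -> nat), (0 < d)%N /\ forall i, d%:R * l i = (k i)%:R.
Proof.
move=> l0.
pose d := (\prod_i absz (denq (l i)))%N.
have dE i : exists e : nat, d = (e * absz (denq (l i)))%N.
  by exists (\prod_(j | j != i) absz (denq (l j)))%N; rewrite /d (bigD1 i) //= mulnC.
have [e hd] : exists e : 'I_m -> nat, forall i, d = (e i * absz (denq (l i)))%N.
  by exists (fun i => sval (cid (dE i))) => i; case: (cid _).
exists d, (fun i => e i * absz (numq (l i)))%N; split.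
  by apply: prodn_gt0 => i; rewrite absz_gt0 denq_neq0.
move=> i; rewrite {1}(hd i) !natrM -mulrA; congr (_ * _).
rewrite -[X in _ * X]divq_num_den.
have -> : (absz (denq (l i)))%:R = (denq (l i))%:~R :> rat.
  by rewrite -[in RHS](gtz0_abs (denq_gt0 _)).
have -> : (absz (numq (l i)))%:R = (numq (l i))%:~R :> rat.
  by rewrite -[in RHS](@gez0_abs (numq (l i))) // numq_ge0.
by rewrite mulrC divfK // intr_eq0 denq_neq0.
Qed.

(** By Gordan's alternative the absence of a positive functional yields a nonnegative relation among
    the generators. Its unit vectors add up to a nonnegative kernel vector [mu]; absorbed into one
    of the solutions that occur, it leaves a relation that shows [v] to be averaged. *)
Lemma bounded_certificate (n B : nat) (a v : 'cV[int]_n) (b : int) (gs : seq 'cV[int]_n) :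
  sol a b v -> ~ averaged a b v ->
  (forall j, delta_mx j 0 \in gs) ->
  (forall g, g \in gs -> (exists j, g = delta_mx j 0) \/
      (exists y, [/\ sol a b y, y != v & g = y - v])) ->
  (forall g, g \in gs -> forall j, `|g j 0| <= B%:Z) ->
  exists c : 'I_n -> int, (forall g, g \in gs -> 1 <= \sum_j c j * g j 0) /\
    forall j, `|c j| <= (n * (n * B) ^ n.-1)%:Z.
Proof.
move=> sv nav deltas gsP gsB.
pose m := size gs; pose G (i : 'I_m) := nth 0 gs i.
have Gin i : G i \in gs by apply: mem_nth.
have idx g : g \in gs -> exists i, g = G i.
  by move=> hg; exists (Ordinal (eq_ind_r is_true hg (index_mem g gs))); rewrite /G nth_index.
have [[c hc]|[l [l0 [i0 li0] lE]]] := gordan (fun i => map_mx intr (G i) : 'cV[rat]_n).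
  pose A : 'M[int]_(m, n) := \matrix_(i, j) G i j 0.
  have [||| c' [c'1 c'2]] := @bounded_solution m n A B c.
  - by move=> i j; rewrite mxE; apply: gsB.
  - move=> j; have [i hi] := idx _ (deltas j); exists i => k.
    by rewrite mxE -hi mxE eqxx andbT.
  - by move=> i; have := hc i; congr (_ < _); apply: eq_bigr => j _; rewrite !mxE mulrC.
  exists c'; split => // g /idx[i ->]; have := c'1 i; congr (_ <= _).
  by apply: eq_bigr => j _; rewrite mxE mulrC.
case: nav.
have [d [k [d0 kE]]] := clear_denominators l0.
have ksum : \sum_i G i *+ k i = 0.
  apply/colP => j; apply: (@intr_inj rat).
  have e : \sum_i l i * (G i j 0)%:~R = 0.
    transitivity ((\sum_i l i *: map_mx intr (G i) : 'cV[rat]_n) j 0); last by rewrite lE mxE.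
    by rewrite summxE; apply: eq_bigr => i _; rewrite !mxE.
  transitivity (d%:R * (\sum_i l i * (G i j 0)%:~R)); last by rewrite e mulr0 mxE.
  rewrite summxE rmorph_sum mulr_sumr; apply: eq_bigr => i _.
  by rewrite /= mulmxnE rmorphMn /= -mulr_natl -kE mulrA.
have ki0 : (0 < k i0)%N.
  by rewrite -(ltr_nat rat) -kE mulr_gt0 // ltr0n.
pose E i := `[< exists j, G i = delta_mx j 0 >].
pose mu := \sum_(i | E i) G i *+ k i.
have mu0 j : 0 <= mu j 0.
  rewrite summxE; apply: sumr_ge0 => i /asboolP[j' ->].
  by rewrite mulmxnE mxE mulrn_wge0.
(* A relation of unit vectors alone is impossible, since their weighted sum has a positive entry. *)
have [i1 /andP[ki1 Ei1]|noi1] := pickP (fun i => (0 < k i)%N && ~~ E i); last first.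
  have kz i : ~~ E i -> k i = 0%N.
    by move=> Ei; have := noi1 i; rewrite Ei andbT lt0n => /negbFE/eqP.
  have Ei0 : E i0 by have := noi1 i0; rewrite ki0 /= => /negbFE.
  have muz : mu = 0.
    rewrite -[RHS]ksum [RHS](bigID E) /= [X in _ + X]big1 ?addr0 // => i /kz ->.
    by rewrite mulr0n.
  have /asboolP[j0 hj0] := Ei0.
  have : 0 < mu j0 0.
    rewrite summxE (bigD1 i0) //= hj0 mulmxnE mxE !eqxx.
    apply: ltr_wpDr; last by rewrite pmulrn_lgt0.
    apply: sumr_ge0 => i /andP[/asboolP[j' ->] _].
    by rewrite mulmxnE mxE mulrn_wge0.
  by rewrite muz mxE ltxx.
(* Indices of unit vectors receive a dummy solution; their weight will be 0. *)
have yex i : exists y, sol a b y /\ (y != v) /\ (~~ E i -> G i = y - v).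
  have [Ei|Ei] := boolP (E i).
    have [/asboolP|[y [h1 h2 h3]]] := gsP _ (Gin i1); first by rewrite -/(E i1) (negPf Ei1).
    by exists y.
  have [/asboolP|[y [h1 h2 h3]]] := gsP _ (Gin i); first by rewrite -/(E i) (negPf Ei).
  by exists y.
pose y i := sval (cid (yex i)).
have ys i : sol a b (y i) by rewrite /y; case: (cid _) => /= ? [].
have yv i : y i != v by rewrite /y; case: (cid _) => /= ? [? []].
have yG i : ~~ E i -> G i = y i - v by rewrite /y; case: (cid _) => /= ? [? []].
have muE : mu = - \sum_(i | ~~ E i) (y i - v) *+ k i.
  apply/eqP; rewrite -subr_eq0 opprK -[X in _ == X]ksum [X in _ == X](bigID E) /=.
  by apply/eqP; congr (_ + _); apply: eq_bigr => i /yG ->.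
have amu : idot a mu = 0.
  rewrite muE idotNr (big_mkcond (fun i => ~~ E i)) /=.
  have -> : \sum_i (if ~~ E i then (y i - v) *+ k i else 0) =
     \sum_i (y i - v) *+ (if ~~ E i then k i else 0).
    by apply: eq_bigr => i _; case: ifP => _; rewrite ?mulr0n.
  rewrite idot_sum big1 ?oppr0 // => i _.
  by rewrite idotBr; case: (ys i) => -> _; case: sv => -> _; rewrite subrr mul0rn.
(* One copy of [y i1] is to be replaced by [y i1 + mu], which must differ from [v]. If it does not,
   [v] is the midpoint of [v + mu] and [v - mu = y i1]. *)
have [e|ne] := eqVneq (y i1 + mu) v.
  have mun0 : mu != 0.
    by apply/eqP => mz; have := yv i1; rewrite -e mz addr0 eqxx.
  apply: (averaged2 (d := mu)) => //.
    split; first by rewrite idotDr amu addr0; case: sv.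
    by move=> j; rewrite mxE addr_ge0 //; case: sv.
  by rewrite -e addrK; apply: ys.
exists m.+1, (fun i => if unlift ord0 i is Some i' then y i' else y i1 + mu),
  (fun i => if unlift ord0 i is Some i' then if E i' then 0%N else (k i' - (i' == i1))%N else 1%N).
split.
- move=> i; case: unliftP => [i'|] _; first by [].
  split => //; split; first by rewrite idotDr amu addr0; case: (ys i1).
  by move=> j; rewrite mxE addr_ge0 //; case: (ys i1).
- by exists ord0; rewrite unlift_none.
rewrite big_ord_recl unlift_none mulr1n.
have -> : \sum_(i < m) ((if unlift ord0 (lift ord0 i) is Some i' then y i' else y i1 + mu) - v) *+
    (if unlift ord0 (lift ord0 i) is Some i' then if E i' then 0%N else (k i' - (i' == i1))%N else 1%N)
  = \sum_(i | ~~ E i) (y i - v) *+ k i - (y i1 - v).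
  rewrite [in RHS](bigD1 i1) //= (bigD1 i1) //= liftK (negPf Ei1) eqxx.
  rewrite -[X in _ = X *+ k i1 + _ - _]opprK.
  have -> : \sum_(i < m | i != i1) ((if unlift ord0 (lift ord0 i) is Some i' then y i' else y i1 + mu) - v) *+
    (if unlift ord0 (lift ord0 i) is Some i' then if E i' then 0%N else (k i' - (i' == i1))%N else 1%N)
   = \sum_(i | ~~ E i && (i != i1)) (y i - v) *+ k i.
    rewrite [RHS]big_mkcondl; apply: eq_bigr => i /negPf ii1; rewrite liftK.
    by case: ifP => _; rewrite ?mulr0n // ii1 subn0.
  by rewrite opprK mulrnBr // mulr1n addrAC.
by rewrite muE [y i1 - _]addrC addrACA addrA; set s := \sum_(i | _) _; rewrite [_ - v]addrC; 
   rewrite [- s + _]addrC !addrA; apply/colP => j; rewrite !mxE; ring.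
Qed.

(** * The vertex test *)

Definition certified (n : nat) (a : 'cV[int]_n) (b : int) (v : 'cV[int]_n) : Prop :=
  exists c : 'cV[int]_n, forall y, sol a b y -> y != v -> idot c v < idot c y.

Definition truncate (n : nat) (T : int) (v : 'cV[int]_n) : 'cV[int]_n :=
  \col_j Num.min (v j 0) T.

Lemma truncate_sol (n : nat) (a v : 'cV[int]_n) (T : int) :
  0 <= T -> (forall j, 0 <= v j 0) -> sol a (idot a (truncate T v)) (truncate T v).
Proof. by move=> T0 v0; split => // j; rewrite mxE le_min v0 T0. Qed.

(** An averaging of the truncation, translated by the nonnegative vector that was cut off, is an
    averaging of [v]. *)
Lemma not_averaged_truncate (n : nat) (a v : 'cV[int]_n) (b T : int) :
  sol a b v -> ~ averaged a b v ->
  ~ averaged a (idot a (truncate T v)) (truncate T v).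
Proof.
move=> [vb v0] nav av; apply: nav.
have := @averaged_shift n a _ _ (v - truncate T v) _ av.
rewrite idotBr vb [X in averaged _ X]addrC subrK [X in averaged _ _ X]addrC subrK; apply.
by move=> j; rewrite !mxE subr_ge0 ge_min lexx.
Qed.

(* The rows of the cone only matter through their sum, the certificate. *)
Lemma stable_certified (n Dl : nat) (a v : 'cV[int]_n) (b T : int) (U : 'M[int]_n) :
  (0 < n)%N -> (0 < Dl)%N -> (forall j, `|a j 0| <= Dl%:Z) -> (n * Dl ^ 2)%:Z <= T ->
  sol a b v ->
  (forall g, g \in gens (4 * Dl ^ 2) a (idot a (truncate T v)) (truncate T v) ->
     0 < \sum_r \sum_j U r j * g j 0) ->
  certified a b v.
Proof.
move=> n0 D0 aD hT [vb v0] stable.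
have T0 : 0 <= T by apply: le_trans hT.
pose c : 'cV[int]_n := \col_j \sum_r U r j.
have cE (g : 'cV[int]_n) : \sum_r \sum_j U r j * g j 0 = idot c g.
  by rewrite exchange_big; apply: eq_bigr => j _; rewrite mxE mulr_suml.
have c0 j : 0 < c j 0.
  rewrite -idot_delta -cE; apply: stable; apply/gensP; left; by exists j.
set v' := truncate T v in stable; set b' := idot a v' in stable.
have sv' : sol a b' v' by apply: truncate_sol.
(* A rival not above the level of [v'] can be lowered to a rigid one, and the rigid ones are among
   the candidates covered by [stable]. *)
have small y : sol a b' y -> y != v' -> idot c v' < idot c y.
  move=> sy yv; rewrite ltNge; apply/negP => cy.
  have [y' [sy' ry' yv' cy']] := rigid_descent c0 sv' sy yv cy.
  have [i [w [wb ok _ yE _]]] := cand_complete n0 D0 aD sy' ry'.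
  have : 0 < idot c (y' - v').
    rewrite -cE; apply: stable; apply/gensP; right; exists i, w.
    by rewrite yE.
  by rewrite idotBr subr_gt0 ltNge cy'.
exists c => y [yb y0] yv.
rewrite -subr_gt0 -idotBr.
apply: (kernel_positive_truncate (v := v) (v' := v') D0 aD hT) => //.
- by move=> j; rewrite mxE.
- move=> g ag g0 vg; have := small (v' + g); rewrite idotDr.
  rewrite -subr_eq0 [v' + g]addrC addrK => /(_ _ g0).
  have -> : (idot c v' < idot c v' + idot c g) = (0 < idot c g) by rewrite ltrDl.
  apply; split; first by rewrite idotDr ag add0r.
  by move=> j; rewrite mxE addrC.
- by rewrite idotBr yb vb subrr.
- by rewrite subr_eq0.
- by move=> j; rewrite !mxE addrCA subrr addr0.
Qed.

(** The unit vectors among the generators make every feasible point nonnegative, so the orthant is a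
    valid first cone. *)
Lemma simplex_inv_init (S n : nat) (G : 'cV[int]_n -> Prop) :
  (forall j, G (delta_mx j 0)) -> simplex_inv S G 1%:M 0.
Proof.
move=> Gd; exists 1; split => //.
- move=> r; rewrite (bigD1 r) //= mxE eqxx big1 ?addr0 // => j /negPf jr.
  by rewrite mxE eq_sym jr.
- by rewrite det1.
- move=> w fw; exists w; split.
    move=> i; have := fw _ (Gd i); rewrite (bigD1 i) //= mxE !eqxx mulr1.
    rewrite big1 ?addr0 // => j /negPf ji; by rewrite mxE ji mulr0.
  move=> j; rewrite (bigD1 j) //= mxE eqxx mulr1 big1 ?addr0 // => i /negPf ij.
  by rewrite mxE ij mulr0.
by rewrite det1 expr0 mulr1 expr1n.
Qed.

(** Truncation bounds the right-hand side by S * S^2, so the quotient in a candidate is at most S^3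
    + 4 S Dl^2 <= 5 S^3, independently of [b]; the constant 10 leaves room for subtracting [v]. *)
Lemma gens_bound (n Dl : nat) (a v : 'cV[int]_n) (g : 'cV[int]_n) (j : 'I_n) :
  (0 < n)%N -> (0 < Dl)%N -> (forall j, `|a j 0| <= Dl%:Z) ->
  (forall j, 0 <= v j 0 <= ((n * Dl) ^ 2)%:Z) ->
  g \in gens (4 * Dl ^ 2) a (idot a v) v -> `|g j 0| <= (10 * (n * Dl) ^ 3)%:Z.
Proof.
move=> n0 D0 aD vT.
set S := (n * Dl)%N; have S0 : (0 < S)%N by rewrite muln_gt0 n0.
have DS : (Dl <= S)%N by rewrite leq_pmull.
have e12 : (S <= S ^ 2)%N by rewrite -{1}[S]expn1 leq_pexp2l.
have e23 : (S ^ 2 <= S ^ 3)%N by rewrite leq_pexp2l.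
have D2 : (Dl ^ 2 <= S ^ 2)%N by rewrite leq_exp2r.
have dotB (x : 'cV[int]_n) (K : nat) : (forall j, 0 <= x j 0 <= K%:Z) -> `|idot a x| <= (S * K)%:Z.
  move=> xK; apply: le_trans (ler_norm_sum _ _ _) _.
  apply: le_trans (_ : \sum_(i < n) (Dl * K)%:Z <= _).
    apply: ler_sum => i _; rewrite normrM PoszM; have /andP[h1 h2] := xK i.
    by apply: ler_pM => //; rewrite ger0_norm.
  by rewrite sumr_const card_ord -mulr_natl natz -PoszM mulnA.
have N0 : (0 < 4 * Dl ^ 2)%N by rewrite muln_gt0 expn_gt0 D0.
move=> /gensP[[i ->]|[i [w [/(boxesP _ N0 (leqnn n))[w0 wN _] ok _ ->]]]].
  rewrite mxE; case: (_ && _); rewrite ?normr0 ?normr1 //= lez_nat.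
  by rewrite muln_gt0 expn_gt0 S0.
have wj k : 0 <= w k 0 <= (4 * Dl ^ 2)%:Z.
  rewrite w0 -(gez0_abs (w0 k)) lez_nat /=; apply: leq_trans wN.
  rewrite /weight (bigD1 k) //=; apply: leq_trans (leqnSn _) _.
  by apply: leq_pmulr; apply: prodn_gt0.
have /andP[vj0 vj] := vT j.
have cj : 0 <= candv a (idot a v) i w j 0 <= (5 * S ^ 3)%:Z; last first.
  have -> : (candv a (idot a v) i w - v) j 0 = candv a (idot a v) i w j 0 - v j 0.
    by rewrite !mxE.
  move: (candv _ _ _ _ j 0) cj (v j 0) vj0 vj e23 => x.
  by move: (S ^ 2)%N (S ^ 3)%N => s2 s3; lia.
rewrite mxE; case: eqP => _; last first.
  have /andP[-> h] := wj j; apply: le_trans h _; rewrite lez_nat.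
  apply: leq_trans (_ : 4 * S ^ 3 <= _)%N; last by rewrite leq_mul2r orbT.
  by rewrite leq_mul2l /= (leq_trans D2).
case/and3P: ok => /eqP wi /eqP r0 q0; rewrite q0 /=.
have [ai|ai] := eqVneq (a i 0) 0; first by rewrite ai divz0.
apply: le_trans (_ : `|divz (idot a v - idot a w) (a i 0) * a i 0| <= _).
  rewrite normrM (ger0_norm q0); apply: ler_peMr => //.
  by move: ai; rewrite -normr_gt0; lia.
have := divz_eq (idot a v - idot a w) (a i 0); rewrite r0 addr0 => <-.
apply: le_trans (ler_normB _ _) _.
have h1 := dotB v _ vT; have h2 := dotB w _ wj.
apply: le_trans (lerD h1 h2) _; rewrite -PoszD lez_nat -expnS.
have : (S * (4 * Dl ^ 2) <= 4 * S ^ 3)%N.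
  by rewrite mulnCA leq_mul2l /= [(S ^ 3)%N]expnS leq_mul2l D2 orbT.
by move: (S ^ 3)%N (S * (4 * Dl ^ 2))%N => s3 x; lia.
Qed.

Lemma gens_certificate (n Dl : nat) (a v : 'cV[int]_n) (b : int) :
  (0 < n)%N -> (0 < Dl)%N -> (forall j, `|a j 0| <= Dl%:Z) -> sol a b v -> ~ averaged a b v ->
  let S := (n * Dl)%N in let v' := truncate (S ^ 2)%:Z v in
  exists c : 'I_n -> int,
    (forall g, g \in gens (4 * Dl ^ 2) a (idot a v') v' -> 1 <= \sum_j c j * g j 0) /\
    forall j, 0 <= c j <= (n * (n * (10 * S ^ 3)) ^ n.-1)%:Z.
Proof.
move=> n0 D0 aD sv nav S v'.
have N0 : (0 < 4 * Dl ^ 2)%N by rewrite muln_gt0 expn_gt0 D0.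
have [vb v0] := sv.
have sv' : sol a (idot a v') v' by apply: truncate_sol.
have nav' := not_averaged_truncate (T := (S ^ 2)%:Z) sv nav.
have vT j : 0 <= v' j 0 <= (S ^ 2)%:Z.
  by case: sv' => _ -> /=; rewrite mxE ge_min lexx orbT.
set gs := gens _ _ _ _.
have gB g : g \in gs -> forall j, `|g j 0| <= (10 * S ^ 3)%:Z.
  by move=> hg j; apply: gens_bound hg.
have deltas j : delta_mx j 0 \in gs by apply/gensP; left; exists j.
have [|c [c1 c2]] := bounded_certificate sv' nav' deltas _ gB.
  move=> g /gensP[[j ->]|[i [w [wb ok cv ->]]]]; first by left; exists j.
  right; exists (candv a (idot a v') i w); split => //; apply: candv_sol => //.
  by move: wb => /(boxesP _ N0 (leqnn n))[].
exists c; split => // j.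
have c0 : 0 <= c j.
  have := c1 _ (deltas j); rewrite (bigD1 j) //= mxE !eqxx mulr1 big1 ?addr0; first lia.
  by move=> k /negPf kj; rewrite mxE kj mulr0.
by rewrite c0 /=; apply: le_trans (ler_norm _) (c2 j).
Qed.

Lemma potential_contradiction (n Dl : nat) (a v : 'cV[int]_n) (b : int) (U : 'M[int]_n) (t : nat) :
  (0 < n)%N -> (0 < Dl)%N -> (forall j, `|a j 0| <= Dl%:Z) -> sol a b v -> ~ averaged a b v ->
  let S := (n * Dl)%N in let v' := truncate (S ^ 2)%:Z v in
  (2200 * S ^ 8 <= t)%N ->
  simplex_inv S (fun g => g \in gens (4 * Dl ^ 2) a (idot a v') v') U t -> False.
Proof.
move=> n0 D0 aD sv nav S v' ht inv.
have S0 : (0 < S)%N by rewrite muln_gt0 n0.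
have nS : (n <= S)%N by rewrite leq_pmulr.
have [vb v0] := sv.
have vT j : 0 <= v' j 0 <= (S ^ 2)%:Z by rewrite mxE le_min v0 ge_min lexx orbT.
have gB g : g \in gens (4 * Dl ^ 2) a (idot a v') v' -> forall j, `|g j 0| <= (10 * S ^ 3)%:Z.
  by move=> hg j; apply: gens_bound hg.
have [c [c1 c2]] := gens_certificate n0 D0 aD sv nav.
have c0 j : 0 <= c j by have /andP[] := c2 j.
have := @simplex_inv_bounded S n t _ U (10 * S ^ 3)%:Z c isT c0 gB c1 inv.
apply/negP; rewrite -ltNge.
set B := (10 * S ^ 3)%N; set X := (n * B)%N.
have B0 : (0 < B)%N by rewrite muln_gt0 expn_gt0 S0.
have X0 : (0 < X)%N by rewrite muln_gt0 n0.
(* The certificate bound gives 1 + n X^n <= 2 X^(n + 1), and the crude X <= 2^X turns this into a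
   power of two whose exponent is polynomial in [S]. *)
have sumc : 1 + B%:Z * \sum_j c j <= (2 ^ (1 + X * n.+1))%:Z.
  have : \sum_j c j <= (n * (n * X ^ n.-1))%:Z.
    rewrite -[n in (n * _)%N]card_ord -natz natrM mulr_natl -sumr_const.
    by apply: ler_sum => j _; rewrite natz; have /andP[] := c2 j.
  move=> /(ler_wpM2l (isT : 0 <= B%:Z)) h.
  apply: le_trans (lerD (lexx 1) h) _; rewrite -PoszM -PoszD lez_nat.
  have -> : (B * (n * (n * X ^ n.-1)) = n * X ^ n)%N.
    have -> : (X ^ n = X * X ^ n.-1)%N by rewrite -expnS prednK.
    by move: (X ^ n.-1)%N => Z; rewrite /X; ring.
  apply: leq_trans (_ : 2 * X ^ n.+1 <= _)%N.
    have : (0 < X ^ n.+1)%N by rewrite expn_gt0 X0.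
    have : (n * X ^ n <= X ^ n.+1)%N by rewrite [(X ^ n.+1)%N]expnS leq_mul2r leq_pmulr ?orbT.
    by move: (X ^ n.+1)%N (n * X ^ n)%N => x y; lia.
  rewrite expnD expn1 leq_mul2l /= expnM leq_exp2r //.
  by apply/ltnW/ltn_expl.
have e2 : 0 <= 1 + B%:Z * \sum_j c j.
  by rewrite addr_ge0 // mulr_ge0 // sumr_ge0.
(* Origin of 2200: X <= 10 S^4 gives e + 1 <= 22 S^6, and each doubling takes 100 S^2 cuts. *)
apply: (rate_pow (e := ((1 + X * n.+1) * n)%N)) => //.
  apply: leq_trans ht.
  have hX : (X <= 10 * S ^ 4)%N.
    by rewrite /X /B mulnCA leq_mul2l /= [(S ^ 4)%N]expnS leq_mul.
  have h1 : (((1 + X * n.+1) * n).+1 <= 22 * S ^ 6)%N.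
    have h2 : (X * n.+1 <= 10 * S ^ 4 * (2 * S))%N by apply: leq_mul => //; lia.
    have h3 : ((1 + X * n.+1) * n <= (1 + 10 * S ^ 4 * (2 * S)) * S)%N by apply: leq_mul => //; rewrite leq_add2l.
    have e6 : ((1 + 10 * S ^ 4 * (2 * S)) * S = S + 20 * S ^ 6)%N by rewrite !expnS expn0; ring.
    have s6 : (S <= S ^ 6)%N by rewrite -{1}[S]expn1 leq_pexp2l.
    by rewrite e6 in h3; move: s6 h3; move: (S ^ 6)%N ((1 + X * n.+1) * n)%N => x y; lia.
  have -> : (2200 * S ^ 8 = 100 * S ^ 2 * (22 * S ^ 6))%N by rewrite !expnS expn0; ring.
  by rewrite leq_mul2l h1 orbT.
rewrite exprM; apply: lerXn2r; rewrite ?nnegrE ?ler0z ?exprn_ge0 //.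
apply: le_trans (_ : (2 ^ (1 + X * n.+1))%:Z%:~R <= _); first by rewrite ler_int.
by rewrite -pmulrn natrX.
Qed.

Lemma simplex_inv_cut (n Dl t : nat) (a v g : 'cV[int]_n) (b : int) (U : 'M[int]_n) (k : 'I_n) :
  (0 < n)%N -> (0 < Dl)%N -> (forall j, `|a j 0| <= Dl%:Z) -> sol a b v -> ~ averaged a b v ->
  let S := (n * Dl)%N in let v' := truncate (S ^ 2)%:Z v in
  let G g := g \in gens (4 * Dl ^ 2) a (idot a v') v' in
  G g -> \sum_r (U *m g) r 0 <= 0 -> (forall i, (U *m g) i 0 <= (U *m g) k 0) ->
  simplex_inv S G U t -> simplex_inv S G (cut_upd S k (U *m g) U) t.+1.
Proof.
move=> n0 D0 aD sv nav S v' G Gg h0 hk inv.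
have [c [c1 _]] := gens_certificate n0 D0 aD sv nav.
apply: (@simplex_inv_upd S n t G U g _ k (fun j => (c j)%:~R)) => //.
- by rewrite leq_pmulr.
- move=> f Gf; have := lt_le_trans (ltr01 : 0 < 1 :> int) (c1 f Gf); rewrite -(ltr0z rat).
  by rewrite rmorph_sum /=; congr (_ < _); apply: eq_bigr => j _; rewrite intrM.
- by move=> i; rewrite mxE.
Qed.

Lemma rate_pow_mono (R : realFieldType) (S t : nat) :
  (1 + (100 * S%:R ^+ 2)^-1) ^+ t <= (1 + (100 * S%:R ^+ 2)^-1) ^+ t.+1 :> R.
Proof.
by apply: ler_weXn2l => //; rewrite lerDl invr_ge0 mulr_ge0 // sqr_ge0.
Qed.

(** Allows a round with several cuts to be counted as one. *)
Lemma simplex_inv_weaken (S n t : nat) (G : 'cV[int]_n -> Prop) (U : 'M[int]_n) :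
  simplex_inv S G U t.+1 -> simplex_inv S G U t.
Proof.
move=> [Q [Q0 rows det0 cone pot]]; exists Q; split => //; apply: le_trans pot.
apply: ler_wpM2l; first by rewrite ler0z ltW.
exact: rate_pow_mono.
Qed.

(** * Vertices of the integer hull *)

Lemma hull_point_int (R : realType) (n : nat) (a : 'cV[int]_n) (b : int) (u : 'cV[int]_n) :
  sol a b u -> (knapsack a b `&` @int_points R n)%classic (map_mx intr u).
Proof.
move=> [ub u0]; split; first split.
- rewrite -ub rmorph_sum; apply: eq_bigr => i _.
  by rewrite mxE rmorphM.
- by move=> i; rewrite mxE ler0z.
by move=> i; rewrite mxE intr_int.
Qed.

Lemma hull_point_lift (R : realType) (n : nat) (a : 'cV[int]_n) (b : int) (x : 'cV[R]_n) :
  (knapsack a b `&` @int_points R n)%classic x -> exists2 u, sol a b u & x = map_mx intr u.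
Proof.
move=> [[xb x0] xi]; pose u : 'cV[int]_n := \col_i Num.floor (x i 0).
have xu : x = map_mx intr u.
  by apply/colP => i; rewrite !mxE; apply/esym/eqP; rewrite -intrEfloor; apply: xi.
exists u => //; split; last by move=> i; rewrite mxE floor_ge0.
apply: (@intr_inj R); rewrite -xb rmorph_sum; apply: eq_bigr => i _.
by rewrite rmorphM /= xu [in RHS]mxE.
Qed.

Lemma sub_conv (R : realType) (V : lmodType R) (S : set V) (x : V) : S x -> conv S x.
Proof.
move=> Sx; exists 1%N, (fun _ => 1), (fun _ => x); split => //; first by rewrite big_ord1.
by rewrite big_ord1 scale1r.
Qed.

Lemma averaged_not_vertex (R : realType) (n : nat) (a : 'cV[int]_n) (b : int) (u : 'cV[int]_n) :
  averaged a b u -> conv (@int_hull R n a b `\ map_mx intr u)%classic (map_mx intr u).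
Proof.
move=> [m [y [k [hy [i0 hi0] hs]]]].
pose K := (\sum_i k i)%N.
have K0 : (0 < K)%N by rewrite /K (bigD1 i0) //= ltn_addr.
have Kr : (K%:R : R) != 0 by rewrite pnatr_eq0 -lt0n.
exists m, (fun i => (k i)%:R / K%:R), (fun i => map_mx intr (y i)); split.
- by move=> i; rewrite divr_ge0.
- by rewrite -mulr_suml -natr_sum mulfV.
- move=> i; have [sy yu] := hy i; split; first exact/sub_conv/hull_point_int.
  move=> /= /colP e; case/eqP: yu; apply/colP => j; apply: (@intr_inj R).
  by have := e j; rewrite !mxE.
apply: (@scalerI _ _ K%:R) => //; rewrite scaler_sumr.
under eq_bigr do rewrite scalerA mulrCA mulfV // mulr1.
apply/colP => j; rewrite mxE summxE.
have /colP/(_ j)/(congr1 (fun z : int => z%:~R : R)) := hs.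
rewrite summxE rmorph_sum mxE rmorph0 /= => e.
apply/eqP; rewrite eq_sym -subr_eq0 -[X in _ == X]e mxE /K natr_sum mulr_suml -sumrB.
apply/eqP/eq_bigr => i _; rewrite !mxE mulmxnE rmorphMn /= !mxE rmorphB /=.
by rewrite -[in RHS]mulr_natl mulrBr.
Qed.

(** When a vertex is written as a convex combination of integer solutions, one of those with
    positive weight must be the vertex itself; otherwise it would lie in the convex hull of the
    other points. *)
Lemma vertex_integral (R : realType) (n : nat) (a : 'cV[int]_n) (b : int) (v : 'cV[R]_n) :
  is_vertex (@int_hull R n a b) v ->
  exists u, [/\ v = map_mx intr u, sol a b u & ~ averaged a b u].
Proof.
move=> [[m [w [y [w0 w1 hy vE]]]] nv].
have [i0 wi0] : exists i, 0 < w i.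
  apply: contrapT => /forallNP h; have := w1; rewrite big1 => [/esym/eqP|i _].
    by rewrite oner_eq0.
  by apply/eqP; rewrite eq_le w0 andbT leNgt; apply/negP/h.
have [i [wi yi]] : exists i, 0 < w i /\ y i = v.
  apply: contrapT => /forallNP h; apply: nv.
  (* Points of weight 0 may equal [v]; they are replaced by [y i0]. *)
  exists m, w, (fun i => if 0 < w i then y i else y i0); split => //.
    move=> i; case: ifP => wi; split; try exact/sub_conv.
      by move=> /= e; apply: (h i).
    by move=> /= e; apply: (h i0).
  rewrite [LHS]vE; apply: eq_bigr => i _; case: ifP => // /negP/negP.
  rewrite -leNgt => wi; have -> : w i = 0 by apply/eqP; rewrite eq_le wi w0.
  by rewrite !scale0r.
have [u su yu] := hull_point_lift (hy i).
exists u; split => //; first by rewrite -yi.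
by move=> /(@averaged_not_vertex R); rewrite -yu yi.
Qed.

(** Strict minimality is lifted twice: from the integer solutions to all points of the hull other
    than [u], and from there to their convex combinations. *)
Lemma certified_vertex (R : realType) (n : nat) (a : 'cV[int]_n) (b : int) (u : 'cV[int]_n) :
  sol a b u -> certified a b u -> is_vertex (@int_hull R n a b) (map_mx intr u).
Proof.
move=> su [c hc]; split; first exact/sub_conv/hull_point_int.
pose C (x : 'cV[R]_n) := \sum_j (c j 0)%:~R * x j 0.
have Csum m (w : 'I_m -> R) (y : 'I_m -> 'cV[R]_n) : C (\sum_i w i *: y i) = \sum_i w i * C (y i).
  rewrite /C; under eq_bigr do rewrite summxE mulr_sumr.
  rewrite exchange_big; apply: eq_bigr => i _; rewrite mulr_sumr.
  by apply: eq_bigr => j _; rewrite mxE mulrCA.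
have gap m (w : 'I_m -> R) (y : 'I_m -> 'cV[R]_n) (p : R) :
    (forall i, 0 <= w i) -> \sum_i w i = 1 ->
    (forall i, p <= C (y i)) -> p <= C (\sum_i w i *: y i).
  move=> w0 w1 hp; rewrite Csum -[p]mul1r -w1 mulr_suml.
  by apply: ler_sum => i _; apply: ler_wpM2l.
have gap' m (w : 'I_m -> R) (y : 'I_m -> 'cV[R]_n) (p : R) i0 :
    (forall i, 0 <= w i) -> \sum_i w i = 1 ->
    (forall i, p <= C (y i)) -> 0 < w i0 -> p < C (y i0) -> p < C (\sum_i w i *: y i).
  move=> w0 w1 hp wi0 hi0; rewrite Csum -[p]mul1r -w1 mulr_suml.
  rewrite (bigD1 i0) //= [X in _ < X](bigD1 i0) //=; apply: ltr_leD.
    by rewrite ltr_pM2l.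
  by apply: ler_sum => i _; apply: ler_wpM2l.
have CE (y : 'cV[int]_n) : C (map_mx intr y) = (idot c y)%:~R.
  by rewrite rmorph_sum; apply: eq_bigr => j _; rewrite mxE rmorphM.
have Xge x : (knapsack a b `&` @int_points R n)%classic x -> C (map_mx intr u) <= C x.
  move=> /hull_point_lift[y sy ->]; rewrite !CE ler_int.
  by have [->|yu] := eqVneq y u; [|apply/ltW/hc].
have Xgt x : (knapsack a b `&` @int_points R n)%classic x -> x <> map_mx intr u ->
    C (map_mx intr u) < C x.
  move=> /hull_point_lift[y sy ->] yu; rewrite !CE ltr_int; apply: hc => //.
  by apply/eqP => e; apply: yu; rewrite e.
have pos m (w : 'I_m -> R) : (forall i, 0 <= w i) -> \sum_i w i = 1 -> exists i, 0 < w i.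
  move=> w0 w1; apply: contrapT => /forallNP h; have := w1; rewrite big1 => [/esym/eqP|i _].
    by rewrite oner_eq0.
  by apply/eqP; rewrite eq_le w0 andbT leNgt; apply/negP/h.
have Pgt p : @int_hull R n a b p -> p <> map_mx intr u -> C (map_mx intr u) < C p.
  move=> [m [w [y [w0 w1 hy ->]]]] pu.
  have [i [wi yi]] : exists i, 0 < w i /\ y i <> map_mx intr u.
    apply: contrapT => /forallNP h; apply: pu.
    rewrite (eq_bigr (fun i => w i *: map_mx intr u)); first by rewrite -scaler_suml w1 scale1r.
    move=> i _; have [wi|wi] := ltrP 0 (w i); last first.
      by have -> : w i = 0 by [apply/eqP; rewrite eq_le wi w0]; rewrite !scale0r.
    by congr (_ *: _); apply: contrapT => yi; apply: (h i).
  by apply: (gap' _ _ _ _ i) => // [j|]; [apply: Xge|apply: Xgt].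
move=> [m [w [y [w0 w1 hy uE]]]].
have [i wi] := pos _ _ w0 w1.
have : C (map_mx intr u) < C (\sum_i w i *: y i).
  have yP j : C (map_mx intr u) < C (y j) by have [h1 h2] := hy j; apply: Pgt.
  by apply: (gap' _ _ _ _ i) => // j; apply: ltW.
by rewrite -uE ltxx.
Qed.

(** * A program logic with running times *)

(* Bounding the time of [c] by [P ^ lev c], where [P] bounds the number of
   iterations of every loop, reduces all running time estimates to iteration
   counts: [lev c] is a constant of the program. *)
Fixpoint lev (c : cmd) : nat :=
  match c with
  | Skip => 1
  | Put _ e1 e2 => (cost e1 + cost e2).+1
  | Emit e => (cost e).+1
  | Seq c1 c2 => (maxn (lev c1) (lev c2)).+1
  | IfLe e1 e2 c1 c2 => (cost e1 + cost e2 + maxn (lev c1) (lev c2)).+2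
  | WhileLe e1 e2 c => cost e1 + cost e2 + lev c + 4
  end%N.

(** Changes are tracked per array and not per cell: array names are static, so disjointness is
    settled by computation. *)
Fixpoint mods (c : cmd) : seq nat :=
  match c with
  | Put k _ _ => [:: k]
  | Seq c1 c2 | IfLe _ _ c1 c2 => mods c1 ++ mods c2
  | WhileLe _ _ c => mods c
  | _ => [::]
  end.

Fixpoint reads (e : expr) : seq nat :=
  match e with
  | Cst _ => [::]
  | Get k e => k :: reads e
  | Plus e1 e2 | Minus e1 e2 | Quo e1 e2 | Rem e1 e2 => reads e1 ++ reads e2
  end.

Definition runs (P : nat) (c : cmd) (m : memory) (o : seq int)
    (Q : memory -> seq int -> Prop) : Prop :=
  exists t m' o', [/\ exec c (State m o) t (State m' o'), (t <= P ^ lev c)%N & Q m' o'].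

Lemma eval_frame (m m' : memory) (e : expr) :
  (forall k, k \in reads e -> m' k = m k) -> eval m' e = eval m e.
Proof.
elim: e => //= [k e IH h|e1 h1 e2 h2 h|e1 h1 e2 h2 h|e1 h1 e2 h2 h|e1 h1 e2 h2 h].
  by rewrite IH ?h ?inE ?eqxx // => i hi; apply: h; rewrite inE hi orbT.
all: by rewrite h1 ?h2 // => k hk; apply: h; rewrite mem_cat hk ?orbT.
Qed.

Lemma exec_frame c s t s' : exec c s t s' ->
  forall k, k \notin mods c -> store s' k = store s k.
Proof.
elim=> //= {c s t s'}.
- by move=> k e1 e2 s k' /=; rewrite inE /update => /negPf kk'; apply/funext => i; rewrite kk'.
- move=> c1 c2 s t1 s1 t2 s2 _ h1 _ h2 k; rewrite mem_cat negb_or => /andP[k1 k2].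
  by rewrite h2 // h1.
- by move=> e1 e2 c1 c2 s t s' _ _ h k; rewrite mem_cat negb_or => /andP[k1 k2]; apply: h.
- by move=> e1 e2 c1 c2 s t s' _ _ h k; rewrite mem_cat negb_or => /andP[k1 k2]; apply: h.
- by move=> e1 e2 c s t1 s1 t2 s2 _ _ h1 _ h2 k hk; rewrite h2 // h1.
Qed.

Lemma runs_conseq P c m o (Q Q' : memory -> seq int -> Prop) :
  runs P c m o Q -> (forall m' o', Q m' o' -> Q' m' o') -> runs P c m o Q'.
Proof. by move=> [t [m' [o' [h1 h2 h3]]]] h; exists t, m', o'; split => //; apply: h. Qed.

Lemma runs_frame P c m o Q : runs P c m o Q ->
  runs P c m o (fun m' o' => (forall k, k \notin mods c -> m' k = m k) /\ Q m' o').
Proof.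
move=> [t [m' [o' [h1 h2 h3]]]]; exists t, m', o'; split => //; split => // k hk.
exact: (exec_frame h1).
Qed.

Lemma runs_frame_conseq P c m o (Q Q' : memory -> seq int -> Prop) :
  runs P c m o Q ->
  (forall m' o', (forall k, k \notin mods c -> m' k = m k) -> Q m' o' -> Q' m' o') ->
  runs P c m o Q'.
Proof. by move=> /runs_frame h1 h2; apply: (runs_conseq h1) => m' o' []; apply: h2. Qed.

Lemma leq_pow_self (P x : nat) : (1 < P)%N -> (x <= P ^ x)%N.
Proof. by move=> P1; apply/ltnW/ltn_expl. Qed.

Lemma runs_skip P m o (Q : memory -> seq int -> Prop) :
  (1 < P)%N -> Q m o -> runs P Skip m o Q.
Proof.
move=> P1 h; exists 1%N, m, o; split => //; first exact: exec_skip.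
by rewrite /= expn1 ltnW.
Qed.

Lemma runs_put P k e1 e2 m o (Q : memory -> seq int -> Prop) : (1 < P)%N ->
  Q (update m k (eval m e1) (eval m e2)) o -> runs P (Put k e1 e2) m o Q.
Proof.
move=> P1 h; do 3 eexists; split; first exact: exec_put; last exact: h.
exact: leq_pow_self.
Qed.

Lemma runs_emit P e m o (Q : memory -> seq int -> Prop) : (1 < P)%N ->
  Q m (rcons o (eval m e)) -> runs P (Emit e) m o Q.
Proof.
move=> P1 h; do 3 eexists; split; first exact: exec_emit; last exact: h.
exact: leq_pow_self.
Qed.

Lemma runs_seq P c1 c2 m o Q : (1 < P)%N ->
  runs P c1 m o (fun m' o' => runs P c2 m' o' Q) -> runs P (Seq c1 c2) m o Q.
Proof.
move=> P1 [t1 [m1 [o1 [h1 b1 [t2 [m2 [o2 [h2 b2 h3]]]]]]]].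
exists (t1 + t2)%N, m2, o2; split => //; first exact: exec_seq h1 h2.
have P0 := ltnW P1.
apply: leq_trans (leq_add b1 b2) _; rewrite /= expnS.
apply: leq_trans (_ : 2 * P ^ maxn (lev c1) (lev c2) <= _)%N; last by rewrite leq_mul2r P1 orbT.
by rewrite mul2n -addnn leq_add // leq_pexp2l // ?leq_maxl ?leq_maxr.
Qed.

Lemma runs_if P e1 e2 c1 c2 m o Q : (1 < P)%N ->
  (eval m e1 <= eval m e2 -> runs P c1 m o Q) ->
  (eval m e2 < eval m e1 -> runs P c2 m o Q) -> runs P (IfLe e1 e2 c1 c2) m o Q.
Proof.
move=> P1 h1 h2; have P0 := ltnW P1.
have bnd t c : (lev c <= maxn (lev c1) (lev c2))%N -> (t <= P ^ lev c)%N ->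
    ((cost e1 + cost e2 + t).+1 <= P ^ lev (IfLe e1 e2 c1 c2))%N.
  move=> lc ht; set ce := (cost e1 + cost e2)%N; set M := maxn (lev c1) (lev c2) in lc.
  have -> : lev (IfLe e1 e2 c1 c2) = (1 + (ce.+1 + M))%N by rewrite /= -/ce -/M; lia.
  have htM : (t <= P ^ M)%N by apply: leq_trans ht _; apply: leq_pexp2l.
  have hce : (ce.+1 <= P ^ ce.+1)%N by apply: leq_pow_self.
  have A0 : (0 < P ^ ce.+1)%N by rewrite expn_gt0 P0.
  have B0 : (0 < P ^ M)%N by rewrite expn_gt0 P0.
  rewrite expnD expn1 expnD; move: (P ^ ce.+1)%N (P ^ M)%N hce htM A0 B0 => A B hA hB A0 B0.
  have h : (A + B <= 2 * (A * B))%N by nia.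
  by apply: leq_trans (_ : 2 * (A * B) <= _)%N; [lia|rewrite leq_mul2r P1 orbT].
have [le|lt] := lerP (eval m e1) (eval m e2).
  have [t [m' [o' [x b q]]]] := h1 le; exists (cost e1 + cost e2 + t).+1, m', o'.
  by split => //; [exact: exec_if_true|apply: (bnd _ c1); rewrite ?leq_maxl].
have [t [m' [o' [x b q]]]] := h2 lt; exists (cost e1 + cost e2 + t).+1, m', o'.
by split => //; [exact: exec_if_false|apply: (bnd _ c2); rewrite ?leq_maxr].
Qed.

(** The number [K] of iterations is fixed in advance. With A and B the bounds for one test and one
    pass, the time is at most P (A + B) + A <= 3 P A B <= P^3 A B. This explains the 4 in [lev]:
    three for these factors and one for the successor in the cost of a test. *)
Lemma runs_while P e1 e2 c m o (K : nat) (I : nat -> memory -> seq int -> Prop) Q :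
  (1 < P)%N -> (K <= P)%N -> I 0%N m o ->
  (forall i m o, (i < K)%N -> I i m o -> eval m e1 <= eval m e2 /\ runs P c m o (I i.+1)) ->
  (forall m o, I K m o -> eval m e2 < eval m e1 /\ Q m o) ->
  runs P (WhileLe e1 e2 c) m o Q.
Proof.
move=> P1 KP I0 step fin; have P0 := ltnW P1.
pose ce := (cost e1 + cost e2).+1.
suff H : forall j i m o, (i + j = K)%N -> I i m o -> exists t m' o',
    [/\ exec (WhileLe e1 e2 c) (State m o) t (State m' o'),
        (t <= j * (ce + P ^ lev c) + ce)%N & Q m' o'].
  have [t [m' [o' [x b q]]]] := H K 0%N m o erefl I0.
  exists t, m', o'; split => //; apply: leq_trans b _.
  have ceP : (ce <= P ^ ce)%N by apply: leq_pow_self.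
  have c0 : (0 < P ^ ce)%N by rewrite expn_gt0 P0.
  have l0 : (0 < P ^ lev c)%N by rewrite expn_gt0 P0.
  have -> : (lev (WhileLe e1 e2 c) = 3 + (ce + lev c))%N by rewrite /= /ce; lia.
  rewrite expnD expnD; set A := (P ^ ce)%N in ceP c0 *; set B := (P ^ lev c)%N in l0 *.
  apply: leq_trans (_ : P * (A + B) + A <= _)%N.
    by rewrite leq_add // leq_mul // leq_add2r.
  have h1 : (A + B <= 2 * (A * B))%N by nia.
  have h2 : (P * (A + B) + A <= P * (2 * (A * B)) + P * (A * B))%N.
    by apply: leq_add; [rewrite leq_mul2l h1 orbT|nia].
  apply: leq_trans h2 _; have -> : (P * (2 * (A * B)) + P * (A * B) = 3 * P * (A * B))%N by ring.
  rewrite leq_mul2r !expnS expn0 muln1; apply/orP; right; nia.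
elim=> [|j IH] i m1 o1 ij hI.
  have [|lt q] := fin m1 o1; first by rewrite -ij addn0.
  by exists ce, m1, o1; split => //; exact: exec_while_false.
have iK : (i < K)%N by rewrite -ij -addSnnS leq_addr.
have [le [t1 [m2 [o2 [x1 b1 q1]]]]] := step i m1 o1 iK hI.
have [|t2 [m3 [o3 [x2 b2 q2]]]] := IH i.+1 m2 o2 _ q1; first by rewrite addSnnS.
exists (cost e1 + cost e2 + t1 + t2).+1, m3, o3; split => //.
  by apply: (exec_while_true (s1 := State m2 o2)) x1 x2.
by move: b1 b2; rewrite /ce mulSn; lia.
Qed.

Arguments update : simpl never.

Lemma updE m k i x k' i' :
  update m k i x k' i' = if (k' == k) && (i' == i) then x else m k' i'.
Proof. by []. Qed.

Lemma update_other m k i x k' : k' != k -> update m k i x k' = m k'.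
Proof. by move=> /negPf h; apply/funext => j; rewrite /update h. Qed.

Lemma notin_neq (L : seq nat) (k k' : nat) : k' \notin L -> k \in L -> k' != k.
Proof. by move=> h1 h2; apply: contra h1 => /eqP ->. Qed.

Lemma notin_sub (L1 L2 : seq nat) (k : nat) :
  k \notin L2 -> all (mem L2) L1 -> k \notin L1.
Proof. by move=> h /allP h1; apply: contra h => /h1. Qed.

(* Decides the comparisons of numerals left by reading updated memory cells. *)
Ltac eval_update :=
  do 2 (rewrite /= ?updE;
  repeat match goal with
  | |- context [@eq_op ?T ?a ?b] =>
      let v := eval vm_compute in (@eq_op T a b) in
      match v with
      | true => change (@eq_op T a b) with true
      | false => change (@eq_op T a b) with false
      end
  end); rewrite /= ?eqxx /=.

Notation scalar k := (Get k (Cst 0)).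
Notation "k <~ e" := (Put k (Cst 0) e) (at level 70).
Notation "c1 ;; c2" := (Seq c1 c2) (at level 75, right associativity).

Definition For (k kb : nat) (body : cmd) : cmd :=
  k <~ Cst 0 ;;
  WhileLe (Plus (scalar k) (Cst 1)) (scalar kb) (body ;; k <~ Plus (scalar k) (Cst 1)).

Lemma runs_for P k kb body m0 o0 (N : nat) (I : nat -> memory -> seq int -> Prop) Q :
  (1 < P)%N -> (N <= P)%N -> k \notin mods body -> kb \notin k :: mods body ->
  m0 kb 0 = N%:Z ->
  (forall i m m' o, (forall k', k' != k -> m' k' = m k') -> I i m o -> I i m' o) ->
  I 0%N m0 o0 ->
  (forall i m o, (i < N)%N -> m k 0 = i%:Z ->
     (forall k', k' \notin k :: mods body -> m k' = m0 k') -> I i m o ->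
     runs P body m o (I i.+1)) ->
  (forall m o, (forall k', k' \notin k :: mods body -> m k' = m0 k') -> I N m o -> Q m o) ->
  runs P (For k kb body) m0 o0 Q.
Proof.
move=> P1 NP kb1 kb2 mN ins I0 step fin.
apply: (runs_seq P1); apply: runs_put => //=.
pose J i m o := [/\ m k 0 = i%:Z, forall k', k' \notin k :: mods body -> m k' = m0 k' & I i m o].
have upE m x k' : k' != k -> update m k 0 x k' = m k'.
  by move=> /negPf h; apply/funext => j; rewrite /update h.
apply: (@runs_while _ _ _ _ _ _ N J) => //.
- split; first by rewrite /update !eqxx.
    by move=> k'; rewrite inE negb_or => /andP[h _]; apply: upE.
  by apply: ins I0 => k'; apply: upE.
- move=> i m o iN [mk fr hI]; split.
    by rewrite /= mk fr // mN; lia.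
  apply: (runs_seq P1); apply: runs_frame_conseq (step i m o iN mk fr hI) _ => m' o' fr' hI'.
  apply: runs_put => //=; split.
  - by rewrite /update !eqxx /= fr' // mk -addn1 PoszD.
  - move=> k' hk; move: (hk); rewrite inE negb_or => /andP[h1 h2].
    by rewrite upE // fr' // fr.
  - by apply: ins hI' => k'; apply: upE.
- move=> m o [mk fr hI]; split; first by rewrite /= mk fr // mN; lia.
  exact: fin.
Qed.

(* Repeated addition: the time depends on [ey] only, while [ex] may have any size. *)
Definition Mul (ex ey : expr) : cmd :=
  10 <~ ey ;; 11 <~ ex ;; 12 <~ Cst 0 ;;
  WhileLe (Cst 1) (scalar 10) (12 <~ Plus (scalar 12) (scalar 11) ;; 10 <~ Minus (scalar 10) (Cst 1)) ;;
  WhileLe (scalar 10) (Cst (-1)) (12 <~ Minus (scalar 12) (scalar 11) ;; 10 <~ Plus (scalar 10) (Cst 1)).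

Lemma runs_mul P ex ey m o (Q : memory -> seq int -> Prop) : (1 < P)%N ->
  10%N \notin reads ex -> (absz (eval m ey) <= P)%N ->
  (forall m', (forall k, k \notin [:: 10; 11; 12]%N -> m' k = m k) ->
     m' 12%N 0 = eval m ex * eval m ey -> Q m' o) ->
  runs P (Mul ex ey) m o Q.
Proof.
move=> P1 hx yP fin.
set x := eval m ex; set y := eval m ey.
apply: (runs_seq P1); apply: runs_put => //.
apply: (runs_seq P1); apply: runs_put => //.
rewrite [eval _ ex](_ : _ = x); last first.
  apply: eval_frame => k hk; apply/funext => j; rewrite /update.
  by case: eqP => // e; rewrite -e hk in hx.
apply: (runs_seq P1); apply: runs_put => //.
apply: (runs_seq P1).
pose I (i : nat) (m' : memory) (o' : seq int) := [/\ m' 11%N 0 = x,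
  (forall k, k \notin [:: 10; 11; 12]%N -> m' k = m k), o' = o &
  m' 12%N 0 = x * (y - m' 10%N 0)].
have fr (m1 m2 : memory) k j z : k \in [:: 10; 11; 12]%N ->
   (forall k, k \notin [:: 10; 11; 12]%N -> m1 k = m2 k) ->
   forall k', k' \notin [:: 10; 11; 12]%N -> update m1 k j z k' = m2 k'.
  move=> hk h k' hk'; rewrite -h //; apply/funext => j'; rewrite /update.
  by case: eqP => // e; rewrite e hk in hk'.
(* At most one of the two loops does any work, depending on the sign of [y]. *)
apply: (@runs_while _ _ _ _ _ _ (if 0 <= y then absz y else 0)
  (fun i m' o' => I i m' o' /\ m' 10%N 0 = (if 0 <= y then (absz y)%:Z - i%:Z else y))) => //.
- by case: ifP.
- split; last by eval_update; rewrite -/y; case: ifP => // y0; rewrite subr0 gez0_abs.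
  split => //; last by eval_update; rewrite -/y subrr mulr0.
  by do 3 (apply: (fr) => //).
- move=> i m1 o1 hi [[h11 hf -> h12] h10]; case: ifP hi h10 => // y0 hi h10.
  split; first by rewrite /= h10; lia.
  apply: (runs_seq P1); apply: runs_put => //; apply: runs_put => //.
  split; last by eval_update; rewrite h10; lia.
  split => //; last by eval_update; rewrite h12 h11; ring.
  by do 2 (apply: (fr) => //).
- move=> m1 o1 [[h11 hf -> h12] h10]; split; first by move: h10; rewrite /=; case: (lerP 0 y); lia.
  apply: (@runs_while _ _ _ _ _ _ (if 0 <= y then 0 else absz y)
    (fun i m' o' => I i m' o' /\ m' 10%N 0 = (if 0 <= y then 0 else y + i%:Z))) => //.
  + by case: ifP.
  + by split => //; move: h10; case: (lerP 0 y) => y0 ->; lia.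
  + move=> i m2 o2 hi [[g11 gf -> g12] g10]; case: ifP hi g10 => // y0 hi g10.
    split; first by rewrite /= g10; lia.
    apply: (runs_seq P1); apply: runs_put => //; apply: runs_put => //.
    split; last by eval_update; rewrite g10; lia.
    split => //; last by eval_update; rewrite g12 g11; ring.
    by do 2 (apply: (fr) => //).
  + move=> m2 o2 [[g11 gf -> g12] g10]; split; first by move: g10; rewrite /=; case: (lerP 0 y); lia.
    apply: fin => //; rewrite g12; suff -> : m2 10%N 0 = 0 by rewrite subr0.
    by rewrite g10; case: (lerP 0 y); lia.
Qed.

(** The operands are not symmetric: the entries of [k2] are the short factors, so [k2] is always the
    array of [a] or of a generator, while [k1] may hold long integers. *)
Definition Dot (k1 : nat) (off : expr) (k2 : nat) : cmd :=
  14 <~ Cst 0 ;;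
  For 13 0 (Mul (Get k1 (Plus off (scalar 13))) (Get k2 (scalar 13)) ;;
            14 <~ Plus (scalar 14) (scalar 12)).

Lemma runs_dot P k1 off k2 m o n (Q : memory -> seq int -> Prop) : (1 < P)%N ->
  all (fun k => k \notin iota 10 5) [:: k1, k2 & reads off] -> m 0%N 0 = n%:Z -> (n <= P)%N ->
  (forall j, (j < n)%N -> (absz (m k2 j%:Z) <= P)%N) ->
  (forall m', (forall k, k \notin iota 10 5 -> m' k = m k) ->
     m' 14%N 0 = \sum_(j < n) m k1 (eval m off + (j : nat)%:Z) * m k2 (j : nat)%:Z -> Q m' o) ->
  runs P (Dot k1 off k2) m o Q.
Proof.
move=> P1 /= /and3P[hk1 hk2 /allP hoff] mn nP k2P fin.
apply: (runs_seq P1); apply: runs_put => //=.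
have fr0 (m1 m2 : memory) k j z : k \in iota 10 5 ->
   (forall k, k \notin iota 10 5 -> m1 k = m2 k) ->
   forall k', k' \notin iota 10 5 -> update m1 k j z k' = m2 k'.
  move=> hk h k' hk'; rewrite -h //; apply/funext => j'; rewrite /update.
  by case: eqP => // e; rewrite e hk in hk'.
pose I (i : nat) (m' : memory) (o' : seq int) := [/\ o' = o, (forall k, k \notin iota 10 5 -> m' k = m k) &
  m' 14%N 0 = \sum_(j < i) m k1 (eval m off + (j : nat)%:Z) * m k2 (j : nat)%:Z].
apply: (@runs_for _ _ _ _ _ _ n I) => //.
- move=> i m1 m2 o' h [h1 h2 h3]; split => // [k hk|]; last by rewrite h.
  by rewrite h ?h2 //; apply: contra hk => /eqP ->.
- by split => //; [apply: (fr0)|eval_update; rewrite big_ord0].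
- move=> i m1 o1 hi h13 fr [-> h2 h3].
  have e2 : m1 k2 i%:Z = m k2 i%:Z by rewrite h2.
  apply: (runs_seq P1); apply: runs_mul => //.
  + rewrite [reads _]/= in_cons mem_cat !negb_or; apply/and3P; split => //.
      by apply: contra hk1 => /eqP <-.
    by apply/negP => /hoff.
  + by rewrite /= h13 e2; apply: k2P.
  move=> m2 fr2 /= e12; apply: runs_put => //=.
  have fr3 k : k \notin iota 10 5 -> m2 k = m k.
    by move=> hk; rewrite fr2 ?h2 //; apply: contra hk; rewrite !inE => /or3P[] /eqP ->.
  split => //; first exact: (fr0).
  eval_update; rewrite e12 fr2 // h3 big_ord_recr /= h13 e2 (h2 _ hk1); congr (_ + _ * _).
  congr (m k1 (_ + _)); apply: eval_frame => k /hoff hk; exact: h2.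
- by move=> m1 o1 fr [-> h2 h3]; apply: fin.
Qed.

(** * The program *)

(* Array 30 stores the vectors of [boxes] one after the other, with the offset
   of the [p]-th vector in cell [p] of array 31 and its weight in cell [p] of
   array 32; array 33 holds their number and array 48 the next free offset. *)
Definition PushBox : cmd :=
  For 39 0 (Put 30 (Plus (scalar 48) (scalar 39))
                (Get 30 (Plus (Get 31 (scalar 35)) (scalar 39)))) ;;
  Put 30 (Plus (scalar 48) (scalar 34)) (scalar 38) ;;
  Put 31 (scalar 33) (scalar 48) ;;
  Put 32 (scalar 33) (scalar 37) ;;
  33 <~ Plus (scalar 33) (Cst 1) ;;
  48 <~ Plus (scalar 48) (scalar 0) ;;
  37 <~ Plus (scalar 37) (Get 32 (scalar 35)) ;;
  38 <~ Plus (scalar 38) (Cst 1).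

Definition GenBoxes : cmd :=
  Put 32 (Cst 0) (Cst 1) ;; 33 <~ Cst 1 ;; 48 <~ scalar 0 ;;
  For 34 0 (
    36 <~ scalar 33 ;;
    For 35 36 (
      37 <~ Plus (Get 32 (scalar 35)) (Get 32 (scalar 35)) ;; 38 <~ Cst 1 ;;
      WhileLe (scalar 37) (scalar 21) PushBox)).

Definition stores_boxes (n : nat) (ws : seq 'cV[int]_n) (m : memory) : Prop :=
  m 33%N 0 = (size ws)%:Z /\
  forall p, (p < size ws)%N ->
    [/\ m 31%N p%:Z = (p * n)%:Z, m 32%N p%:Z = (weight (nth 0 ws p))%:Z
      & forall j : 'I_n, m 30%N (p * n + j)%:Z = nth 0 ws p j 0].

Lemma stores_boxes_frame (n : nat) (ws : seq 'cV[int]_n) (m m' : memory) :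
  (forall k, k \in [:: 30; 31; 32; 33]%N -> m' k = m k) ->
  stores_boxes ws m -> stores_boxes ws m'.
Proof.
move=> fr [h1 h2]; split; first by rewrite fr.
by move=> p hp; have [g1 g2 g3] := h2 p hp; split => [||j]; rewrite fr.
Qed.

Lemma divn_muln_add_lt (p q n i j : nat) : (i < n)%N -> (j < n)%N ->
  ((p * n + i)%N == (q * n + j)%N) = (p == q) && (i == j).
Proof.
move=> hi hj; apply/eqP/andP => [e|[/eqP -> /eqP ->] //].
have n0 : (0 < n)%N by apply: leq_ltn_trans hi.
have := congr1 (divn^~ n) e; have := congr1 (modn^~ n) e.
by rewrite /= !modnMDl !modn_small // !divnMDl // !divn_small // !addn0 => -> ->.
Qed.

Lemma runs_push P n (ws : seq 'cV[int]_n) (m : memory) o (p k t c : nat) Q :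
  (1 < P)%N -> (n <= P)%N -> m 0%N 0 = n%:Z -> (k < n)%N -> (p < size ws)%N ->
  stores_boxes ws m -> m 48%N 0 = (size ws * n)%:Z ->
  m 34%N 0 = k%:Z -> m 35%N 0 = p%:Z -> m 38%N 0 = t%:Z -> m 37%N 0 = c%:Z ->
  c = weight (set_coord (nth 0 ws p) k t%:Z) ->
  (forall m', (forall k', k' \notin mods PushBox -> m' k' = m k') ->
     stores_boxes (rcons ws (set_coord (nth 0 ws p) k t%:Z)) m' ->
     m' 48%N 0 = (size (rcons ws (set_coord (nth 0 ws p) k t%:Z)) * n)%:Z ->
     m' 38%N 0 = t.+1%:Z -> m' 37%N 0 = (c + weight (nth 0 ws p))%:Z -> Q m' o) ->
  runs P PushBox m o Q.
Proof.
move=> P1 nP mn kn ps sb m48 m34 m35 m38 m37 cE fin.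
have [m33 sbp] := sb; have [m31 m32 m30] := sbp p ps.
apply: (runs_seq P1).
pose I (i : nat) (m' : memory) (o' : seq int) := [/\ o' = o,
  forall k', k' \notin [:: 30; 39]%N -> m' k' = m k',
  forall x : nat, (x < size ws * n)%N -> m' 30%N x%:Z = m 30%N x%:Z &
  forall j : 'I_n, (j < i)%N -> m' 30%N (size ws * n + j)%:Z = nth 0 ws p j 0].
have lt1 (q : nat) (j : 'I_n) : (q < size ws)%N -> (q * n + j < size ws * n)%N.
  move=> h; apply: leq_trans (_ : q.+1 * n <= _)%N; last by rewrite leq_mul2r h orbT.
  by rewrite mulSn addnC ltn_add2r.
apply: (@runs_for _ _ _ _ _ _ n I) => //.
- move=> i m1 m2 o' h [h1 h2 h3 h4]; split => //.
  + by move=> k' hk; rewrite h ?h2 //; apply: contra hk => /eqP ->.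
  + by move=> x hx; rewrite h // h3.
  + by move=> j hj; rewrite h // h4.
- move=> i m1 o1 hi h39 fr [-> h2 h3 h4]; apply: runs_put => //.
  rewrite /= h39 (h2 48%N) // (h2 35%N) // (h2 31%N) // m48 m35 m31 -!PoszD.
  rewrite (_ : (p * n + i)%N = (p * n + Ordinal hi)%N) // h3 ?lt1 // m30.
  split => //.
  + move=> k' hk; rewrite -h2 //; apply/funext => x; rewrite /update.
    by case: eqP => // e; rewrite e in hk.
  + move=> x hx; eval_update; rewrite h3 //.
    case: eqP => // -[e]; move: hx; rewrite e; lia.
  + move=> j; rewrite ltnS leq_eqVlt => /orP[/eqP ji|ji]; eval_update.
      by have -> : j = Ordinal hi by [apply: val_inj]; rewrite eqxx.
    rewrite h4 //; case: eqP => // -[]; lia.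
move=> m1 o1 fr [-> h2 h3 h4].
have m1E k' : k' \notin [:: 30; 39]%N -> m1 k' = m k' by apply: h2.
do 6 (apply: (runs_seq P1); apply: runs_put => //; eval_update).
apply: runs_put => //; eval_update.
rewrite (m1E 48%N) // (m1E 33%N) // (m1E 34%N) // (m1E 35%N) // (m1E 37%N) // (m1E 38%N) // (m1E 32%N) // (m1E 0%N) // m48 m33 m34 m35 m37 m38 m32 mn -!PoszD.
set w := set_coord _ _ _ in cE fin *.
apply: fin => //.
- move=> k' hk; rewrite !(update_other _ _ _ (notin_neq hk _)) // m1E //.
  by apply: contra hk; rewrite !inE => /orP[] /eqP ->.
- split; first by eval_update; rewrite size_rcons addn1.
  move=> q; rewrite size_rcons ltnS leq_eqVlt => /orP[/eqP ->|hq].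
    rewrite nth_rcons ltnn eqxx; split; eval_update; rewrite ?cE //.
    move=> j; eval_update; rewrite /w mxE; case: (eqVneq (j : nat) k) => jk; first by rewrite jk eqxx.
    by rewrite eqz_nat eqn_add2l (negPf jk) h4.
  rewrite nth_rcons hq; have [g1 g2 g3] := sbp q hq.
  have qs : (q%:Z == size ws :> int) = false by rewrite eqz_nat ltn_eqF.
  split; eval_update; rewrite ?qs ?(m1E 31%N) ?(m1E 32%N) //.
  move=> j; eval_update; rewrite eqz_nat divn_muln_add_lt // (ltn_eqF hq) /= h3 ?lt1 //.
- by eval_update; rewrite size_rcons mulSn; congr Posz; lia.
- by eval_update; rewrite addn1.
- by eval_update; rewrite eqz_nat ltn_eqF // -PoszD.
Qed.

Lemma runs_gen_boxes P n (m : memory) o (N : nat) Q :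
  (1 < P)%N -> (n <= P)%N -> (0 < N)%N -> (N <= P)%N -> (size (boxes n N n) <= P)%N ->
  m 0%N 0 = n%:Z -> m 21%N 0 = N%:Z ->
  (forall j, m 30%N j = 0) -> (forall j, m 31%N j = 0) ->
  (forall m', (forall k', k' \notin mods GenBoxes -> m' k' = m k') ->
     stores_boxes (boxes n N n) m' -> Q m' o) ->
  runs P GenBoxes m o Q.
Proof.
move=> P1 nP N0 NP sP mn mN m30 m31 fin.
apply: (runs_seq P1); apply: runs_put => //; eval_update.
apply: (runs_seq P1); apply: runs_put => //; eval_update.
apply: (runs_seq P1); apply: runs_put => //; eval_update; rewrite mn.
have mem_le k : (k <= n)%N -> (size (boxes n N k) <= size (boxes n N n))%N.
  move=> kn; have : {subset boxes n N k <= boxes n N n}.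
    move=> w /(boxesP _ N0 kn)[h1 h2 h3]; apply/(boxesP _ N0 (leqnn n)); split => // j hj.
    by apply: h3; apply: leq_trans hj.
  by apply: uniq_leq_size; apply: boxes_uniq.
pose I (i : nat) (m' : memory) (o' : seq int) := [/\ o' = o,
   stores_boxes (boxes n N i) m' & m' 48%N 0 = (size (boxes n N i) * n)%:Z].
set m0 := update _ 48 _ _.
apply: (@runs_for _ _ _ _ _ _ n I) => //.
- move=> i m1 m2 o' h [h1 h2 h3]; split => //; last by rewrite h.
  by apply: stores_boxes_frame h2 => k; rewrite !inE => /or4P[] /eqP ->; apply: h.
- split => //; last by rewrite /m0; eval_update; rewrite mul1n.
  split; first by rewrite /m0; eval_update.
  move=> [|p] //= _; rewrite /m0; split; eval_update; rewrite ?weight0 ?m31 // => j.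
  by eval_update; rewrite m30 mxE.
- move=> k m1 o1 kn h34 fr [-> sb h48].
  have mn1 : m1 0%N 0 = n%:Z by rewrite fr // /m0; eval_update.
  have mN1 : m1 21%N 0 = N%:Z by rewrite fr // /m0; eval_update.
  pose bs := boxes n N k; rewrite -/bs in sb h48.
  have kn' := ltnW kn; pose kk := Ordinal kn.
  pose ext w : seq 'cV[int]_n := [seq set_coord w k t%:Z | t <- iota 1 (N %/ weight w - 1)].
  pose J (p : nat) (m' : memory) (o' : seq int) := [/\ o' = o,
   stores_boxes (bs ++ flatten [seq ext w | w <- take p bs]) m' &
   m' 48%N 0 = (size (bs ++ flatten [seq ext w | w <- take p bs]) * n)%:Z].
  have [sb33 _] := sb.
  apply: (runs_seq P1); apply: runs_put => //; eval_update; rewrite sb33.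
  set m2 := update _ 36 _ _.
  have m2E k' : k' != 36%N -> m2 k' = m1 k' by apply: update_other.
  apply: (@runs_for _ _ _ _ _ _ (size bs) J) => //.
  + by apply: leq_trans sP; apply: mem_le.
  + move=> i m3 m4 o' h [h1 h2 h3]; split => //; last by rewrite h.
    by apply: stores_boxes_frame h2 => k'; rewrite !inE => /or4P[] /eqP ->; apply: h.
  + rewrite /J take0 cats0; split => //.
  + move=> p m3 o3 hp h35 fr3 [-> sb3 h48'].
    set pre := bs ++ _ in sb3 h48'.
    pose w := nth 0 bs p.
    have wb : w \in bs by apply: mem_nth.
    have /(boxesP _ N0 kn')[w0 wN wk] := wb.
    have wkk : w kk 0 = 0 by apply: wk.
    have Ww t : weight (set_coord w k t%:Z) = (t.+1 * weight w)%N.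
      by rewrite -(weight_set_coord t wkk).
    have prep q : nth 0 (pre ++ q) p = w by rewrite /pre -catA nth_cat hp.
    have [_ sb3p] := sb3.
    have hpp : (p < size pre)%N by rewrite /pre size_cat ltn_addr.
    have [_ m32 _] := sb3p p hpp.
    have nthp : nth 0 pre p = w by have := prep [::]; rewrite cats0.
    rewrite nthp in m32.
    have mn3 : m3 0%N 0 = n%:Z by rewrite fr3 // m2E.
    have mN3 : m3 21%N 0 = N%:Z by rewrite fr3 // m2E.
    have m34 : m3 34%N 0 = k%:Z by rewrite fr3 // m2E.
    apply: (runs_seq P1); apply: runs_put => //; eval_update.
    apply: (runs_seq P1); apply: runs_put => //; eval_update.
    rewrite h35 m32 -PoszD.
    set m4 := update _ 38 _ _.
    have m4E k' : k' \notin [:: 37; 38]%N -> m4 k' = m3 k'.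
      by move=> hk; rewrite /m4 !(update_other _ _ _ (notin_neq hk _)).
    pose L t := pre ++ [seq set_coord w k s%:Z | s <- iota 1 t].
    pose A (t : nat) (m' : memory) (o' : seq int) := [/\ o' = o,
      (forall k', k' \notin [:: 37, 38 & mods PushBox]%N -> m' k' = m3 k'),
      stores_boxes (L t) m', m' 48%N 0 = (size (L t) * n)%:Z &
      m' 38%N 0 = t.+1%:Z /\ m' 37%N 0 = (t.+2 * weight w)%:Z].
    have w1 := weight_gt0 w.
    have dw : (0 < N %/ weight w)%N by rewrite divn_gt0.
    apply: (@runs_while _ _ _ _ _ _ (N %/ weight w - 1) A) => //.
    * apply: leq_trans (leq_subr _ _) _; exact: leq_trans (leq_div _ _) NP.
    * rewrite /A /L /= cats0; split => //.
      - move=> k' hk; apply: m4E; apply: contra hk; rewrite !inE.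
        by move=> /orP[] /eqP ->.
      - by rewrite /m4; split; eval_update; rewrite // mul2n addnn.
    * move=> t m5 o5 ht [-> fr5 sb5 h5 [h38 h37]]; split.
        rewrite /= h37 fr5 // mN3 lez_nat -leq_divRL //; lia.
      apply: (runs_push (ws := L t) (p := p) (k := k) (t := t.+1) (c := t.+2 * weight w)) => //.
      - by rewrite fr5.
      - by rewrite /L size_cat ltn_addr.
      - by rewrite fr5.
      - by rewrite fr5.
      - by rewrite /L prep Ww.
      rewrite /L prep => m6 fr6 sb6 h6 g38 g37.
      have LE : rcons (L t) (set_coord w k t.+1%:Z) = L t.+1.
        have iE : iota 1 t.+1 = rcons (iota 1 t) t.+1 by rewrite -cats1 -[t.+1 in LHS]addn1 iotaD add1n.
        by rewrite /L iE map_rcons rcons_cat.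
      rewrite -/(L t) LE in sb6 h6; split => //.
        move=> k' hk; rewrite fr6 ?fr5 //.
        by move: hk; rewrite inE negb_or inE negb_or => /and3P[].
      by split => //; rewrite g37; congr Posz; lia.
    * move=> m5 o5 [-> fr5 sb5 h5 [h38 h37]]; split.
        rewrite /= h37 fr5 // mN3 ltz_nat ltnNge -leq_divRL // -ltnNge; lia.
      have LE : L (N %/ weight w - 1)%N = bs ++ flatten [seq ext w | w <- take p.+1 bs].
        rewrite /L /pre (take_nth 0 hp) map_rcons flatten_rcons catA; congr (_ ++ _).
      by rewrite LE in sb5 h5.
  + move=> m3 o3 fr3 [-> sb3 h3]; rewrite take_size in sb3 h3; split => //.
- move=> m1 o1 fr [-> sb _]; apply: fin => // k' hk.
  rewrite fr; last by apply: (notin_sub hk).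
  by rewrite /m0 !(update_other _ _ _ (notin_neq hk _)).
Qed.

(* Arrays 40, 41, 42 hold the parameters [i], [p], [b] of [candv] and
   [cand_ok]; the results go to arrays 43 and 44. *)
Definition Cand : cmd :=
  Dot 30 (Get 31 (scalar 41)) 1 ;;
  45 <~ Quo (Minus (scalar 42) (scalar 14)) (Get 1 (scalar 40)) ;;
  For 46 0 (Put 43 (scalar 46) (Get 30 (Plus (Get 31 (scalar 41)) (scalar 46)))) ;;
  Put 43 (scalar 40) (scalar 45) ;;
  44 <~ Cst 0 ;;
  IfLe (Get 30 (Plus (Get 31 (scalar 41)) (scalar 40))) (Cst 0)
    (IfLe (Rem (Minus (scalar 42) (scalar 14)) (Get 1 (scalar 40))) (Cst 0)
      (IfLe (Cst 0) (Rem (Minus (scalar 42) (scalar 14)) (Get 1 (scalar 40)))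
        (IfLe (Cst 0) (scalar 45) (44 <~ Cst 1) Skip) Skip) Skip) Skip.

(* One step of the Yamnitsky-Levin method. Array 52 holds the matrix whose rows
   generate the current simplicial cone, with the offsets of the rows in array
   28; array 53 holds the cutting vector. *)
Definition Upd : cmd :=
  For 60 0 (
    Mul (Get 54 (scalar 60)) (scalar 25) ;;
    66 <~ Quo (Minus (Cst 0) (scalar 12)) (scalar 64) ;;
    For 62 0 (
      Mul (Minus (Get 52 (Plus (Get 28 (scalar 65)) (scalar 62)))
                 (Get 52 (Plus (Get 28 (scalar 60)) (scalar 62)))) (scalar 66) ;;
      Put 67 (scalar 62) (scalar 12)) ;;
    68 <~ Plus (scalar 26) (scalar 66) ;;
    For 61 0 (For 62 0 (
      Mul (Get 52 (Plus (Get 28 (scalar 61)) (scalar 62))) (scalar 68) ;;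
      Put 52 (Plus (Get 28 (scalar 61)) (scalar 62)) (scalar 12))) ;;
    For 62 0 (
      Put 52 (Plus (Get 28 (scalar 60)) (scalar 62))
        (Plus (Get 52 (Plus (Get 28 (scalar 60)) (scalar 62))) (Get 67 (scalar 62))))).

(** The trial certificate is the sum of the rows, so scalar 63 is its value on the generator. Scalar
    64 is the denominator of the cut coefficients and scalar 65 the pivot. *)
Definition Cut : cmd :=
  For 60 0 (Dot 52 (Get 28 (scalar 60)) 53 ;; Put 54 (scalar 60) (scalar 14)) ;;
  63 <~ Cst 0 ;; 64 <~ Cst 0 ;; 65 <~ Cst 0 ;;
  For 60 0 (
    63 <~ Plus (scalar 63) (Get 54 (scalar 60)) ;;
    IfLe (Cst 0) (Get 54 (scalar 60))
      (64 <~ Plus (scalar 64) (Get 54 (scalar 60)))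
      (64 <~ Minus (scalar 64) (Get 54 (scalar 60))) ;;
    IfLe (Get 54 (scalar 60)) (Get 54 (scalar 65)) Skip (65 <~ scalar 60)) ;;
  IfLe (scalar 63) (Cst 0) (55 <~ Cst 1 ;; Upd) Skip.

(** The data that the later stages read but never write; [env_arrays] lists their arrays, and
    disjointness from [mods] is checked by computation. *)
Definition env (n : nat) (a : 'cV[int]_n) (b : int) (S T : nat) (ws : seq 'cV[int]_n)
    (m : memory) : Prop :=
  [/\ m 0%N 0 = n%:Z, m 0%N 1 = b, forall j : 'I_n, m 1%N (j : nat)%:Z = a j 0
    & stores_boxes ws m] /\
  [/\ m 23%N 0 = (S ^ 2)%:Z, m 25%N 0 = 4 * S%:R ^+ 2, m 26%N 0 = 50 * S%:R ^+ 3,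
      m 27%N 0 = T%:Z & forall r : nat, (r < n)%N -> m 28%N r%:Z = (r * n)%:Z].

Definition env_arrays : seq nat := [:: 0; 1; 23; 25; 26; 27; 28; 30; 31; 32; 33]%N.

Lemma env_frame (n : nat) (a : 'cV[int]_n) b S T ws (m m' : memory) :
  (forall k, k \in env_arrays -> m' k = m k) -> env a b S T ws m -> env a b S T ws m'.
Proof.
move=> fr [[h1 h2 h3 h4] [h5 h6 h7 h8 h9]]; split; split; rewrite ?fr //.
  apply: stores_boxes_frame h4 => k; rewrite !inE => hk; apply: fr.
  by case/or4P: hk => /eqP ->.
Qed.

Definition stores_mat (n : nat) (U : 'M[int]_n) (m : memory) : Prop :=
  forall r c : 'I_n, m 52%N (r * n + c)%N%:Z = U r c.

Lemma stores_mat_put (n : nat) (U V : 'M[int]_n) (m : memory) (r c : 'I_n) x :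
  stores_mat U m ->
  (forall i j, V i j = if (i == r) && (j == c) then x else U i j) ->
  stores_mat V (update m 52 (r * n + c)%N%:Z x).
Proof.
move=> h hV i j; rewrite updE eqxx hV eqz_nat divn_muln_add_lt //=.
by rewrite h.
Qed.

Lemma stores_mat_frame (n : nat) (U : 'M[int]_n) (m m' : memory) :
  m' 52%N = m 52%N -> stores_mat U m -> stores_mat U m'.
Proof. by move=> e h r c; rewrite e. Qed.

Definition small (P : nat) (n : nat) (g : 'cV[int]_n) : Prop := forall j, (absz (g j 0%R) <= P)%N.

Lemma runs_cand P n (a : 'cV[int]_n) b S T ws m o (i : 'I_n) (p : nat) b' Q :
  (1 < P)%N -> (n <= P)%N -> small P a -> env a b S T ws m -> (p < size ws)%N ->
  (forall j, 0 <= nth 0 ws p j 0) ->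
  m 40%N 0 = (i : nat)%:Z -> m 41%N 0 = p%:Z -> m 42%N 0 = b' ->
  (forall m', (forall k, k \notin mods Cand -> m' k = m k) ->
     (forall j : 'I_n, m' 43%N (j : nat)%:Z = candv a b' i (nth 0 ws p) j 0) ->
     m' 44%N 0 = (cand_ok a b' i (nth 0 ws p) : nat)%:Z -> Q m' o) ->
  runs P Cand m o Q.
Proof.
move=> P1 nP aP ev ps w0 m40 m41 m42 fin.
have [[mn mb ma [m33 sb]] _] := ev; have [m31 m32 m30] := sb p ps.
set w := nth 0 ws p in w0 m30 fin *.
apply: (runs_seq P1); apply: (@runs_dot _ _ _ _ _ _ n) => //.
  by move=> j jn; have := ma (Ordinal jn); rewrite /= => ->; apply: aP.
move=> m1 fr1; rewrite /= m41 m31 => h14.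
have {}h14 : m1 14%N 0 = idot a w.
  by rewrite h14; apply: eq_bigr => j _; rewrite -PoszD m30 ma mulrC.
apply: (runs_seq P1); apply: runs_put => //; eval_update.
rewrite h14 (fr1 42%N) // (fr1 1%N) // (fr1 40%N) // m42 m40 ma.
set q := divz _ _; set m2 := update _ 45 _ _.
have m2E k : k \notin 45%N :: iota 10 5 -> m2 k = m k.
  move=> hk; rewrite /m2 (update_other _ _ _ (notin_neq hk _)) //.
  by apply: fr1; apply: (notin_sub hk).
apply: (runs_seq P1).
pose I (x : nat) (m' : memory) (o' : seq int) := [/\ o' = o,
  forall k, k \notin [:: 43; 46]%N -> m' k = m2 k &
  forall j : 'I_n, (j < x)%N -> m' 43%N (j : nat)%:Z = w j 0].
apply: (@runs_for _ _ _ _ _ _ n I) => //.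
- by rewrite m2E.
- move=> x m3 m4 o' h [h1 h2 h3]; split => //.
    by move=> k' hk; rewrite h ?h2 //; apply: (notin_neq hk).
  by move=> j hj; rewrite h // h3.
- move=> x m3 o3 hx h46 fr [-> h2 h3]; apply: runs_put => //.
  rewrite /= h46 (h2 30%N) // (h2 31%N) // (h2 41%N) // (m2E 30%N) // (m2E 31%N) // (m2E 41%N) //.
  rewrite m41 m31 -PoszD (_ : (p * n + x)%N = (p * n + Ordinal hx)%N) // m30.
  split => //.
    by move=> k hk; rewrite (update_other _ _ _ (notin_neq hk _)) // h2.
  move=> j; rewrite ltnS leq_eqVlt => /orP[/eqP jx|jx]; eval_update.
    by have -> : j = Ordinal hx by [apply: val_inj]; rewrite eqxx.
  by rewrite eqz_nat (ltn_eqF jx) h3.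
move=> m3 o3 fr3 [-> h2 h3].
have m3E k : k \notin [:: 43; 45; 46]%N ++ iota 10 5 -> m3 k = m k.
  by move=> hk; rewrite h2 ?m2E //; apply: (notin_sub hk).
have v14 : m3 14%N 0 = idot a w by rewrite h2 // /m2; eval_update.
have v45 : m3 45%N 0 = q by rewrite h2 // /m2; eval_update.
apply: (runs_seq P1); apply: runs_put => //; eval_update.
rewrite v45 (m3E 40%N) // m40.
apply: (runs_seq P1); apply: runs_put => //.
set m4 := update _ 44 _ _.
have m4E k : k \notin [:: 43; 44; 45; 46]%N ++ iota 10 5 -> m4 k = m k.
  move=> hk; rewrite /m4 !(update_other _ _ _ (notin_neq hk _)) //.
  by apply: m3E; apply: (notin_sub hk).
have res m' (f : bool) : (forall k, k \notin [:: 44]%N -> m' k = m4 k) -> m' 44%N 0 = f%:Z ->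
    f = cand_ok a b' i w -> Q m' o.
  move=> fr' h44 fE; apply: fin; last by rewrite h44 fE.
    by move=> k hk; rewrite fr' ?m4E //; apply: (notin_sub hk).
  move=> j; rewrite fr' // /m4 /candv mxE; eval_update; rewrite eqz_nat.
  by case: eqP => // _; rewrite h3.
have w30 : m4 30%N (m4 31%N (m4 41%N 0) + m4 40%N 0) = w i 0.
  by rewrite (m4E 30%N) // (m4E 31%N) // (m4E 41%N) // (m4E 40%N) // m41 m31 m40 -PoszD m30.
have rem : modz (m4 42%N 0 - m4 14%N 0) (m4 1%N (m4 40%N 0)) = modz (b' - idot a w) (a i 0).
  rewrite (m4E 42%N) // (m4E 1%N) // (m4E 40%N) // m42 m40 ma.
  by rewrite (_ : m4 14%N 0 = idot a w) // /m4; eval_update.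
have m444 : m4 44%N 0 = false%:Z by rewrite /m4; eval_update.
have q45 : m4 45%N 0 = q by rewrite /m4; eval_update.
have no : cand_ok a b' i w = false -> runs P Skip m4 o Q.
  by move=> h; apply: runs_skip => //; apply: (res _ false).
apply: runs_if => //=; rewrite w30 => c1; last first.
  by apply: no; rewrite /cand_ok gt_eqF.
have wi : w i 0 == 0 by rewrite eq_le c1 w0.
apply: runs_if => //=; rewrite rem => c2; last first.
  by apply: no; rewrite /cand_ok wi /= gt_eqF.
(* The sign of the remainder matters if [a i 0 = 0]: then it is the dividend and may be negative. *)
apply: runs_if => //=; rewrite rem => c3; last first.
  by apply: no; rewrite /cand_ok wi /= lt_eqF.
have r0 : modz (b' - idot a w) (a i 0) == 0 by rewrite eq_le c2 c3.
apply: runs_if => //=; rewrite q45 => c4; last first.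
  by apply: no; rewrite /cand_ok wi r0 /= leNgt c4.
apply: runs_put => //=; apply: (res _ true).
- by move=> k hk; rewrite (update_other _ _ _ (notin_neq hk _)).
- by eval_update.
- by rewrite /cand_ok wi r0 c4.
Qed.

(** * The cutting step on the machine *)

Definition offsets (n : nat) (m : memory) : Prop :=
  m 0%N 0 = n%:Z /\ forall r : nat, (r < n)%N -> m 28%N r%:Z = (r * n)%:Z.

Lemma offsets_frame (n : nat) (m m' : memory) :
  m' 0%N = m 0%N -> m' 28%N = m 28%N -> offsets n m -> offsets n m'.
Proof. by move=> e1 e2 [h1 h2]; split; [rewrite e1|move=> r hr; rewrite e2 h2]. Qed.

Lemma runs_scale P n (U : 'M[int]_n) (m : memory) o (e : int) Q :
  (1 < P)%N -> (n <= P)%N -> (absz e <= P)%N -> offsets n m -> stores_mat U m -> m 68%N 0 = e ->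
  (forall m', (forall k, k \notin [:: 52; 61; 62]%N ++ iota 10 3 -> m' k = m k) ->
     stores_mat (\matrix_(i, j) (e * U i j)) m' -> Q m' o) ->
  runs P (For 61 0 (For 62 0 (
      Mul (Get 52 (Plus (Get 28 (scalar 61)) (scalar 62))) (scalar 68) ;;
      Put 52 (Plus (Get 28 (scalar 61)) (scalar 62)) (scalar 12)))) m o Q.
Proof.
move=> P1 nP eP [mn off] sU m68 fin.
pose A (r c : nat) : 'M[int]_n :=
  \matrix_(i, j) (if (i < r)%N || ((i == r :> nat) && (j < c)%N) then e * U i j else U i j).
pose I c r (m' : memory) (o' : seq int) := [/\ o' = o,
  forall k, k \notin [:: 52; 61; 62]%N ++ iota 10 3 -> m' k = m k & stores_mat (A r c) m'].
have Iins c r m1 m2 o' L : all (mem ([:: 52; 61; 62]%N ++ iota 10 3)) L -> 52%N \notin L ->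
    (forall k', k' \notin L -> m2 k' = m1 k') -> I c r m1 o' -> I c r m2 o'.
  move=> hL h52 h [h1 h2 h3]; split => //.
    by move=> k hk; rewrite h ?h2 //; apply: (notin_sub hk).
  by apply: stores_mat_frame h3; rewrite h.
apply: (@runs_for _ _ _ _ _ _ n (I 0%N)) => //.
- move=> r m1 m2 o' h; apply: (@Iins 0%N r m1 m2 o' [:: 61%N]) => // k' hk; apply: h.
  by apply: (notin_neq hk).
- split => // i j; rewrite sU mxE.
  by rewrite ltn0 andbF.
- move=> r m1 o1 rn h61 fr [-> h2 h3].
  apply: (@runs_for _ _ _ _ _ _ n (fun c => I c r)) => //.
  + by rewrite h2.
  + move=> c m2 m3 o' h; apply: (@Iins c r m2 m3 o' [:: 62%N]) => // k' hk; apply: h.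
    by apply: (notin_neq hk).
  + move=> c m2 o2 cn h62 fr2 [-> g2 g3].
    have h61' : m2 61%N 0 = r%:Z by rewrite fr2.
    have e68 : m2 68%N 0 = e by rewrite g2.
    apply: (runs_seq P1); apply: runs_mul => //; first by rewrite /= e68.
    move=> m4 fr4; rewrite /= h61' h62 e68 (g2 28%N) // off // -PoszD => h12.
    apply: runs_put => //=; rewrite (fr4 28%N) // (fr4 61%N) // (fr4 62%N) // h61' h62 (g2 28%N) //.
    rewrite off // -PoszD h12; split => //.
      move=> k hk; rewrite (update_other _ _ _ (notin_neq hk _)) // fr4; first exact: g2.
      by apply: (notin_sub hk).
    apply: (@stores_mat_put _ (A r c) _ _ (Ordinal rn) (Ordinal cn)).
      by apply: stores_mat_frame g3; rewrite fr4.
    move=> i j; rewrite !mxE -!val_eqE /= ltnS.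
    have -> : m2 52%N (r * n + c)%N = U (Ordinal rn) (Ordinal cn).
      by rewrite (g3 (Ordinal rn) (Ordinal cn)) mxE /= !ltnn eqxx.
    case: (ltngtP i r) => // ir /=; rewrite leq_eqVlt; case: eqP => //= jc.
    have -> : i = Ordinal rn by apply: val_inj.
    have -> : j = Ordinal cn by apply: val_inj.
    by rewrite mulrC.
  + move=> m2 o2 fr2 [-> g2 g3]; split => // i j; rewrite g3 !mxE ltnS (leq_eqVlt i r).
    by rewrite ltn_ord andbT ltn0 andbF orbF orbC.
- move=> m1 o1 fr [-> h2 h3]; apply: fin => // i j; rewrite h3 !mxE ltn_ord //.
Qed.

Lemma runs_upd P n S (U : 'M[int]_n) (h : 'cV[int]_n) (k : 'I_n) (m : memory) o Q :
  (1 < P)%N -> (n <= P)%N -> (54 * S ^ 3 <= P)%N -> (0 < S)%N -> offsets n m ->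
  m 25%N 0 = 4 * S%:R ^+ 2 -> m 26%N 0 = 50 * S%:R ^+ 3 ->
  stores_mat U m -> (forall r : 'I_n, m 54%N (r : nat)%:Z = h r 0) ->
  m 65%N 0 = (k : nat)%:Z -> m 64%N 0 = \sum_r `|h r 0| ->
  (forall m', (forall k, k \notin mods Upd -> m' k = m k) ->
     stores_mat (cut_upd S k h U) m' -> Q m' o) ->
  runs P Upd m o Q.
Proof.
move=> P1 nP SP S0 [mn off] m25 m26 sU m54 m65 m64 fin.
pose V r := upd (50 * S%:R ^+ 3) k (cut_coef S h) U (take r (enum 'I_n)).
have e23 : (S ^ 2 <= S ^ 3)%N by rewrite leq_pexp2l.
have K4 : (4 * S%:R ^+ 2 : int) = (4 * S ^ 2)%N%:Z by rewrite -[RHS]natz natrM natrX.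
have K50 : (50 * S%:R ^+ 3 : int) = (50 * S ^ 3)%N%:Z by rewrite -[RHS]natz natrM natrX.
have VS r (rn : (r < n)%N) : V r.+1 = elem (50 * S%:R ^+ 3) k (Ordinal rn) (cut_coef S h (Ordinal rn)) (V r).
  rewrite /V (take_nth (Ordinal rn)) ?size_enum_ord // (nth_ord_enum (Ordinal rn) (Ordinal rn)).
  by rewrite /upd foldl_rcons.
pose I r (m' : memory) (o' : seq int) := [/\ o' = o,
  forall k, k \notin mods Upd -> m' k = m k & stores_mat (V r) m'].
apply: (@runs_for _ _ _ _ _ _ n I) => //.
- move=> r m1 m2 o' hm [h1 h2 h3]; split => //.
    by move=> x hx; rewrite hm ?h2 //; apply: (notin_neq hx).
  by apply: stores_mat_frame h3; rewrite hm.
- by split => //; rewrite /V take0.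
- move=> r m1 o1 rn h60 fr [-> h2 h3].
  set D : int := 50 * S%:R ^+ 3 in m26 VS *.
  pose rr := Ordinal rn; pose mr := cut_coef S h rr.
  have mrP : `|mr| <= (4 * S ^ 2)%N%:Z by rewrite -K4; apply: cut_coef_bound.
  apply: (runs_seq P1); apply: runs_mul => //.
    by rewrite /= h2 // m25 K4 /=; lia.
  move=> m2 fr2; rewrite /= h60 (h2 54%N) // (h2 25%N) // (m54 rr) m25 => h12.
  apply: (runs_seq P1); apply: runs_put => //=.
  rewrite h12 (fr2 64%N) // (h2 64%N) // m64 sub0r [h rr 0 * _]mulrC -/(cut_coef S h rr) -/mr.
  set m3 := update _ _ _ _.
  have m3E x : x \notin mods Upd -> m3 x = m x.
    move=> hx; rewrite /m3 (update_other _ _ _ (notin_neq hx _)) // fr2 ?h2 //.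
    by apply: (notin_sub hx).
  have m360 : m3 60%N 0 = r%:Z by rewrite /m3; eval_update; rewrite fr2.
  have m366 : m3 66%N 0 = mr by rewrite /m3; eval_update.
  have s3 : stores_mat (V r) m3.
    by apply: stores_mat_frame h3; rewrite /m3 update_other // fr2.
  apply: (runs_seq P1).
  (* The differences to the pivot row are saved in array 67 before all rows are scaled, since [elem]
     refers to the old rows. *)
  pose J c (m' : memory) (o' : seq int) := [/\ o' = o,
    forall k, k \notin [:: 62; 67]%N ++ iota 10 3 -> m' k = m3 k &
    forall j : 'I_n, (j < c)%N -> m' 67%N (j : nat)%:Z = (V r k j - V r rr j) * mr].
  apply: (@runs_for _ _ _ _ _ _ n J) => //.
  + by rewrite m3E.
  + move=> c m4 m5 o' hm [g1 g2 g3]; split => //.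
      by move=> x hx; rewrite hm ?g2 //; apply: (notin_neq hx).
    by move=> j hj; rewrite hm // g3.
  + move=> c m4 o4 cn h62 fr4 [-> g2 g3].
    apply: (runs_seq P1); apply: runs_mul => //.
      by rewrite /= g2 // m366; lia.
    move=> m5 fr5; rewrite /= (g2 66%N) // m366 h62 (g2 28%N) // (g2 65%N) // (g2 60%N) // (g2 52%N) //.
    rewrite (m3E 28%N) // (m3E 65%N) // m360 m65 !off // -!PoszD.
    rewrite (s3 k (Ordinal cn)) (s3 rr (Ordinal cn)) => h12'.
    apply: runs_put => //=; rewrite (fr5 62%N) // h62 h12'; split => //.
      move=> x hx; rewrite (update_other _ _ _ (notin_neq hx _)) // fr5 ?g2 //.
      by apply: (notin_sub hx).
    move=> j; rewrite ltnS leq_eqVlt => /orP[/eqP jx|jx]; eval_update.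
      by have -> : j = Ordinal cn by [apply: val_inj]; rewrite eqxx.
    by rewrite eqz_nat (ltn_eqF jx) fr5 // g3.
  move=> m4 o4 fr4 [-> g2 g3].
  apply: (runs_seq P1); apply: runs_put => //=.
  rewrite (g2 26%N) // (m3E 26%N) // m26 (g2 66%N) // m366.
  set m5 := update _ _ _ _.
  have m5E x : x \notin mods Upd -> m5 x = m x.
    move=> hx; rewrite /m5 (update_other _ _ _ (notin_neq hx _)) // g2 ?m3E //.
    by apply: (notin_sub hx).
  have s5 : stores_mat (V r) m5.
    by apply: stores_mat_frame s3; rewrite /m5 update_other // g2.
  apply: (runs_seq P1); apply: (runs_scale (U := V r) (e := D + mr)) => //.
  + by rewrite /D K50; lia.
  + by apply: (offsets_frame (m := m)); rewrite ?m5E.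
  move=> m6 fr6 s6.
  have m6E x : x \notin mods Upd -> m6 x = m x.
    move=> hx; rewrite fr6 ?m5E //; by apply: (notin_sub hx).
  have m660 : m6 60%N 0 = r%:Z by rewrite fr6 // /m5 update_other // g2.
  have m667 (j : 'I_n) : m6 67%N (j : nat)%:Z = (V r k j - V r rr j) * mr.
    by rewrite fr6 // /m5 update_other // g3.
  pose A (c : nat) : 'M[int]_n :=
    \matrix_(i, j) ((D + mr) * V r i j + if (i == rr) && (j < c)%N then mr * (V r k j - V r i j) else 0).
  pose K c (m' : memory) (o' : seq int) := [/\ o' = o,
    forall k, k \notin [:: 52; 62]%N -> m' k = m6 k & stores_mat (A c) m'].
  apply: (@runs_for _ _ _ _ _ _ n K) => //.
  + by rewrite m6E.
  + move=> c m7 m8 o' hm [f1 f2 f3]; split => //.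
      by move=> x hx; rewrite hm ?f2 //; apply: (notin_neq hx).
    by apply: stores_mat_frame f3; rewrite hm.
  + split => // i j; rewrite s6 !mxE ltn0 andbF addr0 //.
  + move=> c m7 o7 cn h62 fr7 [-> f2 f3]; apply: runs_put => //=.
    rewrite h62 (f2 28%N) // (f2 60%N) // (f2 67%N) // m660 (m6E 28%N) // off // -PoszD.
    rewrite (f3 rr (Ordinal cn)) (m667 (Ordinal cn)); split => //.
      by move=> x hx; rewrite (update_other _ _ _ (notin_neq hx _)) // f2.
    apply: (@stores_mat_put _ (A c) _ _ rr (Ordinal cn)) => // i j.
    rewrite !mxE eqxx ltnn /= addr0 ltnS leq_eqVlt -(val_eqE j).
    case: (eqVneq i rr) => [->|] //=; case: eqP => //= jc.
    have -> : j = Ordinal cn by apply: val_inj.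
    by rewrite [mr * _]mulrC.
  + move=> m7 o7 fr7 [-> f2 f3]; split => //.
      by move=> x hx; rewrite f2 ?m6E //; apply: (notin_sub hx).
    rewrite (VS r rn) => i j; rewrite f3 !mxE ltn_ord andbT.
    by case: eqP => [->|].
- move=> m1 o1 fr [-> h2 h3]; apply: fin => //.
  by move: h3; rewrite /V -[n in take n _](size_enum_ord n) take_size.
Qed.

Definition cut_step (S n : nat) (g : 'cV[int]_n) (U U' : 'M[int]_n) (f f' : int) : Prop :=
  let h := U *m g in
  [\/ [/\ 0 < \sum_r h r 0, U' = U & f' = f]
    | [/\ \sum_r h r 0 <= 0, f' = 1
        & exists2 k, forall i, h i 0 <= h k 0 & U' = cut_upd S k h U]].

Lemma runs_cut P n S (U : 'M[int]_n) (g : 'cV[int]_n) (m : memory) o Q :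
  (1 < P)%N -> (n <= P)%N -> (0 < n)%N -> (54 * S ^ 3 <= P)%N -> (0 < S)%N -> offsets n m ->
  m 25%N 0 = 4 * S%:R ^+ 2 -> m 26%N 0 = 50 * S%:R ^+ 3 ->
  stores_mat U m -> (forall j : 'I_n, m 53%N (j : nat)%:Z = g j 0) -> small P g ->
  (forall m' U', (forall k, k \notin mods Cut -> m' k = m k) ->
     stores_mat U' m' -> cut_step S g U U' (m 55%N 0) (m' 55%N 0) -> Q m' o) ->
  runs P Cut m o Q.
Proof.
move=> P1 nP n0 SP S0 [mn off] m25 m26 sU m53 gP fin.
pose h := U *m g.
apply: (runs_seq P1).
pose I (r : nat) (m' : memory) (o' : seq int) := [/\ o' = o,
  forall k, k \notin [:: 54; 60]%N ++ iota 10 5 -> m' k = m k &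
  forall j : 'I_n, (j < r)%N -> m' 54%N (j : nat)%:Z = h j 0].
apply: (@runs_for _ _ _ _ _ _ n I) => //.
- move=> r m1 m2 o' hm [h1 h2 h3]; split => //.
    by move=> x hx; rewrite hm ?h2 //; apply: (notin_neq hx).
  by move=> j hj; rewrite hm // h3.
- move=> r m1 o1 rn h60 fr [-> h2 h3].
  apply: (runs_seq P1); apply: (@runs_dot _ _ _ _ _ _ n) => //.
  + by rewrite h2.
  + by move=> j jn; rewrite h2 // (m53 (Ordinal jn)); apply: gP.
  move=> m2 fr2; rewrite /= h60 (h2 28%N) // off // => h14.
  apply: runs_put => //=; rewrite h14 (fr2 60%N) // h60; split => //.
    move=> k hk; rewrite (update_other _ _ _ (notin_neq hk _)) // fr2 ?h2 //.
    by apply: (notin_sub hk).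
  move=> j; rewrite ltnS leq_eqVlt => /orP[/eqP jr|jr]; eval_update; last first.
    by rewrite eqz_nat (ltn_eqF jr) fr2 // h3.
  have -> : j = Ordinal rn by apply: val_inj.
  rewrite eqxx mxE; apply: eq_bigr => l _; rewrite -PoszD (h2 52%N) // (h2 53%N) //.
  by rewrite m53 (sU (Ordinal rn) l).
move=> m1 o1 fr1 [-> h2 h3].
have h54 (j : 'I_n) : m1 54%N (j : nat)%:Z = h j 0 by rewrite h3.
apply: (runs_seq P1); apply: runs_put => //=.
apply: (runs_seq P1); apply: runs_put => //=.
apply: (runs_seq P1); apply: runs_put => //=.
set m2 := update _ 65 _ _.
have m2E k : k \notin [:: 54; 60; 63; 64; 65]%N ++ iota 10 5 -> m2 k = m k.
  move=> hk; rewrite /m2 !(update_other _ _ _ (notin_neq hk _)) // h2 //.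
  by apply: (notin_sub hk).
have m254 : m2 54%N = m1 54%N by rewrite /m2 !update_other.
apply: (runs_seq P1).
pose J (r : nat) (m' : memory) (o' : seq int) := [/\ o' = o,
  forall k, k \notin [:: 60; 63; 64; 65]%N -> m' k = m2 k,
  m' 63%N 0 = \sum_(j < r) m1 54%N (j : nat)%:Z, m' 64%N 0 = \sum_(j < r) `|m1 54%N (j : nat)%:Z| &
  exists k : 'I_n, m' 65%N 0 = (k : nat)%:Z /\ forall j : 'I_n, (j < r)%N -> h j 0 <= h k 0].
apply: (@runs_for _ _ _ _ _ _ n J) => //.
- by rewrite m2E.
- move=> r m3 m4 o' hm [g1 g2 g3 g4 [k [g5 g6]]]; split; rewrite ?hm //; last first.
    by exists k.
  by move=> x hx; rewrite hm ?g2 //; apply: (notin_neq hx).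
- split => //; rewrite ?big_ord0 //.
  by exists (Ordinal n0).
- move=> r m3 o3 rn h60 fr [-> g2 g3 g4 [k [g5 g6]]].
  pose rr := Ordinal rn.
  have v54 : m3 54%N r%:Z = h rr 0 by rewrite g2 // m254 (h54 rr).
  apply: (runs_seq P1); apply: runs_put => //=; rewrite h60 g3.
  set m4 := update _ _ _ _.
  have m4E x : x != 63%N -> m4 x = m3 x by apply: update_other.
  have step m5 o5 (k' : 'I_n) : (forall x, x \notin [:: 63; 64; 65]%N -> m5 x = m3 x) -> o5 = o ->
      m5 63%N 0 = m4 63%N 0 -> m5 64%N 0 = m3 64%N 0 + `|h rr 0| -> m5 65%N 0 = (k' : nat)%:Z ->
      (forall j : 'I_n, (j < r.+1)%N -> h j 0 <= h k' 0) -> J r.+1 m5 o5.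
    move=> f1 -> f2 f3 f4 f5; split => //.
    - by move=> x hx; rewrite f1 ?g2 //; apply: (notin_sub hx).
    - by rewrite f2 /m4; eval_update; rewrite big_ord_recr /= v54 -(h54 rr).
    - by rewrite f3 g4 big_ord_recr /= -(h54 rr).
    - by exists k'.
  have {}step m5 : (forall x, x \notin [:: 63; 64]%N -> m5 x = m3 x) ->
      m5 63%N 0 = m4 63%N 0 -> m5 64%N 0 = m3 64%N 0 + `|h rr 0| ->
      runs P (IfLe (Get 54 (scalar 60)) (Get 54 (scalar 65)) Skip (65 <~ scalar 60)) m5 o (J r.+1).
    move=> f1 f2 f3; apply: runs_if => //=; rewrite !f1 // h60 g5 v54 g2 // m254 h54 => c.
      apply: runs_skip => //; apply: (step m5 o k) => //.
      - by move=> x hx; apply: f1; apply: (notin_sub hx).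
      - by rewrite f1.
      - move=> j; rewrite ltnS leq_eqVlt => /orP[/eqP jr|]; last exact: g6.
        by have -> : j = rr by apply: val_inj.
    apply: runs_put => //=; rewrite f1 // h60; apply: (step _ o rr) => //.
    - move=> x hx; rewrite (update_other _ _ _ (notin_neq hx _)) //; apply: f1.
      by apply: (notin_sub hx).
    - move=> j; rewrite ltnS leq_eqVlt => /orP[/eqP jr|jr].
        by have -> : j = rr by apply: val_inj.
      by apply: le_trans (g6 _ jr) (ltW c).
  apply: (runs_seq P1); apply: runs_if => //=; rewrite !m4E // h60 v54 => c.
    apply: runs_put => //=; rewrite !m4E // h60 v54; apply: step.
    - by move=> x hx; rewrite /m4 !(update_other _ _ _ (notin_neq hx _)).
    - by eval_update.
    - by eval_update; rewrite ger0_norm.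
  apply: runs_put => //=; rewrite !m4E // h60 v54; apply: step.
  - by move=> x hx; rewrite /m4 !(update_other _ _ _ (notin_neq hx _)).
  - by eval_update.
  - by eval_update; rewrite ltr0_norm.
move=> m3 o3 fr3 [-> g2 g3 g4 [k [g5 g6]]].
have s63 : m3 63%N 0 = \sum_r h r 0 by rewrite g3; apply: eq_bigr => r _; rewrite h54.
have s64 : m3 64%N 0 = \sum_r `|h r 0| by rewrite g4; apply: eq_bigr => r _; rewrite h54.
have m3E x : x \notin [:: 54; 60; 63; 64; 65]%N ++ iota 10 5 -> m3 x = m x.
  by move=> hx; rewrite g2 ?m2E //; apply: (notin_sub hx).
have s3 : stores_mat U m3 by apply: stores_mat_frame sU; rewrite m3E.
apply: runs_if => //=; rewrite s63 => c; last first.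
  apply: runs_skip => //; apply: (fin _ U) => //.
    by move=> x hx; apply: m3E; apply: (notin_sub hx).
  by left; rewrite m3E.
apply: (runs_seq P1); apply: runs_put => //=.
set m4 := update _ _ _ _.
have m4E x : x \notin [:: 54; 55; 60; 63; 64; 65]%N ++ iota 10 5 -> m4 x = m x.
  move=> hx; rewrite /m4 (update_other _ _ _ (notin_neq hx _)) // m3E //.
  by apply: (notin_sub hx).
have m43 x : x != 55%N -> m4 x = m3 x by apply: update_other.
apply: (@runs_upd P n S U h k) => //.
- by apply: (offsets_frame (m := m)); rewrite ?m4E.
- by rewrite m4E.
- by rewrite m4E.
- by move=> r; rewrite m43 // g2 // m254.
move=> m5 fr5 s5; apply: (fin _ (cut_upd S k h U)) => //.
  by move=> x hx; rewrite fr5 ?m4E //; apply: (notin_sub hx).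
right; split => //; first by rewrite fr5 // /m4; eval_update.
by exists k => // i; apply: g6.
Qed.

Definition SetDiff : cmd :=
  69 <~ Cst 0 ;;
  For 62 0 (
    Put 53 (scalar 62) (Minus (Get 43 (scalar 62)) (Get 51 (scalar 62))) ;;
    IfLe (Cst 0) (Get 53 (scalar 62))
      (69 <~ Plus (scalar 69) (Get 53 (scalar 62)))
      (69 <~ Minus (scalar 69) (Get 53 (scalar 62)))).

Definition SetUnit : cmd :=
  For 62 0 (Put 53 (scalar 62) (Cst 0)) ;; Put 53 (scalar 59) (Cst 1).

(** A cut does not restart the pass through the generators: one cut per round is enough progress,
    and a round without a cut has checked all of them against the same matrix. *)
Definition Round : cmd :=
  55 <~ Cst 0 ;;
  For 59 0 (SetUnit ;; Cut) ;;
  For 57 0 (For 58 33 (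
    40 <~ scalar 57 ;; 41 <~ scalar 58 ;; Cand ;;
    IfLe (Cst 1) (scalar 44) (SetDiff ;; IfLe (Cst 1) (scalar 69) Cut Skip) Skip)).

(* Tests whether the solution stored in array 50 is a vertex; the answer is 0
   in array 55 if it is. *)
Definition Test : cmd :=
  For 62 0 (
    IfLe (Get 50 (scalar 62)) (scalar 23)
      (Put 51 (scalar 62) (Get 50 (scalar 62))) (Put 51 (scalar 62) (scalar 23))) ;;
  Dot 51 (Cst 0) 1 ;; 42 <~ scalar 14 ;;
  For 60 0 (
    For 62 0 (Put 52 (Plus (Get 28 (scalar 60)) (scalar 62)) (Cst 0)) ;;
    Put 52 (Plus (Get 28 (scalar 60)) (scalar 60)) (Cst 1)) ;;
  For 56 27 Round.

(** * The vertex test on the machine *)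

Lemma runs_set_unit P n (m : memory) o (j : 'I_n) Q :
  (1 < P)%N -> (n <= P)%N -> m 0%N 0 = n%:Z -> m 59%N 0 = (j : nat)%:Z ->
  (forall m', (forall k, k \notin mods SetUnit -> m' k = m k) ->
     (forall i : 'I_n, m' 53%N (i : nat)%:Z = (delta_mx j 0 : 'cV[int]_n) i 0) -> Q m' o) ->
  runs P SetUnit m o Q.
Proof.
move=> P1 nP mn m59 fin.
pose I (x : nat) (m' : memory) (o' : seq int) := [/\ o' = o,
  forall k, k \notin [:: 53; 62]%N -> m' k = m k &
  forall i : 'I_n, (i < x)%N -> m' 53%N (i : nat)%:Z = 0].
apply: (runs_seq P1); apply: (@runs_for _ _ _ _ _ _ n I) => //.
- move=> x m1 m2 o' hm [h1 h2 h3]; split => //.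
    by move=> k hk; rewrite hm ?h2 //; apply: (notin_neq hk).
  by move=> i hi; rewrite hm // h3.
- move=> x m1 o1 hx h62 fr [-> h2 h3]; apply: runs_put => //=; rewrite h62; split => //.
    by move=> k hk; rewrite (update_other _ _ _ (notin_neq hk _)) // h2.
  move=> i; rewrite ltnS leq_eqVlt => /orP[/eqP ix|ix]; eval_update; first by rewrite ix eqxx.
  by case: eqP => // _; rewrite h3.
move=> m1 o1 fr [-> h2 h3]; apply: runs_put => //=; rewrite h2 // m59; apply: fin.
  move=> k hk; rewrite (update_other _ _ _ (notin_neq hk _)) // h2 //.
  by apply: (notin_sub hk).
move=> i; eval_update; rewrite mxE eqz_nat andbT h3 // -(val_eqE i).
by case: (_ == _).
Qed.

Lemma runs_set_diff P n (m : memory) o (y v : 'cV[int]_n) Q :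
  (1 < P)%N -> (n <= P)%N -> m 0%N 0 = n%:Z ->
  (forall i : 'I_n, m 43%N (i : nat)%:Z = y i 0) -> (forall i : 'I_n, m 51%N (i : nat)%:Z = v i 0) ->
  (forall m', (forall k, k \notin mods SetDiff -> m' k = m k) ->
     (forall i : 'I_n, m' 53%N (i : nat)%:Z = (y - v) i 0) ->
     (1 <= m' 69%N 0) = (y - v != 0) -> Q m' o) ->
  runs P SetDiff m o Q.
Proof.
move=> P1 nP mn m43 m51 fin.
pose I (x : nat) (m' : memory) (o' : seq int) := [/\ o' = o,
  forall k, k \notin [:: 53; 62; 69]%N -> m' k = m k,
  forall i : 'I_n, (i < x)%N -> m' 53%N (i : nat)%:Z = (y - v) i 0,
  0 <= m' 69%N 0 & (m' 69%N 0 == 0) = [forall i : 'I_n, (i < x)%N ==> ((y - v) i 0 == 0)]].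
apply: (runs_seq P1); apply: runs_put => //=; set m0 := update _ _ _ _.
apply: (@runs_for _ _ _ _ _ _ n I) => //.
- move=> x m1 m2 o' hm [h1 h2 h3 h4 h5]; split; rewrite ?hm //.
  by move=> k hk; rewrite hm ?h2 //; apply: (notin_neq hk).
- split => //; first by move=> k hk; rewrite /m0 (update_other _ _ _ (notin_neq hk _)).
  by rewrite /m0; eval_update; apply/esym/forallP.
- move=> x m1 o1 hx h62 fr [-> h2 h3 h4 h5].
  pose xx := Ordinal hx; pose d := (y - v) xx 0.
  apply: (runs_seq P1); apply: runs_put => //=.
  rewrite h62 !h2 // (m43 xx) (m51 xx).
  have -> : y xx 0 - v xx 0 = d by rewrite /d !mxE.
  set m2 := update _ _ _ _.
  have m2E k : k != 53%N -> m2 k = m1 k by apply: update_other.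
  have v53 : m2 53%N x%:Z = d by rewrite /m2; eval_update.
  have step m3 : (forall k, k \notin [:: 69]%N -> m3 k = m2 k) -> m3 69%N 0 = m1 69%N 0 + `|d| ->
      I x.+1 m3 o.
    move=> f1 f2; split => //.
    + move=> k hk; rewrite f1; last by apply: (notin_sub hk).
      rewrite m2E ?h2 //; apply: (notin_neq hk) => //.
    + move=> i; rewrite ltnS leq_eqVlt f1 // => /orP[/eqP ix|ix].
        by have -> : i = xx by [apply: val_inj]; rewrite v53.
      by rewrite /m2; eval_update; rewrite eqz_nat (ltn_eqF ix) h3.
    + by rewrite f2 addr_ge0.
    + rewrite f2 paddr_eq0 // h5 normr_eq0; apply/andP/forallP => [[/forallP hf hd] i|hf].
        apply/implyP; rewrite ltnS leq_eqVlt => /orP[/eqP ix|ix].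
          by have -> : i = xx by apply: val_inj.
        by have := hf i; rewrite ix.
      split; last by have := hf xx; rewrite ltnSn.
      apply/forallP => i; apply/implyP => ix; have := hf i.
      by rewrite ltnS ltnW.
  apply: runs_if => //=; rewrite (m2E 62%N) // h62 v53 => c.
    apply: runs_put => //=; rewrite (m2E 62%N) // (m2E 69%N) // h62 v53; apply: step.
      by move=> k hk; rewrite (update_other _ _ _ (notin_neq hk _)).
    by eval_update; rewrite ger0_norm.
  apply: runs_put => //=; rewrite (m2E 62%N) // (m2E 69%N) // h62 v53; apply: step.
    by move=> k hk; rewrite (update_other _ _ _ (notin_neq hk _)).
  by eval_update; rewrite ltr0_norm.
move=> m1 o1 fr [-> h2 h3 h4 h5]; apply: fin.
- by move=> k hk; rewrite h2 //; apply: (notin_sub hk).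
- by move=> i; rewrite h3.
have -> : (1 <= m1 69%N 0) = (m1 69%N 0 != 0) by move: h4; lia.
rewrite h5; congr (~~ _); apply/forallP/eqP => [hf|-> i]; last by rewrite mxE eqxx implybT.
by apply/colP => i; have /implyP/(_ (ltn_ord i))/eqP -> := hf i; rewrite mxE.
Qed.

Definition rate_sum (n : nat) (U : 'M[int]_n) (g : 'cV[int]_n) : int := \sum_r (U *m g) r 0.

Lemma rate_sumE (n : nat) (U : 'M[int]_n) (g : 'cV[int]_n) :
  rate_sum U g = \sum_r \sum_j U r j * g j 0.
Proof. by apply: eq_bigr => r _; rewrite mxE. Qed.

(** [Test] has no early exit. A matrix whose row sum satisfies all inequalities is left unchanged by
    every later round, hence the disjunction in the hypothesis. The volume invariant is conditional
    on [~ averaged], which guarantees a strictly feasible point. *)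
Lemma runs_round P n Dl T (a v : 'cV[int]_n) (b b0 : int) (U : 'M[int]_n) (m : memory) o t Q :
  let S := (n * Dl)%N in let v' := truncate (S ^ 2)%:Z v in
  let ws := boxes n (4 * Dl ^ 2) n in
  let G g := g \in gens (4 * Dl ^ 2) a (idot a v') v' in
  let good t U := ~ averaged a b v -> simplex_inv S G U t in
  (1 < P)%N -> (n <= P)%N -> (0 < n)%N -> (0 < Dl)%N -> (54 * S ^ 3 <= P)%N ->
  (size ws <= P)%N -> (forall j, `|a j 0| <= Dl%:Z) -> sol a b v ->
  env a b0 S T ws m -> m 42%N 0 = idot a v' ->
  (forall i : 'I_n, m 51%N (i : nat)%:Z = v' i 0) -> stores_mat U m ->
  (forall g, G g -> 0 < rate_sum U g) \/ good t U ->
  (forall m' U', (forall k, k \notin mods Round -> m' k = m k) -> stores_mat U' m' ->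
     (m' 55%N 0 = 0 /\ (forall g, G g -> 0 < rate_sum U' g)) \/ (m' 55%N 0 = 1 /\ good t.+1 U') ->
     Q m' o) ->
  runs P Round m o Q.
Proof.
move=> S v' ws G good P1 nP n0 D0 SP wsP aD sv ev m42 m51 sU start fin.
have S0 : (0 < S)%N by rewrite muln_gt0 n0.
have N0 : (0 < 4 * Dl ^ 2)%N by rewrite muln_gt0 expn_gt0 D0.
have [vb v0] := sv.
have vT j : 0 <= v' j 0 <= (S ^ 2)%:Z by rewrite mxE le_min v0 ge_min lexx orbT.
have Gsmall g : G g -> small P g.
  move=> Gg j; have := gens_bound j n0 D0 aD vT Gg; rewrite -/S -lez_nat abszE => h.
  by apply: le_trans h _; rewrite lez_nat; apply: leq_trans SP; rewrite leq_mul2r orbT.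
have e13 : (Dl <= P)%N.
  apply: leq_trans (_ : S <= _)%N; first by rewrite leq_pmull.
  apply: leq_trans SP; apply: leq_trans (_ : S ^ 3 <= _)%N; last by rewrite leq_pmull.
  by rewrite -{1}[S]expn1 leq_pexp2l.
have aP : small P a.
  by move=> j; have := aD j; rewrite -abszE lez_nat => h; apply: leq_trans h e13.
(* The state within a round: either no cut so far, and the unchanged [U] is positive on all
   generators seen, or a cut has been made and the invariant has advanced to [t.+1]. *)
pose R (seen : 'cV[int]_n -> Prop) (m' : memory) := exists2 U', stores_mat U' m' &
  (m' 55%N 0 = 0 /\ U' = U /\ forall g, seen g -> 0 < rate_sum U g) \/
  (m' 55%N 0 = 1 /\ (exists2 g, G g & rate_sum U g <= 0) /\ good t.+1 U').
pose L := [:: 52; 53; 54; 55; 59; 60; 61; 62; 63; 64; 65; 66; 67; 68; 69; 57; 58; 40; 41; 43; 44; 45; 46]%N ++ iota 10 5.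
pose F (m' : memory) := forall k, k \notin L -> m' k = m k.
have Fenv m' : F m' -> env a b0 S T ws m'.
  move=> f; apply: (env_frame (m := m)) => // k hk; apply: f; move: k hk; apply/allP.
  by [].
have cutR seen m1 g Q1 : F m1 -> R seen m1 -> G g -> (forall j : 'I_n, m1 53%N (j : nat)%:Z = g j 0) ->
    (forall m', (forall k, k \notin mods Cut -> m' k = m1 k) -> F m' ->
       R (fun f => seen f \/ f = g) m' -> Q1 m' o) ->
    runs P Cut m1 o Q1.
  move=> f1 [U1 s1 R1] Gg g53 fin1.
  have [[e0 _ _ _] [_ e25 e26 _ e28]] := Fenv _ f1.
  apply: (runs_cut (S := S) (U := U1) (g := g)) => //; first exact: Gsmall.
  move=> m2 U2 fr2 s2 cs; apply: fin1 => //.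
    by move=> k hk; rewrite fr2 ?f1 //; apply: (notin_sub hk).
  exists U2 => //; case: cs => [[c1 -> ->]|[c1 -> [k hk ->]]].
    case: R1 => [[-> [U1E h]]|h]; [left|by right].
    by split => //; split => // f [|->]; [apply: h|rewrite -U1E].
  right; split => //; split.
    by case: R1 => [[_ [<- _]]|[_ [h _]]] //; exists g.
  move=> nav; have cut t' : simplex_inv S G U1 t' -> simplex_inv S G (cut_upd S k (U1 *m g) U1) t'.+1.
    exact: (simplex_inv_cut n0 D0 aD sv nav).
  (* The second and later cuts of a round are not counted. *)
  case: R1 => [[_ [U1E h]]|[_ [_ h]]]; last exact/simplex_inv_weaken/cut/h.
  case: start => [st|st]; last by apply: cut; rewrite U1E; apply: st.
  by have := st g Gg; rewrite -U1E /rate_sum ltNge c1.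
apply: (runs_seq P1); apply: runs_put => //=; set m0 := update _ _ _ _.
have F0 : F m0.
  by move=> k hk; rewrite /m0 (update_other _ _ _ (notin_neq hk _)).
have R0 : R (fun _ => False) m0.
  exists U; first by apply: stores_mat_frame sU; rewrite /m0 update_other.
  by left; split; [rewrite /m0; eval_update|].
apply: (runs_seq P1).
pose I (x : nat) (m' : memory) (o' : seq int) := [/\ o' = o, F m' &
  R (fun g => exists2 j : 'I_n, (j < x)%N & g = delta_mx j 0) m'].
have Rframe seen m1 m2 : m2 52%N = m1 52%N -> m2 55%N = m1 55%N -> R seen m1 -> R seen m2.
  by move=> e1 e2 [U1 s1 r1]; exists U1; rewrite ?e2 //; apply: stores_mat_frame s1.
have Rsub (seen seen' : 'cV[int]_n -> Prop) m1 : (forall g, seen' g -> seen g) -> R seen m1 -> R seen' m1.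
  move=> hs [U1 s1 r1]; exists U1 => //; case: r1 => [[h1 [h2 h3]]|]; [left|by right].
  by split => //; split => // g /hs; apply: h3.
have Fsub m1 m2 L' : (forall k, k \notin L' -> m2 k = m1 k) -> all (mem L) L' -> F m1 -> F m2.
  by move=> e sub f k hk; rewrite e ?f //; apply: (notin_sub hk).
apply: (@runs_for _ _ _ _ _ _ n I) => //.
- by have [[]] := Fenv _ F0.
- move=> x m1 m2 o' hm [h1 h2 h3]; split => //; last by apply: Rframe h3; rewrite hm.
  apply: (Fsub _ _ [:: 59%N]) h2 => // k hk; apply: hm; exact: (notin_neq hk).
- by split => //; apply: Rsub R0 => g [].
- move=> x m1 o1 hx h59 fr [-> f1 r1]; pose xx := Ordinal hx.
  have [[e0 _ _ _] _] := Fenv _ f1.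
  apply: (runs_seq P1); apply: (runs_set_unit (j := xx)) => // m2 fr2 g2.
  have f2 : F m2 by apply: Fsub fr2 _ f1.
  apply: (cutR _ _ (delta_mx xx 0) _ f2 (Rframe _ _ _ _ _ r1)) => //.
  + by rewrite fr2.
  + by rewrite fr2.
  + by apply/gensP; left; exists xx.
  move=> m3 fr3 f3 r3; split => //; apply: Rsub r3 => g [j]; rewrite ltnS leq_eqVlt.
  move=> /orP[/eqP jx|jx] ->; last by left; exists j.
  by right; congr delta_mx; apply: val_inj.
move=> m1 o1 fr1 [-> f1 r1].
pose seen (x p : nat) (g : 'cV[int]_n) := (exists j, g = delta_mx j 0) \/
  exists (i : 'I_n) (q : nat), [/\ (q < size ws)%N, (i < x)%N \/ ((i : nat) = x /\ (q < p)%N),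
     cand_ok a (idot a v') i (nth 0 ws q), g = candv a (idot a v') i (nth 0 ws q) - v' & g != 0].
pose J p x (m' : memory) (o' : seq int) := [/\ o' = o, F m' & R (seen x p) m'].
have Jins p x m2 m3 o' k0 : k0 \in L -> k0 != 52%N -> k0 != 55%N ->
   (forall k, k != k0 -> m3 k = m2 k) -> J p x m2 o' -> J p x m3 o'.
  move=> kL k52 k55 hm [h1 h2 h3]; split => //.
    apply: (Fsub _ _ [:: k0]) h2; last by rewrite /= kL.
    by move=> k hk; apply: hm; apply: (notin_neq hk); rewrite inE.
  by apply: Rframe h3; rewrite hm // eq_sym.
apply: (@runs_for _ _ _ _ _ _ n (J 0%N)) => //.
- by have [[]] := Fenv _ f1.
- by move=> x m2 m3 o' hm; apply: (Jins _ _ _ _ _ 57%N).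
- split => //; apply: Rsub r1 => g [[j ->]|[i [q [_ [|[_]] //]]]].
  by exists j.
- move=> x m2 o2 hx h57 fr2 [-> f2 r2]; pose xx := Ordinal hx.
  have [[e0 _ _ [e33 _]] _] := Fenv _ f2.
  apply: (@runs_for _ _ _ _ _ _ (size ws) (fun p => J p x)) => //.
  + by move=> p m3 m4 o' hm; apply: (Jins _ _ _ _ _ 58%N).
  + move=> p m3 o3 hp h58 fr3 [-> f3 r3].
    have h57' : m3 57%N 0 = x%:Z by rewrite fr3.
    apply: (runs_seq P1); apply: runs_put => //=; rewrite h57'.
    apply: (runs_seq P1); apply: runs_put => //=.
    rewrite update_other // h58; set m4 := update _ _ _ _.
    have m4E k : k \notin [:: 40; 41]%N -> m4 k = m3 k.
      by move=> hk; rewrite /m4 !(update_other _ _ _ (notin_neq hk _)).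
    have f4 : F m4 by apply: Fsub m4E _ f3.
    pose w := nth 0 ws p; have ww : w \in ws by apply: mem_nth.
    have /(boxesP _ N0 (leqnn n))[w0 _ _] := ww.
    apply: (runs_seq P1); apply: (runs_cand (i := xx) (p := p) (b' := idot a v') _ _ _ (Fenv _ f4)) => //.
    * by rewrite f4.
    move=> m5 fr5 g43 g44.
    have f5 : F m5 by apply: Fsub fr5 _ f4.
    have r5 : R (seen x p) m5 by apply: Rframe r3; rewrite fr5 ?m4E.
    have skip : (forall g, seen x p.+1 g -> seen x p g) -> runs P Skip m5 o (J p.+1 x).
      by move=> hs; apply: runs_skip => //; split => //; apply: Rsub r5.
    have seenS g : seen x p.+1 g -> seen x p g \/ [/\ cand_ok a (idot a v') xx w,
        g = candv a (idot a v') xx w - v' & g != 0].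
      case=> [|[i [q [h1 h2 h3 h4 h5]]]]; first by left; left.
      case: h2 => [ix|[ix]]; first by left; right; exists i, q; split => //; left.
      rewrite ltnS leq_eqVlt => /orP[/eqP qp|qp]; last by left; right; exists i, q; split => //; right.
      have ixx : i = xx by apply: val_inj.
      by right; rewrite /w -qp -ixx; split.
    apply: runs_if => //=; rewrite g44 -/w; case ok: (cand_ok a (idot a v') xx w) => //= _; last first.
      by apply: skip => g /seenS[|[]] //; rewrite ok.
    apply: (runs_seq P1); apply: (runs_set_diff (y := candv a (idot a v') xx w) (v := v')) => //.
    * by have [[]] := Fenv _ f5.
    * by move=> i; rewrite f5.
    move=> m6 fr6 g53 g69.
    have f6 : F m6 by apply: Fsub fr6 _ f5.
    have r6 : R (seen x p) m6 by apply: Rframe r5; rewrite fr6.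
    apply: runs_if => //=; rewrite ?g69 => c; last first.
      apply: runs_skip => //; split => //; apply: Rsub r6 => g /seenS[|[_ -> hg]] //.
      by move: c; rewrite ltNge g69 hg.
    apply: (cutR _ _ (candv a (idot a v') xx w - v') _ f6 r6) => //.
      by apply/gensP; right; exists xx, w; split => //; rewrite -subr_eq0.
    move=> m7 fr7 f7 r7; split => //; apply: Rsub r7 => g /seenS[|[_ ->]]; first by left.
    by right.
  + move=> m3 o3 fr3 [-> f3 r3]; split => //; apply: Rsub r3 => g [|[i [q [h1 h2 h3 h4 h5]]]].
      by left.
    right; exists i, q; split => //; case: h2 => [|[_]] //; rewrite ltnS leq_eqVlt.
    by move=> /orP[/eqP ->|]; [right|left].
move=> m2 o2 fr2 [-> f2 [U2 s2 r2]]; apply: (fin _ U2) => //.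
  move=> k hk; apply: f2; apply: (notin_sub hk) => //.
case: r2 => [[h1 [-> h2]]|[h1 [_ h2]]]; [left|by right].
split => // g Gg; apply: h2; move/gensP: Gg => [|[i [w [wb ok cv ->]]]]; first by left.
right; exists i, (index w ws); rewrite nth_index // index_mem; split => //; last by rewrite subr_eq0.
by left.
Qed.

Lemma averaged_not_certified (n : nat) (a v : 'cV[int]_n) (b : int) :
  averaged a b v -> ~ certified a b v.
Proof.
move=> [m [y [k [hy [i0 hi0] hs]]]] [c hc].
have pos i : 0 < idot c (y i - v).
  by have [sy yv] := hy i; rewrite idotBr subr_gt0; apply: hc.
have := congr1 (idot c) hs; rewrite idot_sum idot0r (bigD1 i0) //=.
apply/eqP; rewrite gt_eqF //; apply: ltr_wpDr; last by rewrite pmulrn_lgt0.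
by apply: sumr_ge0 => i _; rewrite mulrn_wge0 // ltW.
Qed.

Lemma runs_test P n Dl (a v : 'cV[int]_n) (b b0 : int) (m : memory) o Q :
  let S := (n * Dl)%N in let ws := boxes n (4 * Dl ^ 2) n in
  (1 < P)%N -> (n <= P)%N -> (0 < n)%N -> (0 < Dl)%N -> (2200 * S ^ 8 <= P)%N ->
  (size ws <= P)%N -> (forall j, `|a j 0| <= Dl%:Z) -> sol a b v ->
  env a b0 S (2200 * S ^ 8) ws m ->
  (forall i : 'I_n, m 50%N (i : nat)%:Z = v i 0) ->
  (forall m', (forall k, k \notin mods Test -> m' k = m k) ->
     (m' 55%N 0 <= 0 /\ certified a b v) \/ (0 < m' 55%N 0 /\ ~ certified a b v) -> Q m' o) ->
  runs P Test m o Q.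
Proof.
move=> S ws P1 nP n0 D0 SP wsP aD sv ev m50 fin.
have S0 : (0 < S)%N by rewrite muln_gt0 n0.
have S38 : (S ^ 3 <= S ^ 8)%N by rewrite leq_pexp2l.
have S3P : (54 * S ^ 3 <= P)%N.
  by apply: leq_trans SP; apply: leq_mul.
have DP : (Dl <= P)%N.
  apply: leq_trans (_ : S <= _)%N; first by rewrite leq_pmull.
  apply: leq_trans S3P; apply: leq_trans (_ : S ^ 3 <= _)%N; last by rewrite leq_pmull.
  by rewrite -{1}[S]expn1 leq_pexp2l.
have [vb v0] := sv.
pose v' := truncate (S ^ 2)%:Z v.
have [[e0 e1 ea _] [e23 _ _ e27 e28]] := ev.
have env' m' : (forall k, k \notin mods Test -> m' k = m k) -> env a b0 S (2200 * S ^ 8) ws m'.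
  move=> f; apply: (env_frame (m := m)) => // k hk; apply: f; move: k hk; apply/allP.
  by [].
pose F (m' : memory) := forall k, k \notin mods Test -> m' k = m k.
apply: (runs_seq P1).
pose I1 (x : nat) (m' : memory) (o' : seq int) := [/\ o' = o,
  forall k, k \notin [:: 51; 62]%N -> m' k = m k &
  forall i : 'I_n, (i < x)%N -> m' 51%N (i : nat)%:Z = v' i 0].
apply: (@runs_for _ _ _ _ _ _ n I1) => //.
- move=> x m1 m2 o' hm [h1 h2 h3]; split => //.
    by move=> k hk; rewrite hm ?h2 //; apply: (notin_neq hk).
  by move=> i hi; rewrite hm // h3.
- move=> x m1 o1 hx h62 fr [-> h2 h3]; pose xx := Ordinal hx.
  have put z : z = v' xx 0 -> I1 x.+1 (update m1 51 x%:Z z) o.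
    move=> ->; split => //.
      by move=> k hk; rewrite (update_other _ _ _ (notin_neq hk _)) // h2.
    move=> i; rewrite ltnS leq_eqVlt => /orP[/eqP ix|ix]; eval_update.
      by have -> : i = xx by [apply: val_inj]; rewrite eqxx.
    by rewrite eqz_nat (ltn_eqF ix) h3.
  apply: runs_if => //=; rewrite h62 !h2 // e23 (m50 xx) => c; apply: runs_put => //=; rewrite h62 !h2 // ?(m50 xx) ?e23; apply: put.
    by rewrite mxE min_l.
  by rewrite mxE min_r // ltW.
move=> m1 o1 fr1 [-> h2 h3].
have h51 (i : 'I_n) : m1 51%N (i : nat)%:Z = v' i 0 by rewrite h3.
apply: (runs_seq P1); apply: (@runs_dot _ _ _ _ _ _ n) => //.
- by rewrite h2.
- by move=> j jn; rewrite h2 // (ea (Ordinal jn)); have := aD (Ordinal jn); rewrite -abszE lez_nat => h; apply: leq_trans h DP.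
move=> m2 fr2 h14.
have {}h14 : m2 14%N 0 = idot a v'.
  by rewrite h14 /=; apply: eq_bigr => j _; rewrite add0r h51 h2 // ea mulrC.
apply: (runs_seq P1); apply: runs_put => //=; rewrite h14; set m3 := update _ _ _ _.
have m3E k : k \notin [:: 42; 51; 62]%N ++ iota 10 5 -> m3 k = m k.
  move=> hk; rewrite /m3 (update_other _ _ _ (notin_neq hk _)) // fr2; last by apply: (notin_sub hk).
  by apply: h2; apply: (notin_sub hk).
have h42 : m3 42%N 0 = idot a v' by rewrite /m3; eval_update.
have g51 (i : 'I_n) : m3 51%N (i : nat)%:Z = v' i 0 by rewrite /m3 update_other // fr2.
have lt1 (q r : nat) (j : 'I_n) c : (q < r)%N -> (c < n)%N -> (q * n + j == r * n + c)%N = false.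
  by move=> qr cn; rewrite divn_muln_add_lt // (ltn_eqF qr).
apply: (runs_seq P1).
pose I2 (x : nat) (m' : memory) (o' : seq int) := [/\ o' = o,
  forall k, k \notin [:: 52; 60; 62]%N -> m' k = m3 k &
  forall i j : 'I_n, (i < x)%N -> m' 52%N (i * n + j)%N%:Z = (1%:M : 'M[int]_n) i j].
apply: (@runs_for _ _ _ _ _ _ n I2) => //.
- by rewrite m3E.
- move=> x m4 m5 o' hm [f1 f2 f3]; split => //.
    by move=> k hk; rewrite hm ?f2 //; apply: (notin_neq hk).
  by move=> i j hi; rewrite hm // f3.
- move=> x m4 o4 hx h60 fr4 [-> f2 f3]; pose xx := Ordinal hx.
  pose I3 (c : nat) (m' : memory) (o' : seq int) := [/\ o' = o,
    forall k, k \notin [:: 52; 62]%N -> m' k = m4 k,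
    forall i j : 'I_n, (i < x)%N -> m' 52%N (i * n + j)%N%:Z = (1%:M : 'M[int]_n) i j &
    forall j : 'I_n, (j < c)%N -> m' 52%N (x * n + j)%N%:Z = 0].
  apply: (runs_seq P1); apply: (@runs_for _ _ _ _ _ _ n I3) => //.
  + by rewrite f2 // m3E.
  + move=> c m5 m6 o' hm [k1 k2 k3 k4]; split => //.
    * by move=> k hk; rewrite hm ?k2 //; apply: (notin_neq hk).
    * by move=> i j hi; rewrite hm // k3.
    * by move=> j hj; rewrite hm // k4.
  + move=> c m5 o5 hc h62 fr5 [-> k2 k3 k4]; apply: runs_put => //=.
    rewrite h62 (k2 28%N) // (k2 60%N) // h60 (f2 28%N) // (m3E 28%N) // e28 // -PoszD.
    split => //.
    * by move=> k hk; rewrite (update_other _ _ _ (notin_neq hk _)) // k2.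
    * by move=> i j hi; eval_update; rewrite eqz_nat lt1 // k3.
    * move=> j; rewrite ltnS leq_eqVlt => /orP[/eqP jc|jc]; eval_update; first by rewrite jc eqxx.
      by case: eqP => // _; rewrite k4.
  move=> m5 o5 fr5 [-> k2 k3 k4]; apply: runs_put => //=.
  rewrite (k2 28%N) // (k2 60%N) // h60 (f2 28%N) // (m3E 28%N) // e28 // -PoszD.
  split => //.
    move=> k hk; rewrite (update_other _ _ _ (notin_neq hk _)) // k2; last by apply: (notin_sub hk).
    by apply: f2.
  move=> i j; rewrite ltnS leq_eqVlt => /orP[/eqP ix|ix]; eval_update; last first.
    by rewrite eqz_nat lt1 // k3.
  have -> : i = xx by apply: val_inj.
  by rewrite eqz_nat eqn_add2l mxE eq_sym -(val_eqE xx) /=; case: eqP => // _; rewrite k4.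
move=> m4 o4 fr4 [-> f2 f3].
have m4E k : k \notin [:: 42; 51; 52; 60; 62]%N ++ iota 10 5 -> m4 k = m k.
  by move=> hk; rewrite f2 ?m3E //; apply: (notin_sub hk).
have s4 : stores_mat (1%:M : 'M[int]_n) m4 by move=> i j; rewrite f3.
pose G g := g \in gens (4 * Dl ^ 2) a (idot a v') v'.
pose good t U := ~ averaged a b v -> simplex_inv S G U t.
have F4 : F m4.
  by move=> k hk; apply: m4E; apply: (notin_sub hk).
pose I4 (x : nat) (m' : memory) (o' : seq int) := [/\ o' = o,
  F m', m' 42%N 0 = idot a v', forall i : 'I_n, m' 51%N (i : nat)%:Z = v' i 0 &
  exists2 U, stores_mat U m' &
   ((forall g, G g -> 0 < rate_sum U g) /\ ((0 < x)%N -> m' 55%N 0 = 0)) \/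
   (good x U /\ ((0 < x)%N -> m' 55%N 0 = 1))].
apply: (@runs_for _ _ _ _ _ _ (2200 * S ^ 8) I4) => //.
- by rewrite F4.
- move=> x m5 m6 o' hm [k1 k2 k3 k4 [U k5 k6]]; split; rewrite ?hm //.
  + by move=> k hk; rewrite hm ?k2 //; apply: (notin_neq hk).
  + by exists U => //; apply: stores_mat_frame k5; rewrite hm.
- split => //; [by rewrite f2|by move=> i; rewrite f2|].
  exists 1%:M => //; right; split => // _; apply: simplex_inv_init => j.
  by apply/gensP; left; exists j.
- move=> x m5 o5 hx h56 fr5 [-> k2 k3 k4 [U k5 k6]].
  apply: (@runs_round P n Dl (2200 * S ^ 8) a v b b0 U m5 o x) => //; first exact: env'.
    by case: k6 => -[h _]; [left|right].
  move=> m6 U6 fr6 s6 res; split => //.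
  + by move=> k hk; rewrite fr6 ?k2 //; apply: (notin_sub hk).
  + by rewrite fr6.
  + by move=> i; rewrite fr6.
  + by exists U6 => //; case: res => -[q1 q2]; [left|right].
move=> m5 o5 fr5 [-> k2 k3 k4 [U k5 k6]]; apply: fin => //.
have T0 : (0 < 2200 * S ^ 8)%N by rewrite muln_gt0 expn_gt0 S0.
(* If the last round still cuts, the invariant has advanced in every round, which is impossible for
   a solution that is not averaged. *)
case: k6 => -[q1 /(_ T0) ->]; [left|right]; split => //.
  apply: (@stable_certified n Dl a v b (S ^ 2)%:Z U) => //.
    rewrite lez_nat /S expnMn leq_mul2r; apply/orP; right.
    by rewrite -{1}[n]expn1 leq_pexp2l.
  by move=> g Gg; rewrite -rate_sumE; apply: q1.
apply: averaged_not_certified; apply: contrapT => nav.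
exact: (potential_contradiction n0 D0 aD sv nav (leqnn _) (q1 nav)).
Qed.

(** * The whole program *)

Definition MaxAbs : cmd :=
  20 <~ Cst 0 ;;
  For 19 0 (
    IfLe (Get 1 (scalar 19)) (scalar 20) Skip (20 <~ Get 1 (scalar 19)) ;;
    IfLe (Minus (Cst 0) (Get 1 (scalar 19))) (scalar 20) Skip
      (20 <~ Minus (Cst 0) (Get 1 (scalar 19)))).

Definition SetMul (z : nat) (ex ey : expr) : cmd := Mul ex ey ;; z <~ scalar 12.

(** With D in array 20, arrays 21 to 27 receive 4 D^2, S, S^2, S^3, 4 S^2, 50 S^3 and 2200 S^8. The
    last is assembled as S^3 * S^3 * S^2 * 2200 so that every second factor stays within the loop
    bound. *)
Definition Params : cmd :=
  SetMul 21 (scalar 20) (scalar 20) ;;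
  SetMul 21 (scalar 21) (Cst 4) ;;
  SetMul 22 (scalar 0) (scalar 20) ;;
  SetMul 23 (scalar 22) (scalar 22) ;;
  SetMul 24 (scalar 23) (scalar 22) ;;
  SetMul 25 (scalar 23) (Cst 4) ;;
  SetMul 26 (scalar 24) (Cst 50) ;;
  SetMul 27 (scalar 24) (scalar 24) ;;
  SetMul 27 (scalar 27) (scalar 23) ;;
  SetMul 27 (scalar 27) (Cst 2200).

Definition Offsets : cmd :=
  29 <~ Cst 0 ;;
  For 18 0 (Put 28 (scalar 18) (scalar 29) ;; 29 <~ Plus (scalar 29) (scalar 0)).

Definition CheckArgmax : cmd :=
  73 <~ Cst 1 ;;
  For 74 0 (
    IfLe (Plus (scalar 74) (Cst 1)) (scalar 71)
      (IfLe (Plus (Get 43 (scalar 74)) (Cst 1)) (Get 43 (scalar 71)) Skip (73 <~ Cst 0))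
      (IfLe (Get 43 (scalar 74)) (Get 43 (scalar 71)) Skip (73 <~ Cst 0))).

(** Counters 71 and 72 are kept apart from arrays 40 and 41, and the candidate is copied to array
    50, because [Test] calls [Cand] itself. Array 42 is set in every iteration since [Test]
    overwrites it with the truncated right-hand side. *)
Definition Enumerate : cmd :=
  For 71 0 (For 72 33 (
    42 <~ Get 0 (Cst 1) ;; 40 <~ scalar 71 ;; 41 <~ scalar 72 ;; Cand ;;
    IfLe (Cst 1) (scalar 44)
      (CheckArgmax ;;
       IfLe (Cst 1) (scalar 73)
         (For 74 0 (Put 50 (scalar 74) (Get 43 (scalar 74))) ;; Test ;;
          IfLe (scalar 55) (Cst 0) (For 74 0 (Emit (Get 50 (scalar 74)))) Skip)
         Skip)
      Skip)).

Definition Vertices : cmd := MaxAbs ;; Params ;; Offsets ;; GenBoxes ;; Enumerate.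

Lemma runs_max_abs P n (a : 'cV[int]_n) (m : memory) o Q :
  (1 < P)%N -> (n <= P)%N -> m 0%N 0 = n%:Z -> (forall j : 'I_n, m 1%N (j : nat)%:Z = a j 0) ->
  (forall m', (forall k, k \notin mods MaxAbs -> m' k = m k) ->
     m' 20%N 0 = (norm_oo a)%:Z -> Q m' o) ->
  runs P MaxAbs m o Q.
Proof.
move=> P1 nP mn ma fin.
pose I (x : nat) (m' : memory) (o' : seq int) := [/\ o' = o,
  forall k, k \notin [:: 19; 20]%N -> m' k = m k,
  forall i : 'I_n, (i < x)%N -> `|a i 0| <= m' 20%N 0 & 0 <= m' 20%N 0 <= (norm_oo a)%:Z].
have aN i : `|a i 0| <= (norm_oo a)%:Z.
  by rewrite -abszE lez_nat /norm_oo (bigD1 i) //= leq_maxl.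
apply: (runs_seq P1); apply: runs_put => //=.
apply: (@runs_for _ _ _ _ _ _ n I) => //.
- by move=> x m1 m2 o' hm [h1 h2 h3 h4]; split; rewrite ?hm // => k hk; rewrite hm ?h2 //; apply: (notin_neq hk).
- split => //; first by move=> k hk; rewrite (update_other _ _ _ (notin_neq hk _)).
- move=> x m1 o1 hx h19 fr [-> h2 h3 /andP[h4 h5]]; pose xx := Ordinal hx.
  have ax : m1 1%N x%:Z = a xx 0 by rewrite h2 // (ma xx).
  have step m2 : (forall k, k \notin [:: 20]%N -> m2 k = m1 k) ->
      m1 20%N 0 <= m2 20%N 0 <= (norm_oo a)%:Z -> a xx 0 <= m2 20%N 0 -> - a xx 0 <= m2 20%N 0 -> I x.+1 m2 o.
    move=> f1 /andP[f2 f3] f4 f5; split => //.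
    - by move=> k hk; rewrite f1 ?h2 //; apply: (notin_sub hk).
    - move=> i; rewrite ltnS leq_eqVlt => /orP[/eqP ix|ix]; last exact: le_trans (h3 _ ix) f2.
      by have -> : i = xx by [apply: val_inj]; rewrite ler_norml f4 lerNl f5.
    - by rewrite f3 (le_trans h4 f2).
  have step2 m2 : (forall k, k \notin [:: 20]%N -> m2 k = m1 k) ->
      m1 20%N 0 <= m2 20%N 0 <= (norm_oo a)%:Z -> a xx 0 <= m2 20%N 0 ->
      runs P (IfLe (Minus (Cst 0) (Get 1 (scalar 19))) (scalar 20) Skip
        (20 <~ Minus (Cst 0) (Get 1 (scalar 19)))) m2 o (I x.+1).
    move=> f1 /andP[f2 f3] f4; apply: runs_if => //=; rewrite (f1 19%N) // (f1 1%N) // h19 ax sub0r => c.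
      by apply: runs_skip => //; apply: step => //; rewrite f2.
    apply: runs_put => //=; rewrite (f1 19%N) // (f1 1%N) // h19 ax sub0r; apply: step; eval_update.
    - by move=> k hk; rewrite (update_other _ _ _ (notin_neq hk _)) // f1.
    - rewrite (le_trans f2 (ltW c)) /=; apply: le_trans (aN xx).
      by rewrite -normrN ler_norm.
    - by apply: le_trans f4 (ltW c).
    - by [].
  apply: (runs_seq P1); apply: runs_if => //=; rewrite h19 ax => c.
    by apply: runs_skip => //; apply: step2 => //; rewrite lexx h5.
  apply: runs_put => //=; rewrite h19 ax; apply: step2; eval_update.
  - by move=> k hk; rewrite (update_other _ _ _ (notin_neq hk _)).
  - by rewrite ltW //=; apply: le_trans (aN xx); rewrite ler_norm.
  - by [].
move=> m1 o1 fr [-> h2 h3 /andP[h4 h5]]; apply: fin.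
  by move=> k hk; rewrite h2 //; apply: (notin_sub hk).
apply/eqP; rewrite eq_le h5 /= -(gez0_abs h4) lez_nat /norm_oo; apply/bigmax_leqP => i _.
by rewrite -lez_nat abszE (gez0_abs h4); apply: h3.
Qed.

Lemma runs_set_mul P z ex ey (m : memory) o (x y : int) Q :
  (1 < P)%N -> 10%N \notin reads ex -> eval m ex = x -> eval m ey = y -> (absz y <= P)%N ->
  (forall m', (forall k, k \notin [:: z; 10; 11; 12]%N -> m' k = m k) ->
     m' z 0 = x * y -> Q m' o) ->
  runs P (SetMul z ex ey) m o Q.
Proof.
move=> P1 hx ex1 ey1 yP fin; apply: (runs_seq P1); apply: runs_mul => //; first by rewrite ey1.
move=> m1 fr1; rewrite ex1 ey1 => e; apply: runs_put => //=; rewrite e; apply: fin.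
  move=> k; rewrite inE negb_or => /andP[kz hk]; rewrite update_other // fr1 //.
by rewrite updE !eqxx.
Qed.

Lemma runs_params P n Dl (m : memory) o Q :
  let S := (n * Dl)%N in
  (1 < P)%N -> (0 < S)%N -> (2200 * S ^ 8 <= P)%N -> (Dl <= P)%N ->
  m 0%N 0 = n%:Z -> m 20%N 0 = Dl%:Z ->
  (forall m', (forall k, k \notin mods Params -> m' k = m k) ->
     [/\ m' 21%N 0 = (4 * Dl ^ 2)%:Z, m' 23%N 0 = (S ^ 2)%:Z,  m' 25%N 0 = 4 * S%:R ^+ 2,
         m' 26%N 0 = 50 * S%:R ^+ 3 & m' 27%N 0 = (2200 * S ^ 8)%:Z] -> Q m' o) ->
  runs P Params m o Q.
Proof.
move=> S P1 S0 SP DP mn m20 fin.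
have pw k : (k <= 8)%N -> (S ^ k <= P)%N.
  move=> k8; apply: leq_trans SP; apply: leq_trans (_ : S ^ 8 <= _)%N; last exact: leq_pmull.
  by rewrite leq_pexp2l.
have cP (c : nat) : (c <= 2200)%N -> (c <= P)%N.
  move=> h; apply: leq_trans h _; apply: leq_trans SP; apply: leq_pmulr.
  by rewrite expn_gt0 S0.
apply: (runs_seq P1); apply: (runs_set_mul (x := Dl%:Z) (y := Dl%:Z)) => // m1 f1 e1.
apply: (runs_seq P1); apply: (runs_set_mul (x := Dl%:Z * Dl%:Z) (y := 4)) => //; first exact: cP.
move=> m2 f2 e2.
apply: (runs_seq P1); apply: (runs_set_mul (x := n%:Z) (y := Dl%:Z)) => //=; rewrite ?f2 ?f1 // => m3 f3 e3.
have {}e3 : m3 22%N 0 = S%:Z by rewrite e3 -PoszM.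
apply: (runs_seq P1); apply: (runs_set_mul (x := S%:Z) (y := S%:Z)) => //=; first exact: (pw 1%N).
move=> m4 f4 e4.
apply: (runs_seq P1); apply: (runs_set_mul (x := S%:Z * S%:Z) (y := S%:Z)) => //=; rewrite ?f4 //; first exact: (pw 1%N).
move=> m5 f5 e5.
apply: (runs_seq P1); apply: (runs_set_mul (x := S%:Z * S%:Z) (y := 4)) => //=; rewrite ?f5 //; first exact: cP.
move=> m6 f6 e6.
apply: (runs_seq P1); apply: (runs_set_mul (x := S%:Z * S%:Z * S%:Z) (y := 50)) => //=; rewrite ?f6 //; first exact: cP.
move=> m7 f7 e7.
have m724 : m7 24%N 0 = S%:Z * S%:Z * S%:Z by rewrite f7 // f6.
apply: (runs_seq P1); apply: (runs_set_mul (x := S%:Z * S%:Z * S%:Z) (y := S%:Z * S%:Z * S%:Z)) => //=.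
  by have := pw 3%N isT; rewrite !expnS expn0 muln1 mulnA.
move=> m8 f8 e8.
apply: (runs_seq P1); apply: (runs_set_mul (x := S%:Z * S%:Z * S%:Z * (S%:Z * S%:Z * S%:Z)) (y := S%:Z * S%:Z)) => //=.
- by rewrite f8 // f7 // f6 // f5.
- by have := pw 2%N isT; rewrite !expnS expn0 muln1.
move=> m9 f9 e9.
apply: (runs_set_mul (x := S%:Z * S%:Z * S%:Z * (S%:Z * S%:Z * S%:Z) * (S%:Z * S%:Z)) (y := 2200)) => //=; first exact: cP.
move=> m10 f10 e10; apply: fin.
  move=> k hk; rewrite f10 ?f9 ?f8 ?f7 ?f6 ?f5 ?f4 ?f3 ?f2 ?f1 //; by apply: (notin_sub hk).
have SZ : (S%:R : int) = S%:Z by rewrite natz.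
split.
- by rewrite f10 // f9 // f8 // f7 // f6 // f5 // f4 // f3 // e2 -mulnn !PoszM mulrC.
- by rewrite f10 // f9 // f8 // f7 // f6 // f5 // e4 -mulnn PoszM.
- by rewrite f10 // f9 // f8 // f7 // e6 SZ expr2 mulrC.
- by rewrite f10 // f9 // f8 // e7 SZ; ring.
- rewrite e10 -[(2200 * S ^ 8)%N%:Z]natz natrM natrX SZ; ring.
Qed.

Lemma runs_offsets P n (m : memory) o Q :
  (1 < P)%N -> (n <= P)%N -> m 0%N 0 = n%:Z ->
  (forall m', (forall k, k \notin mods Offsets -> m' k = m k) ->
     (forall r : nat, (r < n)%N -> m' 28%N r%:Z = (r * n)%:Z) -> Q m' o) ->
  runs P Offsets m o Q.
Proof.
move=> P1 nP mn fin; apply: (runs_seq P1); apply: runs_put => //=.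
pose I (x : nat) (m' : memory) (o' : seq int) := [/\ o' = o,
  forall k, k \notin [:: 18; 28; 29]%N -> m' k = m k, m' 29%N 0 = (x * n)%:Z &
  forall r : nat, (r < x)%N -> m' 28%N r%:Z = (r * n)%:Z].
apply: (@runs_for _ _ _ _ _ _ n I) => //.
- move=> x m1 m2 o' hm [h1 h2 h3 h4]; split; rewrite ?hm // => k hk.
  by rewrite hm ?h2 //; apply: (notin_neq hk).
- by split => // k hk; rewrite (update_other _ _ _ (notin_neq hk _)).
- move=> x m1 o1 hx h18 fr [-> h2 h3 h4].
  apply: (runs_seq P1); apply: runs_put => //=; apply: runs_put => //=.
  rewrite update_other // update_other // h18 h3 h2 // mn -PoszD; split.
  + by [].
  + by move=> k hk; rewrite !(update_other _ _ _ (notin_neq hk _)) // h2.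
  + by eval_update; rewrite mulSn addnC.
  + move=> r; rewrite ltnS leq_eqVlt => /orP[/eqP ->|rx]; eval_update; first by [].
    by rewrite eqz_nat (ltn_eqF rx) h4.
by move=> m1 o1 fr [-> h2 h3 h4]; apply: fin => // k hk; rewrite h2 //; apply: (notin_sub hk).
Qed.

Lemma runs_check_argmax P n (y : 'cV[int]_n) (i : 'I_n) (m : memory) o Q :
  (1 < P)%N -> (n <= P)%N -> m 0%N 0 = n%:Z -> m 71%N 0 = (i : nat)%:Z ->
  (forall j : 'I_n, m 43%N (j : nat)%:Z = y j 0) ->
  (forall m', (forall k, k \notin mods CheckArgmax -> m' k = m k) ->
     m' 73%N 0 = (first_argmax y i : nat)%:Z -> Q m' o) ->
  runs P CheckArgmax m o Q.
Proof.
move=> P1 nP mn m71 m43 fin; apply: (runs_seq P1); apply: runs_put => //=.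
pose ok (j : 'I_n) := if (j < i)%N then y j 0 + 1 <= y i 0 else y j 0 <= y i 0.
pose I (x : nat) (m' : memory) (o' : seq int) := [/\ o' = o,
  forall k, k \notin [:: 73; 74]%N -> m' k = m k &
  m' 73%N 0 = ([forall j : 'I_n, (j < x)%N ==> ok j] : nat)%:Z].
apply: (@runs_for _ _ _ _ _ _ n I) => //.
- move=> x m1 m2 o' hm [h1 h2 h3]; split; rewrite ?hm // => k hk.
  by rewrite hm ?h2 //; apply: (notin_neq hk).
- split => //; first by move=> k hk; rewrite (update_other _ _ _ (notin_neq hk _)).
  by eval_update; rewrite (_ : [forall j, _] = true) //; apply/forallP.
- move=> x m1 o1 hx h74 fr [-> h2 h3]; pose xx := Ordinal hx.
  have allS : [forall j : 'I_n, (j < x.+1)%N ==> ok j] = [forall j : 'I_n, (j < x)%N ==> ok j] && ok xx.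
    apply/forallP/andP => [hf|[/forallP hf hx'] j].
      split; last by have := hf xx; rewrite /= ltnSn.
      by apply/forallP => j; apply/implyP => jx; have := hf j; rewrite ltnS ltnW.
    apply/implyP; rewrite ltnS leq_eqVlt => /orP[/eqP jx|jx]; last by have := hf j; rewrite jx.
    by have -> : j = xx by apply: val_inj.
  have v43 : m1 43%N x%:Z = y xx 0 by rewrite h2 // (m43 xx).
  have w43 : m1 43%N (i : nat)%:Z = y i 0 by rewrite h2 // m43.
  have v71 : m1 71%N 0 = (i : nat)%:Z by rewrite h2.
  have good : ok xx -> runs P Skip m1 o (I x.+1).
    by move=> g; apply: runs_skip => //; split => //; rewrite allS g andbT.
  have bad : ok xx = false -> runs P (73 <~ Cst 0) m1 o (I x.+1).
    move=> g; apply: runs_put => //; split => //.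
      by move=> k hk; rewrite (update_other _ _ _ (notin_neq hk _)) // h2.
    by eval_update; rewrite allS g andbF.
  have xi : (x%:Z + 1 <= (i : nat)%:Z) = (x < i)%N by rewrite -lez_nat -addn1 PoszD.
  apply: runs_if => //=; rewrite h74 v71 => c.
    apply: runs_if => //=; rewrite h74 v71 v43 w43 => d.
      by apply: good; rewrite /ok /= -xi c.
    by apply: bad; rewrite /ok /= -xi c leNgt d.
  have c' : (x < i)%N = false by rewrite -xi leNgt c.
  apply: runs_if => //=; rewrite h74 v71 v43 w43 => d.
    by apply: good; rewrite /ok /= c'.
  by apply: bad; rewrite /ok /= c' leNgt d.
move=> m1 o1 fr [-> h2 h3]; apply: fin.
  by move=> k hk; rewrite h2 //; apply: (notin_sub hk).
rewrite h3; congr (nat_of_bool _)%:Z; apply: eq_forallb => j.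
by rewrite ltn_ord.
Qed.

Definition accepted (n : nat) (a : 'cV[int]_n) (b : int) (i : 'I_n) (w : 'cV[int]_n) : bool :=
  [&& cand_ok a b i w, first_argmax (candv a b i w) i & `[< certified a b (candv a b i w) >]].

Definition accepted_row (n : nat) (a : 'cV[int]_n) (b : int) (ws : seq 'cV[int]_n) (i : 'I_n) :=
  [seq candv a b i w | w <- ws & accepted a b i w].

Definition vertex_list (n N : nat) (a : 'cV[int]_n) (b : int) : seq 'cV[int]_n :=
  flatten [seq accepted_row a b (boxes n N n) i | i <- enum 'I_n].

Lemma encode_cat (n : nat) (s1 s2 : seq 'cV[int]_n) : encode (s1 ++ s2) = encode s1 ++ encode s2.
Proof. by rewrite /encode map_cat flatten_cat. Qed.

Lemma encode1 (n : nat) (v : 'cV[int]_n) : encode [:: v] = [seq v i 0 | i <- enum 'I_n].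
Proof. by rewrite /encode /= cats0. Qed.

Lemma runs_enumerate P n Dl (a : 'cV[int]_n) (b : int) (m : memory) Q :
  let S := (n * Dl)%N in let ws := boxes n (4 * Dl ^ 2) n in
  (1 < P)%N -> (n <= P)%N -> (0 < n)%N -> (0 < Dl)%N -> (2200 * S ^ 8 <= P)%N ->
  (size ws <= P)%N -> (Dl <= P)%N -> (forall j, `|a j 0| <= Dl%:Z) ->
  env a b S (2200 * S ^ 8) ws m ->
  (forall m', Q m' (encode (vertex_list (4 * Dl ^ 2) a b))) ->
  runs P Enumerate m [::] Q.
Proof.
move=> S ws P1 nP n0 D0 SP wsP DP aD ev fin.
have N0 : (0 < 4 * Dl ^ 2)%N by rewrite muln_gt0 expn_gt0 D0.
have aP : small P a.
  by move=> j; have := aD j; rewrite -abszE lez_nat => h; apply: leq_trans h DP.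
have envE m' : (forall k, k \notin mods Enumerate -> m' k = m k) ->
    env a b S (2200 * S ^ 8) ws m'.
  move=> f; apply: (env_frame (m := m)) => // k hk; apply: f; move: k hk; apply/allP.
  by [].
pose F (m' : memory) := forall k, k \notin mods Enumerate -> m' k = m k.
have Fsub m1 m2 L' : (forall k, k \notin L' -> m2 k = m1 k) -> all (mem (mods Enumerate)) L' -> F m1 -> F m2.
  by move=> e sub f k hk; rewrite e ?f //; apply: (notin_sub hk).
pose I (x : nat) (m' : memory) (o' : seq int) := F m' /\
  o' = encode (flatten [seq accepted_row a b ws i | i <- take x (enum 'I_n)]).
apply: (@runs_for _ _ _ _ _ _ n I) => //.
- by have [[]] := envE _ (fun k _ => erefl).
- move=> x m1 m2 o' hm [h1 h2]; split => //.
  by apply: (Fsub _ _ [:: 71%N]) h1 => // k hk; apply: hm; apply: (notin_neq hk).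
- by split => //; rewrite take0.
- move=> x m1 o1 hx h71 fr1 [f1 o1E]; pose xx := Ordinal hx.
  have [[e0 _ _ [e33 _]] _] := envE _ f1.
  pose J (p : nat) (m' : memory) (o' : seq int) := F m' /\
    o' = o1 ++ encode (accepted_row a b (take p ws) xx).
  apply: (@runs_for _ _ _ _ _ _ (size ws) J) => //.
  + move=> p m2 m3 o' hm [h1 h2]; split => //.
    by apply: (Fsub _ _ [:: 72%N]) h1 => // k hk; apply: hm; apply: (notin_neq hk).
  + by split => //; rewrite take0 cats0.
  + move=> p m2 o2 hp h72 fr2 [f2 o2E].
    have h71' : m2 71%N 0 = x%:Z by rewrite fr2.
    have [[_ e1 _ _] _] := envE _ f2.
    apply: (runs_seq P1); apply: runs_put => //=; rewrite e1.
    apply: (runs_seq P1); apply: runs_put => //=; rewrite update_other // h71'.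
    apply: (runs_seq P1); apply: runs_put => //=; rewrite !update_other // h72.
    set m3 := update _ _ _ _.
    have m3E k : k \notin [:: 40; 41; 42]%N -> m3 k = m2 k.
      by move=> hk; rewrite /m3 !(update_other _ _ _ (notin_neq hk _)).
    have f3 : F m3 by apply: Fsub m3E _ f2.
    pose w := nth 0 ws p; have ww : w \in ws by apply: mem_nth.
    have /(boxesP _ N0 (leqnn n))[w0 _ _] := ww.
    have rowS : accepted_row a b (take p.+1 ws) xx =
        accepted_row a b (take p ws) xx ++ (if accepted a b xx w then [:: candv a b xx w] else [::]).
      rewrite /accepted_row (take_nth 0 hp) -/w filter_rcons; case: ifP => _; last by rewrite cats0.
      by rewrite map_rcons cats1.
    have skip m' : F m' -> accepted a b xx w = false -> runs P Skip m' o2 (J p.+1).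
      by move=> f' h; apply: runs_skip => //; split => //; rewrite rowS h cats0.
    apply: (runs_seq P1); apply: (runs_cand (i := xx) (p := p) (b' := b) _ _ _ (envE _ f3)) => //.
    move=> m4 fr4 g43 g44.
    have f4 : F m4 by apply: Fsub fr4 _ f3.
    rewrite -/w in g43 g44; set y := candv a b xx w in g43.
    apply: runs_if => //=; rewrite g44; case ok: (cand_ok a b xx w) => //= _; last first.
      by apply: skip => //; rewrite /accepted ok.
    have sy : sol a b y by apply: candv_sol.
    apply: (runs_seq P1); apply: (runs_check_argmax (y := y) (i := xx)) => //.
    * by have [[]] := envE _ f4.
    * by rewrite fr4 // m3E.
    move=> m5 fr5 g73.
    have f5 : F m5 by apply: Fsub fr5 _ f4.
    apply: runs_if => //=; rewrite g73; case am: (first_argmax y xx) => //= _; last first.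
      by apply: skip => //; rewrite /accepted ok -/y am.
    have [[e50 _ _ _] _] := envE _ f5.
    apply: (runs_seq P1).
    pose K (c : nat) (m' : memory) (o' : seq int) := [/\ o' = o2,
      forall k, k \notin [:: 50; 74]%N -> m' k = m5 k &
      forall j : 'I_n, (j < c)%N -> m' 50%N (j : nat)%:Z = y j 0].
    apply: (@runs_for _ _ _ _ _ _ n K) => //.
    * move=> c m6 m7 o' hm [k1 k2 k3]; split => //.
        by move=> k hk; rewrite hm ?k2 //; apply: (notin_neq hk).
      by move=> j hj; rewrite hm // k3.
    * move=> c m6 o6 hc h74 fr6 [-> k2 k3]; apply: runs_put => //=.
      rewrite h74 k2 // fr5 // (g43 (Ordinal hc)); split => //.
        by move=> k hk; rewrite (update_other _ _ _ (notin_neq hk _)) // k2.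
      move=> j; rewrite ltnS leq_eqVlt => /orP[/eqP jc|jc]; eval_update.
        by have -> : j = Ordinal hc by [apply: val_inj]; rewrite eqxx.
      by rewrite eqz_nat (ltn_eqF jc) k3.
    move=> m6 o6 fr6 [-> k2 k3].
    have f6 : F m6 by apply: Fsub k2 _ f5.
    apply: (runs_seq P1).
    apply: (@runs_test P n Dl a y b b m6) => //; first exact: envE.
      by move=> j; rewrite k3.
    move=> m7 fr7 res.
    have f7 : F m7 by apply: Fsub fr7 _ f6.
    have accE : accepted a b xx w = `[< certified a b y >] by rewrite /accepted ok -/y am.
    have no : 0 < m7 55%N 0 -> accepted a b xx w = false.
      move=> h; rewrite accE; apply/asboolP; case: res => -[] // h'.
      by move: h; rewrite ltNge h'.
    apply: runs_if => //= c; last by apply: skip => //; apply: no.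
    have yes : accepted a b xx w.
      by rewrite accE; apply/asboolP; case: res => -[] //; rewrite ltNge c.
    have [[e70 _ _ _] _] := envE _ f7.
    have [s sE] : exists s, s = [seq y i 0 | i <- enum 'I_n] by eexists.
    have sn : size s = n by rewrite sE size_map size_enum_ord.
    have s_nth (d : nat) (hd : (d < n)%N) : nth 0 s d = y (Ordinal hd) 0.
      rewrite sE (nth_map (Ordinal hd)) ?size_enum_ord //.
      by rewrite (nth_ord_enum (Ordinal hd) (Ordinal hd)).
    pose M (c : nat) (m' : memory) (o' : seq int) :=
      (forall k, k \notin [:: 74]%N -> m' k = m7 k) /\ o' = o2 ++ take c s.
    apply: (@runs_for _ _ _ _ _ _ n M) => //.
    * move=> d m8 m9 o' hm [q1 q2]; split => // k hk.
      by rewrite hm ?q1 //; apply: (notin_neq hk).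
    * by split => //; rewrite take0 cats0.
    * move=> d m8 o8 hd h74 fr8 [q1 q2]; apply: runs_emit => //=; split => //.
      rewrite h74 q1 // fr7 // (k3 (Ordinal hd)) // q2 rcons_cat -s_nth.
      by rewrite -take_nth // sn.
    * move=> m8 o8 fr8 [q1 q2]; split; first by apply: Fsub q1 _ f7.
      by rewrite rowS yes encode_cat encode1 -sE catA -o2E q2 -{1}sn take_size.
  + move=> m2 o2 fr2 [f2 o2E]; split => //.
    rewrite o2E take_size o1E -encode_cat (take_nth xx) ?size_enum_ord //.
    by rewrite (nth_ord_enum xx xx) map_rcons flatten_rcons.
- move=> m1 o1 fr [f1 ->]; rewrite take_oversize ?size_enum_ord //; exact: fin.
Qed.

Lemma runs_vertices P n (a : 'cV[int]_n) (b : int) :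
  let Dl := norm_oo a in let S := (n * Dl)%N in let ws := boxes n (4 * Dl ^ 2) n in
  (0 < n)%N -> (0 < Dl)%N -> (2200 * S ^ 8 <= P)%N -> (size ws <= P)%N ->
  runs P Vertices (store (input a b)) [::] (fun _ o => o = encode (vertex_list (4 * Dl ^ 2) a b)).
Proof.
move=> Dl S ws n0 D0 SP wsP.
have S0 : (0 < S)%N by rewrite muln_gt0 n0.
have S1P k : (k <= 8)%N -> (2200 * S ^ k <= P)%N.
  by move=> k8; apply: leq_trans SP; rewrite leq_mul2l leq_pexp2l.
have P1 : (1 < P)%N by apply: leq_trans (S1P 0%N isT).
have SleP : (S <= P)%N by apply: leq_trans (S1P 1%N isT); rewrite expn1 leq_pmull.
have nP : (n <= P)%N by apply: leq_trans SleP; apply: leq_pmulr.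
have DP : (Dl <= P)%N by apply: leq_trans SleP; apply: leq_pmull.
have NP : (4 * Dl ^ 2 <= P)%N.
  apply: leq_trans (S1P 2%N isT); apply: leq_mul => //.
  by rewrite leq_exp2r // leq_pmull.
have aD j : `|a j 0| <= Dl%:Z.
  by rewrite -abszE lez_nat /Dl /norm_oo (bigD1 j) //= leq_maxl.
set m0 := store _.
have a1 (j : 'I_n) : m0 1%N (j : nat)%:Z = a j 0.
  rewrite /m0 /=; case: insubP => [i _ /val_inj -> //|].
  by rewrite ltn_ord.
apply: (runs_seq P1); apply: (runs_max_abs (n := n) (a := a)) => // m1 f1 e20.
apply: (runs_seq P1); apply: (@runs_params P n Dl) => //; first by rewrite f1.
move=> m2 f2 [e21 e23 e25 e26 e27].
apply: (runs_seq P1); apply: (@runs_offsets P n) => //; first by rewrite f2 // f1.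
move=> m3 f3 e28.
have m3E k : k \notin mods MaxAbs ++ mods Params ++ mods Offsets -> m3 k = m0 k.
  by move=> hk; rewrite f3 ?f2 ?f1 //; apply: (notin_sub hk).
apply: (runs_seq P1); apply: (@runs_gen_boxes P n m3 _ (4 * Dl ^ 2)) => //.
- by rewrite muln_gt0 expn_gt0 D0.
- by rewrite m3E.
- by rewrite f3.
- by move=> j; rewrite m3E.
- by move=> j; rewrite m3E.
move=> m4 f4 sb.
apply: (@runs_enumerate P n Dl a b) => //.
split; split => //; rewrite ?f4 //; [| | |by rewrite f3..].
- by rewrite m3E.
- by rewrite m3E.
- by move=> j; rewrite m3E.
Qed.

(** * Running time and correctness *)

(** The number of rounds times the bound on the number of boxes: both factors are at least 1, so the
    product dominates every loop. *)
Definition loop_bound (n Dl : nat) : nat :=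
  (2200 * (n * Dl) ^ 8 * ((4 * Dl ^ 2) ^ 2 * n.+1 ^ trunc_log 2 (4 * Dl ^ 2)))%N.

(** The exponent is 44 = 12 + 8 + 8 + 4 + 4 + 8, for 2200 <= 2^12, n^8, D^8, 16 = 2^4, D^4 and (n +
    1)^log(4 D^2). The estimates are D <= 2^L <= B^L, n + 1 <= B^2 and log(4 D^2) <= 4 L. *)
Lemma loop_bound_le (R : realType) (n Dl : nat) : (0 < n)%N -> (0 < Dl)%N ->
  (loop_bound n Dl)%:R <= time_bound R 44 n Dl.
Proof.
move=> n0 D0; rewrite /time_bound.
set L := Num.max 1 _; set B := Num.max 2 _.
have L1 : 1 <= L by rewrite le_max lexx.
have L0 : 0 <= L by apply: le_trans L1.
have B2 : 2 <= B by rewrite le_max lexx.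
have B1 : 1 <= B by apply: le_trans B2; rewrite ler1n.
have B0 : 0 < B by apply: lt_le_trans B1.
have Bge0 := ltW B0.
have nB : n%:R <= B.
  by rewrite le_max; apply/orP; right; rewrite ler_peMr.
have ln2 : 0 < ln (2 : R) by rewrite ln_gt0 // ltr1n.
have lnD0 : (0 : R) < Dl%:R by rewrite ltr0n.
have lnDl : ln (Dl%:R : R) <= L * ln 2.
  by rewrite -ler_pdivrMr // /L le_max lexx orbT.
have BL (k : nat) (x : R) : x <= B ^+ k -> x <= B `^ (k%:R * L).
  move=> h; apply: le_trans h _; rewrite -powR_mulrn //; apply: ler_powR => //.
  by rewrite ler_peMr // ler0n.
have DL : Dl%:R <= B `^ L.
  rewrite -[Dl%:R]lnK ?posrE // /powR gt_eqF // ler_expR; apply: le_trans lnDl _.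
  by rewrite ler_wpM2l // ler_ln ?posrE.
have DLk (k : nat) : Dl%:R ^+ k <= B `^ (k%:R * L).
  rewrite [k%:R * L]mulrC powRrM powR_mulrn ?powR_ge0 //.
  by apply: lerXn2r => //; rewrite nnegrE ?powR_ge0.
have tlL : (trunc_log 2 (4 * Dl ^ 2))%:R <= 4 * L.
  have N0 : (0 < 4 * Dl ^ 2)%N by rewrite muln_gt0 expn_gt0 D0.
  have h : ((2 ^ trunc_log 2 (4 * Dl ^ 2))%:R : R) <= (4 * Dl ^ 2)%:R.
    by rewrite ler_nat; apply: trunc_logP.
  have : ln ((2 ^ trunc_log 2 (4 * Dl ^ 2))%:R : R) <= ln (4 * Dl ^ 2)%:R.
    by rewrite ler_ln // posrE ltr0n // expn_gt0.
  have e4 : (4%:R : R) = 2 ^+ 2 by rewrite -natrX.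
  rewrite natrX natrM natrX e4 lnM ?posrE ?exprn_gt0 // !lnXn // => h1.
  have l2 : ln (2 : R) <= L * ln 2 by rewrite ler_peMl // ltW.
  rewrite -(ler_pM2r ln2) -mulrA mulr_natl; move: h1 l2 lnDl.
  move: (L * ln 2) (ln (2 : R)) (ln (Dl%:R : R)) => y z w; lra.
have nL : ((n.+1)%:R : R) ^+ trunc_log 2 (4 * Dl ^ 2) <= B `^ (8%:R * L).
  have n2 : ((n.+1)%:R : R) <= B ^+ 2.
    apply: le_trans (_ : 2 * n%:R <= _).
      by rewrite -natrM ler_nat; lia.
    by rewrite expr2 ler_pM.
  apply: le_trans (_ : (B ^+ 2) ^+ trunc_log 2 (4 * Dl ^ 2) <= _).
    by apply: lerXn2r => //; rewrite nnegrE // exprn_ge0 // ltW.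
  rewrite -exprM -powR_mulrn //; apply: ler_powR => //.
  by rewrite natrM; move: tlL; lra.
have -> : (44%:R * L) = 12%:R * L + 8%:R * L + 8%:R * L + 4%:R * L + 4%:R * L + 8%:R * L.
  by rewrite -!mulrDl -!natrD.
have nz : (B == 0) = false by rewrite gt_eqF.
rewrite !powRD ?nz ?implybT //.
have -> : (loop_bound n Dl)%:R = 2200%:R * n%:R ^+ 8 * Dl%:R ^+ 8 * 16%:R * Dl%:R ^+ 4 *
   (n.+1)%:R ^+ trunc_log 2 (4 * Dl ^ 2) :> R.
  rewrite /loop_bound -!natrX -!natrM; congr (_%:R); rewrite !expnMn -expnD addnn.
  have e (c d x y z w : nat) : (c * (x * y) * (d * z * w) = c * x * y * d * z * w)%N by ring.
  exact: e.
have B2k (k : nat) : (2 : R) ^+ k <= B ^+ k by apply: lerXn2r; rewrite ?nnegrE // ltW.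
have le_prod (x y u v : R) : 0 <= x <= u -> 0 <= y <= v -> 0 <= x * y <= u * v.
  by move=> /andP[x0 xu] /andP[y0 yv]; rewrite mulr_ge0 // ler_pM.
have D0k (k : nat) : 0 <= (Dl%:R : R) ^+ k by rewrite exprn_ge0.
have D4 := DLk 4%N; have D8 := DLk 8%N.
have n8 : (n%:R : R) ^+ 8 <= B `^ (8%:R * L) by apply: BL; apply: lerXn2r; rewrite ?nnegrE.
have c16 : (16%:R : R) <= B `^ (4%:R * L).
  by apply: BL; apply: le_trans (B2k _); rewrite -natrX ler_nat.
have c2200 : (2200%:R : R) <= B `^ (12%:R * L).
  by apply: BL; apply: le_trans (B2k _); rewrite -natrX ler_nat.
have fin (x y : R) : 0 <= x <= y -> x <= y by case/andP.
apply: fin; apply: (le_prod); last by rewrite nL andbT exprn_ge0.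
apply: (le_prod); last by rewrite D4 D0k.
apply: (le_prod); last by rewrite c16 ler0n.
apply: (le_prod); last by rewrite D8 D0k.
apply: (le_prod); last by rewrite n8 exprn_ge0.
by rewrite c2200 ler0n.
Qed.

(** [lev Vertices] is a fixed number, so raising the loop bound to this power only changes the
    constant in the exponent. *)
Lemma time_boundX (R : realType) (C n Dl x k : nat) :
  x%:R <= time_bound R C n Dl -> (x ^ k)%:R <= time_bound R (C * k) n Dl.
Proof.
rewrite /time_bound natrX => h.
rewrite natrM -mulrA [k%:R * _]mulrC mulrA powRrM powR_mulrn ?powR_ge0 //.
by apply: lerXn2r => //; rewrite nnegrE ?powR_ge0.
Qed.

(** [stable_certified] sees only the sum of the rows, so the certificate may be presented as the
    single non-zero row of a matrix. *)
Lemma not_averaged_certified (n Dl : nat) (a v : 'cV[int]_n) (b : int) :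
  (0 < n)%N -> (0 < Dl)%N -> (forall j, `|a j 0| <= Dl%:Z) -> sol a b v ->
  ~ averaged a b v -> certified a b v.
Proof.
move=> n0 D0 aD sv nav.
have [c [hc _]] := gens_certificate n0 D0 aD sv nav.
pose U : 'M[int]_n := \matrix_(r, j) if r == Ordinal n0 then c j else 0.
apply: (@stable_certified n Dl a v b ((n * Dl) ^ 2)%:Z U) => //.
  rewrite lez_nat expnMn leq_mul2r; apply/orP; right.
  by rewrite -{1}[n]expn1 leq_pexp2l.
move=> g /hc h; rewrite (bigD1 (Ordinal n0)) //= [X in _ + X]big1 ?addr0; last first.
  by move=> r /negPf r0; apply: big1 => j _; rewrite mxE r0 mul0r.
by under eq_bigr do rewrite mxE eqxx; apply: lt_le_trans h.
Qed.

Lemma mem_vertex_list (n N : nat) (a : 'cV[int]_n) (b : int) (u : 'cV[int]_n) :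
  reflect (exists i w, [/\ w \in boxes n N n, accepted a b i w & u = candv a b i w])
    (u \in vertex_list N a b).
Proof.
apply: (iffP flatten_mapP) => [[i _ /mapP[w]]|[i [w [h1 h2 ->]]]].
  by rewrite mem_filter => /andP[h1 h2] ->; exists i, w.
by exists i; [rewrite mem_enum|apply/mapP; exists w; rewrite // mem_filter h2].
Qed.

(** The coordinate filled in by [candv] is 0 in an admissible [w], so erasing it recovers [w]; hence
    no vector repeats for a fixed [i]. *)
Lemma candvK (n : nat) (a w : 'cV[int]_n) (b : int) (i : 'I_n) :
  cand_ok a b i w -> set_coord (candv a b i w) i 0 = w.
Proof.
move=> /and3P[/eqP wi _ _]; apply/colP => j; rewrite !mxE.
by case: eqP => // /val_inj ->; rewrite wi.
Qed.

Lemma vertex_list_uniq (n N : nat) (a : 'cV[int]_n) (b : int) :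
  (0 < N)%N -> uniq (vertex_list N a b).
Proof.
move=> N0; rewrite /vertex_list; move: (enum_uniq 'I_n); elim: (enum 'I_n) => //= i s IH /andP[is_ us].
rewrite cat_uniq IH // andbT; apply/andP; split.
  rewrite map_inj_in_uniq ?filter_uniq ?boxes_uniq // => w1 w2.
  rewrite !mem_filter => /andP[/and3P[h1 _ _] _] /andP[/and3P[h2 _ _] _] e.
  by rewrite -(candvK h1) -(candvK h2) e.
apply/hasPn => u /flatten_mapP[j js /mapP[w]]; rewrite mem_filter => /andP[/and3P[_ h1 _] _] uE.
apply/negP => /mapP[w']; rewrite mem_filter => /andP[/and3P[_ h2 _] _] uE'.
have ji : j = i by apply: (first_argmax_inj (u := u)); rewrite ?uE // -uE uE'.
by move: is_; rewrite -ji js.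
Qed.

Theorem theorem10 :
  exists (c : cmd) (C : nat),
  forall (R : realType) (n : nat) (a : 'cV[int]_n) (b : int), a != 0 ->
  exists (vs : seq 'cV[int]_n) (t : nat),
    [/\ enumerates c a b vs t,
        uniq vs,
        forall v : 'cV[R]_n,
          is_vertex (@int_hull R n a b) v <->
          exists2 u : 'cV[int]_n, u \in vs & v = map_mx intr u
      & t%:R <= time_bound R C n (norm_oo a)].
Proof.
exists Vertices, (44 * lev Vertices)%N => R n a b a0.
set Dl := norm_oo a.
have aD j : `|a j 0| <= Dl%:Z.
  by rewrite -abszE lez_nat /Dl /norm_oo (bigD1 j) //= leq_maxl.
have [j aj] : exists j, a j 0 != 0.
  apply/existsP; apply: contraNT a0; rewrite negb_exists => /forallP h.
  by apply/eqP/colP => j; rewrite mxE; apply/eqP/negbNE.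
have n0 : (0 < n)%N by apply: leq_ltn_trans (ltn_ord j).
have D0 : (0 < Dl)%N.
  by rewrite -ltz_nat; apply: lt_le_trans (aD j); rewrite normr_gt0.
have N0 : (0 < 4 * Dl ^ 2)%N by rewrite muln_gt0 expn_gt0 D0.
have T0 : (0 < 2200 * (n * Dl) ^ 8)%N by rewrite muln_gt0 expn_gt0 muln_gt0 n0 D0.
have K0 : (0 < (4 * Dl ^ 2) ^ 2 * n.+1 ^ trunc_log 2 (4 * Dl ^ 2))%N.
  by rewrite muln_gt0 !expn_gt0 N0.
have [||t [m [o [run tP oE]]]] := @runs_vertices (loop_bound n Dl) n a b n0 D0 _ _.
- exact: leq_pmulr.
- by apply: leq_trans (size_boxes N0 (leqnn n)) _; apply: leq_pmull.
exists (vertex_list (4 * Dl ^ 2) a b), t; split.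
- by exists (State m o).
- exact: vertex_list_uniq.
- move=> v; split=> [/vertex_integral[u [-> su nav]]|[u /mem_vertex_list[i [w [wN acc ->]]] ->]].
    exists u => //; apply/mem_vertex_list.
    have [i [w [h1 h2 h3 h4 _]]] := cand_complete n0 D0 aD su (rigid_of_not_averaged su nav).
    exists i, w; split => //; rewrite /accepted h2 h4 h3 /=; apply/asboolP.
    exact: (not_averaged_certified n0 D0 aD su nav).
  have /and3P[ok _ /asboolP cert] := acc.
  apply: certified_vertex cert; apply: candv_sol => //.
  by have /(boxesP _ N0 (leqnn n))[] := wN.
- apply: le_trans (_ : (loop_bound n Dl ^ lev Vertices)%:R <= _); first by rewrite ler_nat.
  exact/time_boundX/loop_bound_le.
Qed.
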